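(* Let $K$ be a function field of characteristic $0$ with field of constants $k$, let $\phi\in K(x)$ be a rational function of degree greater than one, and let $\beta\in\mathbb{P}^1(K)$. Suppose that there is a finite extension $K'$ of $K$ and $\sigma\in K'(x)$ of degree one such that $\sigma\circ\phi\circ\sigma^{-1}\in k'(x)$, where $k'$ is the algebraic closure of $k$ in $K'$. For $n\ge 1$ let $K_n=K(\phi^{-n}(\beta))$. Then: (a) If $\sigma(\beta)\in \mathbb{P}^1(k')$, then there are at most finitely many primes of $K$ that ramify in $\bigcup_{n=1}^\infty K_n$. (b) If $\sigma(\beta)\notin \mathbb{P}^1(k')$ and $\phi$ is not postcritically finite, then for all sufficiently large $n$, there exists a prime of $K$ that ramifies in $K_n$ and does not ramify in $K_m$ for $m<n$.
   Context: A function field of characteristic $0$ here means a function field $K$ of characteristic $0$ and of transcendence degree $1$ over its field of constants $k$. A prime of $K$ is a place of $K$ trivial on $k$. $\phi^n$ denotes the $n$-fold composition of $\phi$ with itself, $\phi^{-n}(\beta)$ is the set of $\gamma\in\mathbb{P}^1(\overline{K})$ with $\phi^n(\gamma)=\beta$, and $K(\phi^{-n}(\beta))$ is the field generated over $K$ by this set, with the convention $K(\infty)=K$. In (b), $m,n$ are positive integers. $\phi$ is postcritically finite if the union of the forward orbits of its critical points in $\mathbb{P}^1(\overline{K})$ is finite. $\mathbb{P}^1(k')=k'\cup\{\infty\}$. *)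

(* Defs.v *)
From HB Require Import structures.
From mathcomp Require Import all_boot all_order all_algebra all_field.
From mathcomp Require Import generic_quotient.
From mathcomp Require Import boolp classical_sets cardinality.

Set Implicit Arguments.
Unset Strict Implicit.
Unset Printing Implicit Defensive.

Import GRing.Theory.
Local Open Scope classical_set_scope.
Local Open Scope ring_scope.

Section Subfields.
Variable F : fieldType.

Definition subfield_set (A : set F) : Prop := divring_closed [in A].

Definition field_gen (S : set F) : set F := smallest subfield_set S.

(* [O] is a valuation ring of its field of fractions [L]. *)
Definition valuation_ring (L O : set F) : Prop :=
  [/\ O `<=` L, subring_closed [in O] & forall x, L x -> O x \/ O x^-1].

Definition unit_of (O : set F) (u : F) : Prop := [/\ u != 0, O u & O u^-1].

End Subfields.

(* [K], an extension of [k] through [i], is an algebraic function field of one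
   variable (a finite extension of some k(t), t transcendental) whose exact
   field of constants is [k]. *)
Definition function_field_over (k K : fieldType) (i : {rmorphism k -> K}) :
    Prop :=
  (exists t : K, ~ algebraicOver i t /\
     exists (d : nat) (b : 'I_d -> K), forall y : K,
       exists2 c : 'I_d -> K,
         forall j, field_gen (range i `|` [set t]) (c j) &
         y = \sum_(j < d) c j * b j)
  /\ (forall x : K, algebraicOver i x -> range i x).

(* A place is represented by its valuation ring, which is proper and contains
   the constants; the maximal ideal is determined by it. *)
Definition prime_of (k K : fieldType) (i : {rmorphism k -> K}) (P : set K) :
    Prop :=
  [/\ valuation_ring setT P, P != setT & range i `<=` P].

(* Let [L] be an algebraic extension of K, embedded in [E] through [iota].  [P]
   ramifies in L if for some place [Q] of L above [P] the index e(Q|P) of the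
   value group K^*/P^* in the value group L^*/Q^* is greater than 1, that is,
   the value of some y in L^* is not the value of any x in K^*.  This covers
   infinite algebraic extensions; in characteristic 0 there is no
   inseparability of residue fields to be taken into account. *)
Definition ramifies_in (K E : fieldType) (iota : {rmorphism K -> E})
    (P : set K) (L : set E) : Prop :=
  exists Q : set E,
    [/\ valuation_ring L Q, iota @^-1` Q = P &
        exists y : E, [/\ L y, y != 0 &
          forall x : K, x != 0 -> ~ unit_of Q (y / iota x)]].

(* F(x) is [{fraction {poly F}}].  The representative chosen by [repr] need not
   be in lowest terms, hence the division by the gcd. *)
Section RationalFunctions.
Variable F : fieldType.
Implicit Types f g : {fraction {poly F}}.

Definition rat_gcd f : {poly F} := gcdp \n_(repr f) \d_(repr f).
Definition rat_num f : {poly F} := \n_(repr f) %/ rat_gcd f.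
Definition rat_den f : {poly F} := \d_(repr f) %/ rat_gcd f.

Definition rat_X : {fraction {poly F}} := FracField.tofrac 'X.

Definition rat_deg f : nat := (maxn (size (rat_num f)) (size (rat_den f))).-1.

(* f o g, obtained by evaluating f at the element g of the extension F(x) of F;
   it has its usual meaning unless g is a constant which is a pole of f. *)
Definition rat_comp f g : {fraction {poly F}} :=
  let ev (p : {poly F}) := (map_poly (fun c => FracField.tofrac c%:P) p).[g] in
  ev (rat_num f) / ev (rat_den f).

(* The projective line over F is [option F], [None] being infinity. *)
Definition rat_eval f (a : option F) : option F :=
  let p := rat_num f in
  let q := rat_den f in
  match a with
  | Some x => if q.[x] == 0 then None else Some (p.[x] / q.[x])
  | None => let d := rat_deg f in
            if q`_d == 0 then None else Some (p`_d / q`_d)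
  end.

(* f lies in A(x), for a subfield A of F. *)
Definition rat_over (A : set F) f : Prop :=
  exists p q : {poly F},
    [/\ forall j, A p`_j, forall j, A q`_j, q != 0 &
        f = FracField.tofrac p / FracField.tofrac q].

(* P^1(A), for a subset A of F. *)
Definition P1_of (A : set F) : set (option F) := [set None] `|` (Some @` A).

(* Multiplicity of [a] in the fibre of f through [a].  The fibre over b is the
   zero locus of the form of degree [rat_deg f] whose dehomogenization is
   num - b den (den if b is infinity); the multiplicity at infinity is the drop
   of the degree. *)
Definition rat_mult f (a : option F) : nat :=
  let h := if rat_eval f a is Some b then rat_num f - b *: rat_den f
           else rat_den f in
  if a is Some x then mup x h else (rat_deg f - (size h).-1)%N.

Definition critical_points f : set (option F) :=
  [set a | (1 < rat_mult f a)%N].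

Definition forward_orbit f (a : option F) : set (option F) :=
  [set iter n (rat_eval f) a | n in setT].

(* To be used over an algebraically closed field. *)
Definition postcritically_finite f : Prop :=
  finite_set (\bigcup_(c in critical_points f) forward_orbit f c).

End RationalFunctions.

(* Extension of scalars F(x) -> E(x). *)
Definition rat_map (F E : fieldType) (j : {rmorphism F -> E})
    (f : {fraction {poly F}}) : {fraction {poly E}} :=
  FracField.tofrac (map_poly j (rat_num f))
    / FracField.tofrac (map_poly j (rat_den f)).

Section PreimageFields.
Variables (K Kbar : fieldType) (iota : {rmorphism K -> Kbar}).
Variables (phi : {fraction {poly K}}) (beta : option K).

Definition iter_preimage (n : nat) : set (option Kbar) :=
  [set gamma |
    iter n (rat_eval (rat_map iota phi)) gamma = omap iota beta].

(* K(phi^{-n}(beta)); the point at infinity contributes no generator. *)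
Definition preimage_field (n : nat) : set Kbar :=
  field_gen (range iota `|` [set x | iter_preimage n (Some x)]).

End PreimageFields.

(* Main.v *)
(* Let kbar be the algebraic closure of the constants.  Over E = kbar K', phi is
   conjugate by a Moebius map to some Psi with coefficients in kbar, which may be
   taken to fix infinity; let t be the image of beta.

   (a) If t is constant, so are its iterated preimages under Psi.  Hence every
   K_n lies in E, and only finitely many places ramify in E over K.

   (b) Otherwise t is transcendental over kbar.  As Psi is not postcritically
   finite and has finitely many critical values, there is a critical value b0
   with infinite orbit such that Psi^l(b0) = Psi^l'(c) with l' < l never holds
   for a critical value c.  Put g = Psi^(n-1)(b0) and take a place Q of the
   algebraic closure of K at which t - g vanishes.  If x0 is a critical point above b0,
   some x with Psi^n(x) = t reduces to x0 and (x - x0)^e is a unit times t - g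
   with e > 1.  For large n the place Q avoids the finitely many places where E
   or kbar(t) is not etale over K, so that t - g generates the values of K at Q
   and x - x0 witnesses ramification in K_n.  For m < n the choice of b0 makes
   the residues of the preimages Psi^(-m)(t) distinct, hence K_m etale over K at
   Q; by Bezout and Lagrange interpolation this transfers to all the places
   above the same prime of K. *)

Require Import Defs.
From HB Require Import structures.
From mathcomp Require Import all_boot all_order all_algebra all_field.
From mathcomp Require Import generic_quotient.
From mathcomp Require Import boolp classical_sets cardinality.
From mathcomp Require Import ring.

Set Implicit Arguments.
Unset Strict Implicit.
Unset Printing Implicit Defensive.

Import GRing.Theory.
Local Open Scope classical_set_scope.
Local Open Scope ring_scope.

(** * Valuation rings *)

Section Subsets.
Variable F : fieldType.
Implicit Types (A O L : set F) (x y z : F).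

(** The value group of a place Q of Kbar is divisible, so Q has no uniformizer and no index to
    compute with. Ramification is therefore handled by comparing values: [same_values Q L M] says
    that M has no values at Q beyond those of L. The central object is [etale_closure], a field with
    the values of L that contains L, all constants and every integral root at which an integral
    polynomial over it has unit derivative; a field is shown to be unramified by placing its
    generators there. This rests on two consequences of transcendence degree one: the residue field
    at Q consists of constants, and the value group is archimedean, so that Newton's iteration
    converges without discreteness. Both follow from one remark: in a vanishing sum two terms have
    equal value. Exceptional places are encoded by finite lists of nonzero elements of Kbar which
    must be units at Q. Such a list excludes finitely many primes of K and, for a transcendental t,
    finitely many residues of t; the first serves (a), the second (b). All fields are subsets of
    Kbar; Chevalley's theorem replaces a place of L by one of Kbar. *)

Lemma subfield_setP A : subfield_set A <->
  [/\ A 1, forall x y, A x -> A y -> A (x - y)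
         & forall x y, A x -> A y -> A (x / y)].
Proof.
split=> [[A1 AB AV]|[A1 AB AV]]; split.
- by move: A1; rewrite inE.
- by move=> x y Ax Ay; have := AB x y; rewrite !inE; apply.
- by move=> x y Ax Ay; have := AV x y; rewrite !inE; apply.
- by rewrite inE.
- by move=> x y; rewrite !inE; apply: AB.
- by move=> x y; rewrite !inE; apply: AV.
Qed.

Lemma subring_setP A : subring_closed [in A] <->
  [/\ A 1, forall x y, A x -> A y -> A (x - y)
         & forall x y, A x -> A y -> A (x * y)].
Proof.
split=> [[A1 AB AV]|[A1 AB AV]]; split.
- by move: A1; rewrite inE.
- by move=> x y Ax Ay; have := AB x y; rewrite !inE; apply.
- by move=> x y Ax Ay; have := AV x y; rewrite !inE; apply.
- by rewrite inE.
- by move=> x y; rewrite !inE; apply: AB.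
- by move=> x y; rewrite !inE; apply: AV.
Qed.

Section Ring.
Variable A : set F.
Hypothesis rA : subring_closed [in A].

Lemma sr1 : A 1. Proof. by case/subring_setP: rA. Qed.
Lemma srB x y : A x -> A y -> A (x - y).
Proof. by case/subring_setP: rA => ? AB ?; apply: AB. Qed.
Lemma srM x y : A x -> A y -> A (x * y).
Proof. by case/subring_setP: rA => ? ? AM; apply: AM. Qed.
Lemma sr0 : A 0. Proof. by rewrite -(subrr 1); apply: srB; exact: sr1. Qed.
Lemma srN x : A x -> A (- x).
Proof. by move=> Ax; rewrite -sub0r; apply: srB => //; exact: sr0. Qed.
Lemma srD x y : A x -> A y -> A (x + y).
Proof. by move=> Ax Ay; rewrite -[y]opprK; apply: srB => //; apply: srN. Qed.
Lemma srX x n : A x -> A (x ^+ n).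
Proof.
move=> Ax; elim: n => [|n IH]; first by rewrite expr0; exact: sr1.
by rewrite exprS; apply: srM.
Qed.
Lemma sr_sum I (r : seq I) (P : pred I) (f : I -> F) :
  (forall i, P i -> A (f i)) -> A (\sum_(i <- r | P i) f i).
Proof. by move=> Af; apply: (big_ind A) => //; [exact: sr0|exact: srD]. Qed.
Lemma sr_nat n : A n%:R.
Proof.
by elim: n => [|n IH]; [exact: sr0|rewrite -natr1; apply: srD => //; exact: sr1].
Qed.
Lemma sr_mulrn x n : A x -> A (x *+ n).
Proof. by move=> Ax; rewrite -mulr_natr; apply: srM => //; exact: sr_nat. Qed.
Lemma sr_horner (p : {poly F}) x : (forall i, A p`_i) -> A x -> A p.[x].
Proof.
move=> Ap Ax; rewrite horner_coef; apply: sr_sum => i _.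
by apply: srM => //; apply: srX.
Qed.
Lemma sr_polyM (p q : {poly F}) :
  (forall i, A p`_i) -> (forall i, A q`_i) -> forall i, A (p * q)`_i.
Proof. by move=> Ap Aq i; rewrite coefM; apply: sr_sum => j _; apply: srM. Qed.
Lemma sr_polyB (p q : {poly F}) :
  (forall i, A p`_i) -> (forall i, A q`_i) -> forall i, A (p - q)`_i.
Proof. by move=> Ap Aq i; rewrite coefB; apply: srB. Qed.
Lemma sr_polyD (p q : {poly F}) :
  (forall i, A p`_i) -> (forall i, A q`_i) -> forall i, A (p + q)`_i.
Proof. by move=> Ap Aq i; rewrite coefD; apply: srD. Qed.
Lemma sr_polyC c : A c -> forall i, A (c%:P)`_i.
Proof. by move=> Ac i; rewrite coefC; case: ifP => // _; exact: sr0. Qed.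
Lemma sr_polyX i : A ('X : {poly F})`_i.
Proof. by rewrite coefX; exact: sr_nat. Qed.
Lemma sr_polyZ c (p : {poly F}) :
  A c -> (forall i, A p`_i) -> forall i, A (c *: p)`_i.
Proof. by move=> Ac Ap i; rewrite coefZ; apply: srM. Qed.
Lemma sr_polyXn (p : {poly F}) n :
  (forall i, A p`_i) -> forall i, A (p ^+ n)`_i.
Proof.
move=> Ap; elim: n => [|n IH]; first by rewrite expr0; apply: sr_polyC sr1.
by rewrite exprS; apply: sr_polyM.
Qed.
Lemma sr_poly_sum I (r : seq I) (P : pred I) (f : I -> {poly F}) :
  (forall i, P i -> forall j, A (f i)`_j) ->
  forall j, A (\sum_(i <- r | P i) f i)`_j.
Proof. by move=> Af j; rewrite coef_sum; apply: sr_sum => i Pi; apply: Af. Qed.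
Lemma sr_poly_prod I (r : seq I) (P : pred I) (f : I -> {poly F}) :
  (forall i, P i -> forall j, A (f i)`_j) ->
  forall j, A (\prod_(i <- r | P i) f i)`_j.
Proof.
move=> Af; apply: (big_ind (fun p : {poly F} => forall j, A p`_j)) => //.
- by apply: sr_polyC sr1.
- by move=> p q Ap Aq; apply: sr_polyM.
Qed.
Lemma sr_deriv (p : {poly F}) : (forall i, A p`_i) -> forall i, A (p^`())`_i.
Proof. by move=> Ap i; rewrite coef_deriv; apply: sr_mulrn. Qed.

(** Building the remainder by recursion on the polynomial keeps it in [A]; no division by factorials
    enters. It drives Newton's iteration and the detection of double roots modulo the maximal
    ideal. *)
Lemma sr_taylor (p : {poly F}) x h : (forall i, A p`_i) -> A x -> A h ->
  exists2 r, A r & p.[x + h] = p.[x] + h * p^`().[x] + h ^+ 2 * r.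
Proof.
elim/poly_ind: p => [|p c IH] Ap Ax Ah.
  by exists 0; [exact: sr0|rewrite deriv0 !horner0; ring].
have {}Ap i : A p`_i by have := Ap i.+1; rewrite coefD coefMX coefC /= addr0.
have [r Ar E] := IH Ap Ax Ah.
exists (p^`().[x] + r * (x + h)).
  apply: srD; first by apply: sr_horner => //; apply: sr_deriv.
  by apply: srM => //; apply: srD.
rewrite derivD derivC derivM derivX !hornerE E; ring.
Qed.

End Ring.

Section Field.
Variable A : set F.
Hypothesis fA : subfield_set A.

Lemma sf_div x y : A x -> A y -> A (x / y).
Proof. by case/subfield_setP: fA => ? ? AV; apply: AV. Qed.
Lemma sf1 : A 1. Proof. by case/subfield_setP: fA. Qed.
Lemma sfV x : A x -> A x^-1.
Proof. by move=> Ax; rewrite -div1r; apply: sf_div => //; exact: sf1. Qed.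
Lemma sf_ring : subring_closed [in A].
Proof.
apply/subring_setP; case/subfield_setP: (fA) => A1 AB AV; split=> // x y Ax Ay.
by rewrite -[y]invrK; apply: AV => //; apply: sfV.
Qed.
End Field.

Lemma field_gen_subfield S : subfield_set (@field_gen F S).
Proof.
apply/subfield_setP; split.
- by move=> A [fA _]; exact: sf1.
- by move=> x y Sx Sy A SA; apply: srB; [exact: sf_ring SA.1|exact: Sx|exact: Sy].
- by move=> x y Sx Sy A SA; apply: sf_div; [exact: SA.1|exact: Sx|exact: Sy].
Qed.

Lemma field_gen_sub S : S `<=` @field_gen F S.
Proof. exact: sub_gen_smallest. Qed.

Lemma field_gen_min S A : subfield_set A -> S `<=` A -> @field_gen F S `<=` A.
Proof. exact: smallest_sub. Qed.

Lemma range_subfield (G : fieldType) (f : {rmorphism G -> F}) :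
  subfield_set (range f).
Proof.
apply/subfield_setP; split.
- by exists 1; rewrite ?rmorph1.
- by move=> _ _ [a _ <-] [b _ <-]; exists (a - b); rewrite ?rmorphB.
- by move=> _ _ [a _ <-] [b _ <-]; exists (a / b); rewrite ?fmorph_div.
Qed.

Lemma setT_subfield : subfield_set (@setT F).
Proof. exact/subfield_setP. Qed.

End Subsets.

(* The maximal ideal of [Q]; [0] is listed apart because [0^-1 = 0]. *)
Definition maxid (F : fieldType) (Q : set F) (x : F) := x = 0 \/ ~ Q x^-1.

Section Valuation.
Variables (F : fieldType) (L Q : set F).
Hypothesis fL : subfield_set L.
Hypothesis vQ : valuation_ring L Q.
Implicit Types x y z : F.

Lemma vrS : Q `<=` L. Proof. by case: vQ. Qed.
Lemma vr_ring : subring_closed [in Q]. Proof. by case: vQ. Qed.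
Lemma vr_total x : L x -> Q x \/ Q x^-1. Proof. by case: vQ => _ _; apply. Qed.
Let rQ := vr_ring.

Lemma unitW x : unit_of Q x -> Q x. Proof. by case. Qed.
Lemma unit1 : unit_of Q 1.
Proof. by split; rewrite ?invr1 ?oner_neq0 //; exact: sr1. Qed.
Lemma unitM x y : unit_of Q x -> unit_of Q y -> unit_of Q (x * y).
Proof.
move=> [x0 Qx Qx'] [y0 Qy Qy']; split; first by rewrite mulf_neq0.
  exact: srM.
by rewrite invfM; apply: srM.
Qed.
Lemma unitV x : unit_of Q x -> unit_of Q x^-1.
Proof. by move=> [x0 Qx Qx']; split; rewrite ?invr_eq0 ?invrK. Qed.
Lemma unit_div x y : unit_of Q x -> unit_of Q y -> unit_of Q (x / y).
Proof. by move=> ux /unitV; apply: unitM. Qed.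
Lemma unitX x n : unit_of Q x -> unit_of Q (x ^+ n).
Proof.
by move=> ux; elim: n => [|n IH]; [exact: unit1|rewrite exprS; apply: unitM].
Qed.
Lemma unit_prod I (r : seq I) (P : pred I) (f : I -> F) :
  (forall i, P i -> unit_of Q (f i)) -> unit_of Q (\prod_(i <- r | P i) f i).
Proof. by move=> Af; apply: (big_ind (unit_of Q)) => //; [exact: unit1|exact: unitM]. Qed.

Lemma maxidW x : L x -> maxid Q x -> Q x.
Proof.
by move=> Lx [->|nQ]; [exact: sr0|case: (vr_total Lx)].
Qed.
Lemma maxid_nunit x : maxid Q x -> ~ unit_of Q x.
Proof. by move=> [->|nQ] [x0 Qx Qx'] //; rewrite eqxx in x0. Qed.
Lemma maxidPn x : Q x -> ~ maxid Q x -> unit_of Q x.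
Proof.
move=> Qx nm; split=> //; first by apply/eqP => x0; apply: nm; left.
by apply: contrapT => nQ; apply: nm; right.
Qed.
Lemma maxidP x : Q x -> maxid Q x \/ unit_of Q x.
Proof. by move=> Qx; case: (pselect (maxid Q x)) => [|/maxidPn]; auto. Qed.
Lemma maxidMr x y : maxid Q x -> Q y -> maxid Q (x * y).
Proof.
move=> mx Qy; case: (eqVneq x 0) => [->|x0]; first by rewrite mul0r; left.
case: (eqVneq y 0) => [->|y0]; first by rewrite mulr0; left.
right=> Qxy; case: mx => [e|nQ]; first by rewrite e eqxx in x0.
by apply: nQ; have := srM rQ Qxy Qy; rewrite invfM mulfVK.
Qed.
Lemma maxidMl x y : Q x -> maxid Q y -> maxid Q (x * y).
Proof. by rewrite mulrC => Qx my; apply: maxidMr. Qed.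
Lemma maxidN x : maxid Q x -> maxid Q (- x).
Proof.
by case=> [->|n]; [left; rewrite oppr0|right; rewrite invrN => /(srN rQ); rewrite opprK].
Qed.
Lemma maxidD x y : L x -> L y -> maxid Q x -> maxid Q y -> maxid Q (x + y).
Proof.
move=> Lx Ly mx my.
case: (eqVneq x 0) => [->|x0]; first by rewrite add0r.
case: (eqVneq y 0) => [->|y0]; first by rewrite addr0.
have Lxy : L (x / y) by apply: sf_div.
case: (vr_total Lxy) => H.
  have -> : x + y = (x / y + 1) * y by rewrite mulrDl divfK // mul1r.
  by apply: maxidMl => //; apply: srD => //; exact: sr1.
have -> : x + y = (1 + (x / y)^-1) * x by rewrite invf_div mulrDl divfK // mul1r.
by apply: maxidMl => //; apply: srD => //; exact: sr1.
Qed.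
Lemma maxidB x y : L x -> L y -> maxid Q x -> maxid Q y -> maxid Q (x - y).
Proof.
move=> Lx Ly mx my; apply: maxidD => //; last exact: maxidN.
by apply: srN => //; exact: sf_ring.
Qed.
Lemma unit_maxidD x y : unit_of Q x -> maxid Q y -> L y -> unit_of Q (x + y).
Proof.
move=> ux my Ly; have Lx := vrS (unitW ux).
have Qy := maxidW Ly my.
have Qxy : Q (x + y) by apply: srD => //; exact: unitW.
case: (maxidP Qxy) => // mxy; case: (@maxid_nunit x) => //.
rewrite -(addrK y x); apply: maxidB => //; apply: srD => //; exact: sf_ring.
Qed.
Lemma maxid_sum I (r : seq I) (P : pred I) (f : I -> F) :
  (forall i, P i -> L (f i)) ->
  (forall i, P i -> maxid Q (f i)) -> maxid Q (\sum_(i <- r | P i) f i).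
Proof.
move=> Lf Mf; suff [] : L (\sum_(i <- r | P i) f i) /\
  maxid Q (\sum_(i <- r | P i) f i) by [].
apply: (big_ind (fun x => L x /\ maxid Q x)).
- by split; [exact: sr0 (sf_ring fL)|left].
- by move=> x y [Lx mx] [Ly my]; split; [exact: srD (sf_ring fL) _ _ Lx Ly|exact: maxidD].
- by move=> i Pi; split; [exact: Lf|exact: Mf].
Qed.
Lemma maxid_prime x y : Q x -> Q y -> maxid Q (x * y) -> maxid Q x \/ maxid Q y.
Proof.
move=> Qx Qy mxy; case: (maxidP Qx) => [|ux]; first by left.
case: (maxidP Qy) => [|uy]; first by right.
by case: (maxid_nunit mxy); apply: unitM.
Qed.
(** If [x] were not in [Q], its inverse would lie in the maximal ideal, and the equation divided by
    [x ^+ n] would put the unit leading coefficient there too. *)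
Lemma vr_integral (p : {poly F}) x : L x -> root p x ->
  (forall i, Q p`_i) -> unit_of Q (lead_coef p) -> Q x.
Proof.
move=> Lx px Qp ul; apply: contrapT => nQx.
have x0 : x != 0 by apply/eqP => x0; apply: nQx; rewrite x0; exact: sr0.
have mx : maxid Q x^-1 by right; rewrite invrK.
have LV : L x^-1 by apply: sfV.
have p0 : p != 0 by case: ul; rewrite lead_coef_eq0.
set n := (size p).-1.
have sp : size p = n.+1 by rewrite /n prednK // size_poly_gt0.
case: (@maxid_nunit (lead_coef p)) => //.
suff -> : lead_coef p = - \sum_(i < n) p`_i * x^-1 ^+ (n - i).
  apply: maxidN; apply: maxid_sum => i _.
    apply: srM; [exact: sf_ring|exact: vrS|apply: srX => //; exact: sf_ring].
  apply: maxidMl => //; rewrite -(subnSK (ltn_ord i)) exprS.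
  apply: maxidMr => //; apply: srX => //; exact: maxidW.
apply/eqP; rewrite -addr_eq0; apply/eqP.
have xn : x ^+ n != 0 by rewrite expf_neq0.
apply: (mulfI xn); rewrite mulr0 -[RHS](rootP px) horner_coef sp big_ord_recr /=.
rewrite mulrDr lead_coefE -/n [RHS]addrC (mulrC (x ^+ n)); congr (_ + _).
rewrite mulr_sumr; apply: eq_bigr => j _; rewrite mulrCA; congr (_ * _).
by rewrite exprVn -{1}(subnK (ltnW (ltn_ord j))) exprD mulrAC mulfV ?mul1r // expf_neq0.
Qed.

End Valuation.

(** * Chevalley's extension theorem for valuation rings *)

Section Chevalley.
Variables (F : fieldType) (R M : set F).
Hypothesis rR : subring_closed [in R].
Hypothesis MR : M `<=` R.
Hypothesis Mn0 : forall m, M m -> m != 0.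
Hypothesis Mdir : forall m m', M m -> M m' ->
  exists m'', [/\ M m'', R (m / m'') & R (m' / m'')].
Hypothesis MV : forall m, M m -> ~ R m^-1.

Let good (B : set F) :=
  [/\ subring_closed [in B], R `<=` B & forall m, M m -> ~ B m^-1].

Let ex_max : exists B, good B /\ forall B', good B' -> B `<=` B' -> B' `<=` B.
Proof.
(* Zorn's lemma also tests the empty chain, whose union is empty; adding [R] to the candidates makes
   that case good. *)
pose P (A : set F) := good (A `|` R).
have [|A [PA maxA]] := @Zorn_bigcup F P.
  move=> C CP totC; rewrite /P.
  have sub X : C X -> X `|` R `<=` \bigcup_(X in C) X `|` R.
    by move=> CX x [Xx|Rx]; [left; exists X|right].
  have two x y : (\bigcup_(X in C) X `|` R) x -> (\bigcup_(X in C) X `|` R) y ->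
      R x /\ R y \/ exists2 X, C X & (X `|` R) x /\ (X `|` R) y.
    move=> [[X CX Xx]|Rx] [[Y CY Yy]|Ry].
    - right; case: (totC _ _ CX CY) => S.
        by exists Y => //; split; left => //; apply: S.
      by exists X => //; split; left => //; apply: S.
    - by right; exists X => //; split; [left|right].
    - by right; exists Y => //; split; [right|left].
    - by left.
  split.
  - apply/subring_setP; split.
    + by right; apply: sr1.
    + move=> x y Cx Cy; case: (two x y Cx Cy) => [[Rx Ry]|[X CX [Xx Xy]]].
        by right; apply: srB.
      by apply: (sub X CX); case: (CP _ CX) => rX _ _; apply: srB.
    + move=> x y Cx Cy; case: (two x y Cx Cy) => [[Rx Ry]|[X CX [Xx Xy]]].
        by right; apply: srM.
      by apply: (sub X CX); case: (CP _ CX) => rX _ _; apply: srM.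
  - by move=> x; right.
  - move=> m Mm [[X CX Xm]|Rm]; last exact: (MV Mm).
    by case: (CP _ CX) => _ _ /(_ m Mm); apply; left.
exists (A `|` R); split=> // B' gB' sB.
have : ~ A `<` B'.
  move=> /maxA; apply; rewrite /P setUidl //; by case: gB'.
move=> nlt; apply: contrapT => nsub; apply: nlt; split.
  by move=> x Ax; apply: sB; left.
by move=> BA; apply: nsub => x /BA; left.
Qed.

(** [M] stands for the ideal that must stay proper. Since two members of [M] have a common divisor
    in [M], a combination of them equal to 1 already yields the inverse of a single member. The uses
    take for [M] the nonzero nonunits of a valuation ring, or one element. *)
Lemma chevalley : exists B,
  [/\ valuation_ring setT B, R `<=` B & forall m, M m -> ~ B m^-1].
Proof.
have [B [[rB RB BV] maxB]] := ex_max.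
exists B; split=> //; split=> // x _.
have dirB m m' : M m -> M m' ->
    exists m'', [/\ M m'', B (m / m'') & B (m' / m'')].
  by move=> Mm Mm'; have [m'' [? ? ?]] := Mdir Mm Mm'; exists m''; split; auto.
(* The localization of [B] at the powers of [u] is again good: these powers are congruent to 1
   modulo [m], so an inverse of [m'] in it would make 1 a combination of [m] and [m'] over [B], and
   their common divisor invertible in [B]. Maximality then gives the inverse of [u]. *)
have unitB m b : M m -> B b -> B (1 - m * b)^-1.
  move=> Mm Bb; set u := 1 - m * b.
  have Bm : B m by apply/RB/MR.
  have Bu : B u by apply: srB; [|exact: sr1|exact: srM].
  have u0 : u != 0.
    rewrite /u subr_eq0 eq_sym; apply/eqP => mb1; case: (BV m Mm).
    by rewrite -(divr1_eq (x := b) (y := m^-1)) ?invrK 1?mulrC.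
  have uX i : exists2 s, B s & u ^+ i = 1 - m * s.
    elim: i => [|i [s Bs E]].
      by exists 0; rewrite ?mulr0 ?subr0 ?expr0 //; exact: sr0.
    exists (s + b - s * m * b); last by rewrite exprSr E /u; ring.
    apply: srB => //; first exact: srD.
    by apply: srM => //; apply: srM.
  apply: (maxB [set z | exists2 c, B c & exists i, z = c / u ^+ i]); last first.
  - by exists 1; [exact: sr1|exists 1%N; rewrite expr1 div1r].
  - by move=> z Bz; exists z => //; exists 0%N; rewrite expr0 divr1.
  split.
  - apply/subring_setP; split.
    + by exists 1; [exact: sr1|exists 0%N; rewrite expr0 divr1].
    + move=> _ _ [c Bc [i ->]] [c' Bc' [j ->]].
      exists (c * u ^+ j - c' * u ^+ i).
        by apply: srB => //; apply: srM => //; apply: srX.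
      exists (i + j)%N; rewrite exprD; field.
      by rewrite !expf_neq0.
    + move=> _ _ [c Bc [i ->]] [c' Bc' [j ->]].
      exists (c * c'); first exact: srM.
      exists (i + j)%N; rewrite exprD; field.
      by rewrite !expf_neq0.
  - by move=> z /RB Bz; exists z => //; exists 0%N; rewrite expr0 divr1.
  - move=> m' Mm' [c Bc [i E]].
    have [m'' [Mm'' Br Br']] := dirB _ _ Mm Mm'.
    have [s Bs Es] := uX i.
    case: (BV m'' Mm'').
    have -> : m''^-1 = m / m'' * s + m' / m'' * c.
      have m0 := Mn0 Mm'; have m''0 := Mn0 Mm''.
      have uc : m' * c = u ^+ i.
        by rewrite -[c](divfK (expf_neq0 i u0)) -E mulrA divff // mul1r.
      have : 1 = m * s + m' * c by rewrite uc Es; ring.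
      move=> /(congr1 (fun z => z / m'')); rewrite div1r => E1; by rewrite [LHS]E1; field; rewrite ?m0 ?m''0.
    by apply: (srD rB); apply: (srM rB).
(* Descent on the sizes: as [u] is invertible, the relation in [y] multiplied by [x ^+ n] expresses
   [x ^+ n] through lower powers of [x]; substituting this in the leading term of [p] lowers its
   size. *)
have key m N : M m -> forall (p q : {poly F}) (x y : F), x * y = 1 ->
    (forall i, B p`_i) -> (forall i, B q`_i) ->
    (size p + size q <= N)%N -> m * p.[x] = 1 -> m * q.[y] = 1 -> False.
  move=> Mm; have Bm : B m by apply/RB/MR.
  elim: N => [|N IH] p q {}x y xy Bp Bq.
    rewrite leqn0 addn_eq0 !size_poly_eq0 => /andP[/eqP-> _].
    by rewrite horner0 mulr0 => /esym/eqP; rewrite oner_eq0.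
  move=> sN Ep Eq.
  wlog sqp : x y p q xy Bp Bq sN Ep Eq / (size q <= size p)%N.
    move=> W; case: (leqP (size q) (size p)) => [|/ltnW] H.
      exact: (W x y p q).
    by apply: (W y x q p) => //; rewrite 1?mulrC // addnC.
  have x0 : x != 0 by apply/eqP => x0; move/eqP: xy; rewrite x0 mul0r eq_sym oner_eq0.
  have Bu := unitB m q`_0 Mm (Bq 0%N).
  set u := 1 - m * q`_0 in Bu.
  have u0 : u != 0.
    rewrite /u subr_eq0 eq_sym; apply/eqP => mb1; case: (BV m Mm).
    by rewrite -(divr1_eq (x := q`_0) (y := m^-1)) ?invrK 1?mulrC.
  have p0 : (0 < size p)%N.
    rewrite lt0n size_poly_eq0; apply/eqP => p0.
    by move/eqP: Ep; rewrite p0 horner0 mulr0 eq_sym oner_eq0.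
  set n := (size p).-1; have sp : size p = n.+1 by rewrite /n prednK.
  have yE : y = x^-1 by rewrite -[y]mul1r -(mulVf x0) -mulrA xy mulr1.
  have Equ : u = m * \sum_(j < n) q`_j.+1 * y ^+ j.+1.
    move: Eq; rewrite (@horner_coef_wide _ n.+1); last by rewrite -sp.
    rewrite big_ord_recl expr0 mulr1.
    by rewrite mulrDr /u => <-; rewrite addrC addKr; congr (_ * _); apply: eq_bigr.
  pose r := \sum_(j < n) q`_j.+1 *: 'X^(n - j.+1).
  pose p' := \poly_(i < n) p`_i + (p`_n * (u^-1 * m)) *: r.
  have sr : (size r <= n)%N.
    apply: (leq_trans (size_sum _ _ _)); apply/bigmax_leqP => j _.
    apply: (leq_trans (size_scale_leq _ _)); rewrite size_polyXn.
    by rewrite subnSK // leq_subr.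
  have Br i : B r`_i.
    move: i; apply: sr_poly_sum => // j _; apply: sr_polyZ => // i.
    by rewrite coefXn; exact: sr_nat.
  apply: (IH p' q x y) => //.
  - apply: sr_polyD => // [i|].
      by rewrite coef_poly; case: ifP => // _; exact: sr0.
    by apply: sr_polyZ => //; do 2?apply: srM.
  - have : (size p' <= n)%N.
      rewrite (leq_trans (size_polyD _ _)) // geq_max size_poly.
      by rewrite (leq_trans (size_scale_leq _ _)).
    by move: sN; rewrite sp addSn ltnS => sN sp'; apply: leq_trans sN; rewrite leq_add2r.
  - rewrite -Ep /p' hornerD hornerZ; congr (_ * _).
    rewrite (horner_coef p) sp big_ord_recr /= horner_poly; congr (_ + _).
    rewrite -mulrA; congr (_ * _).
    have -> : r.[x] = x ^+ n * \sum_(j < n) q`_j.+1 * y ^+ j.+1.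
      rewrite /r horner_sum mulr_sumr; apply: eq_bigr => j _.
      rewrite hornerZ hornerXn mulrCA; congr (_ * _).
      rewrite yE exprVn.
      have -> : x ^+ n = x ^+ (n - j.+1) * x ^+ j.+1 by rewrite -exprD subnK.
      by rewrite mulfK // expf_neq0.
    rewrite [X in _ * X]mulrC mulrA -[_ * m * _]mulrA -Equ mulVf ?mul1r //.
(* For [z] outside [B] the ring generated by [z] over [B] is strictly larger, so by maximality it
   inverts a member of [M]. *)
have gen z : ~ B z -> exists2 m, M m & exists2 p : {poly F},
    (forall i, B p`_i) & m * p.[z] = 1.
  move=> nBz; apply: contrapT => nex.
  apply: nBz; apply: (maxB [set w | exists2 p : {poly F}, (forall i, B p`_i) & w = p.[z]]).
  - split.
    + apply/subring_setP; split.
      * by exists 1; [apply: sr_polyC (sr1 rB)|rewrite hornerC].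
      * move=> _ _ [p Bp ->] [q Bq ->]; exists (p - q); last by rewrite !hornerE.
        exact: sr_polyB.
      * move=> _ _ [p Bp ->] [q Bq ->]; exists (p * q); last by rewrite !hornerE.
        exact: sr_polyM.
    + by move=> w /RB Bw; exists w%:P; [apply: sr_polyC|rewrite hornerC].
    + move=> m Mm [p Bp E]; apply: nex; exists m => //; exists p => //.
      by rewrite -E divff // Mn0.
  - by move=> w Bw; exists w%:P; [apply: sr_polyC|rewrite hornerC].
  - by exists 'X; [exact: sr_polyX|rewrite hornerX].
case: (pselect (B x)) => [|nBx]; first by left.
right; apply: contrapT => nBV.
have x0 : x != 0 by apply/eqP => x0; apply: nBx; rewrite x0; exact: sr0.
have [m Mm [p Bp Ep]] := gen _ nBx; have [m' Mm' [q Bq Eq]] := gen _ nBV.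
have [m'' [Mm'' Br Br']] := dirB _ _ Mm Mm'.
have m0 := Mn0 Mm''.
apply: (@key m'' _ Mm'' ((m / m'') *: p) ((m' / m'') *: q) x x^-1 _ _ _ (leqnn _)).
- by rewrite divff.
- exact: sr_polyZ.
- exact: sr_polyZ.
- by rewrite hornerZ mulrA [m'' * _]mulrC divfK.
- by rewrite hornerZ mulrA [m'' * _]mulrC divfK.
Qed.

End Chevalley.

(** With the nonzero nonunits of [O] as [M], the new ring meets [L] in nothing more than [O]: an
    element of [L] outside [O] is the inverse of a member of [M]. *)
Lemma extend_valuation (F : fieldType) (L O : set F) :
  subfield_set L -> valuation_ring L O -> O != L ->
  exists B, [/\ valuation_ring setT B & B `&` L = O].
Proof.
move=> fL vO OL; have rL := sf_ring fL; have rO := vr_ring vO.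
have [x Lx nOx] : exists2 x, L x & ~ O x.
  apply: contrapT => nex; move/eqP: OL; apply; apply/seteqP; split.
    exact: (vrS vO).
  by move=> x Lx; apply: contrapT => nO; apply: nex; exists x.
have xV y : L y -> ~ O y -> [/\ y != 0, O y^-1 & ~ O y^-1^-1].
  move=> Ly nOy; rewrite invrK; split=> //.
    by apply/eqP => y0; apply: nOy; rewrite y0; exact: sr0.
  by case: (vr_total vO Ly).
pose M : set F := [set m | [/\ m != 0, O m & ~ O m^-1]].
have Mdir m m' : M m -> M m' -> exists m'', [/\ M m'', O (m / m'') & O (m' / m'')].
  move=> [m0 Om nOm] [m'0 Om' nOm'].
  have Lmm' : L (m / m') by apply: sf_div => //; exact: (vrS vO).
  case: (vr_total vO Lmm') => H.
    by exists m'; split => //; rewrite divff //; exact: sr1.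
  by exists m; split => //; [rewrite divff //; exact: sr1|rewrite -invf_div].
have [|||B [vB OB BV]] := @chevalley F O M rO _ _ Mdir; do ?by move=> m [].
exists B; split=> //; apply/seteqP; split=> [y [By Ly]|y Oy]; last first.
  by split; [exact: OB|exact: (vrS vO)].
apply: contrapT => nOy; have [y0 OV nOV] := xV y Ly nOy.
apply: (BV y^-1); last by rewrite invrK.
by split => //; rewrite invr_eq0.
Qed.

Section Tie.
Variables (F : fieldType) (L Q : set F).
Hypothesis fL : subfield_set L.
Hypothesis vQ : valuation_ring L Q.

Lemma max_value (I : finType) (z : I -> F) (i0 : I) :
  (forall i, L (z i)) -> z i0 != 0 ->
  exists2 i, z i != 0 & forall j, Q (z j / z i).
Proof.
move=> Lz z0.
suff : forall s : seq I, i0 \in s ->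
    exists2 i, z i != 0 & forall j, j \in s -> Q (z j / z i).
  case/(_ (enum I)); first by rewrite mem_enum.
  by move=> i zi H; exists i => // j; apply: H; rewrite mem_enum.
suff H : forall s : seq I, exists2 i, z i != 0 & forall j, j \in s -> Q (z j / z i).
  by move=> s _; apply: H.
elim=> [|j s [i zi H]]; first by exists i0.
case: (eqVneq (z j) 0) => [zj|zj].
  exists i => // l; rewrite inE => /orP[/eqP->|]; last exact: H.
  by rewrite zj mul0r; apply: sr0 (vr_ring vQ).
have Lij : L (z j / z i) by apply: sf_div.
case: (vr_total vQ Lij) => Qij.
  by exists i => // l; rewrite inE => /orP[/eqP->|]; [|exact: H].
exists j => // l; rewrite inE => /orP[/eqP->|/H Qli].
  by rewrite divff //; exact: sr1 (vr_ring vQ).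
have Q' : Q (z i / z j) by rewrite -invf_div.
have -> : z l / z j = z l / z i * (z i / z j) by field; rewrite zi zj.
exact: (srM (vr_ring vQ)).
Qed.

(** Divide by a term that divides all the others in [Q]: if every other quotient lay in the maximal
    ideal, the sum would be a unit. *)
Lemma tie (I : finType) (z : I -> F) (i0 : I) :
  (forall i, L (z i)) -> z i0 != 0 -> \sum_i z i = 0 ->
  exists i j, [/\ i != j, z i != 0, z j != 0 & unit_of Q (z i / z j)].
Proof.
move=> Lz z0 S0; have [i zi H] := max_value Lz z0.
apply: contrapT => nex.
have : unit_of Q (1 + \sum_(j | j != i) z j / z i).
  apply: (@unit_maxidD _ L) => //.
  - exact: unit1 vQ.
  - apply: (@maxid_sum _ L) => // j ji; first exact: sf_div.
    case: (maxidP (H j)) => // u; case: nex; exists j, i; split => //.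
    by case: u => /[!mulf_eq0] /norP[].
  - by apply: sr_sum => [|j _]; [exact: sf_ring|exact: sf_div].
case=> /negP[]; apply/eqP; rewrite -mulr_suml.
by apply: (mulIf zi); rewrite mulrDl divfK // mul1r mul0r -[RHS]S0 [RHS](bigD1 i).
Qed.

End Tie.

(** * Algebraic elements over a subfield *)

Section SubfieldType.
Variables (F : fieldType) (A : set F).

(** The proof [fA] is a parameter so that a field structure can be attached to the predicate; [A]
    becomes a type to which matrices and [algebraicOver] apply. *)
Definition subfield_pred (fA : subfield_set A) : {pred F} := [in A].
Variable fA : subfield_set A.
HB.instance Definition _ :=
  GRing.isDivringClosed.Build F (subfield_pred fA) fA.

Record subfield_type :=
  SubfieldType { subfield_val :> F; _ : subfield_val \in subfield_pred fA }.
HB.instance Definition _ := [isSub for subfield_val].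
HB.instance Definition _ := [Choice of subfield_type by <:].
HB.instance Definition _ := [SubChoice_isSubIntegralDomain of subfield_type by <:].
HB.instance Definition _ := [SubIntegralDomain_isSubField of subfield_type by <:].

Lemma subfield_valP (u : subfield_type) : A (subfield_val u).
Proof. by have := valP u; rewrite inE. Qed.

Lemma subfield_lift x : A x -> exists u : subfield_type, val u = x.
Proof. by move=> Ax; have H := mem_set Ax; exists (SubfieldType H). Qed.

Lemma subfield_lift_poly (p : {poly F}) : (forall i, A p`_i) ->
  exists q : {poly subfield_type}, map_poly val q = p.
Proof.
move=> Ap.
have [c cE] := choice (fun i => subfield_lift (Ap i)).
exists (\poly_(i < size p) c i); apply/polyP => i.
rewrite coef_map_id0 ?raddf0 // coef_poly; case: ltnP => [_|H]; first exact: cE.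
by rewrite raddf0 nth_default.
Qed.

End SubfieldType.

Definition alg_over (F : fieldType) (A : set F) : set F :=
  [set u | exists p : {poly F}, [/\ p != 0, forall i, A p`_i & root p u]].

Section AlgOver.
Variables (F : fieldType) (A : set F).
Hypothesis fA : subfield_set A.

Lemma alg_over_algebraic u :
  alg_over A u <-> algebraicOver (val : subfield_type fA -> F) u.
Proof.
split=> [[p [p0 Ap pu]]|[q q0 qu]].
  have [q qE] := subfield_lift_poly fA Ap; exists q; last by rewrite qE.
  by rewrite -(map_poly_eq0 val) qE.
exists (map_poly val q); split => //; first by rewrite map_poly_eq0.
by move=> i; rewrite coef_map; apply: subfield_valP.
Qed.

Lemma alg_over_sub : A `<=` alg_over A.
Proof.
move=> x Ax; apply/alg_over_algebraic; have [u <-] := subfield_lift fA Ax.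
exact: algebraic_id.
Qed.

Lemma alg_over_subfield : subfield_set (alg_over A).
Proof.
apply/subfield_setP; split.
- by apply: alg_over_sub; exact: sf1.
- move=> x y /alg_over_algebraic ax /alg_over_algebraic ay.
  exact/alg_over_algebraic/algebraic_sub.
- move=> x y /alg_over_algebraic ax /alg_over_algebraic ay.
  exact/alg_over_algebraic/algebraic_div.
Qed.

Lemma alg_over_closed (p : {poly F}) u :
  p != 0 -> root p u -> (forall i, alg_over A p`_i) -> alg_over A u.
Proof.
move=> p0 pu Ap; apply/alg_over_algebraic/integral_algebraic.
apply: (integral_root p0 pu); apply/integral_poly => i.
by apply/integral_algebraic/alg_over_algebraic.
Qed.

Lemma dependent (s d : nat) (x : 'I_s -> F) (b : 'I_d -> F) : (d < s)%N ->
  (forall i, exists2 c : 'I_d -> F, forall j, A (c j) & x i = \sum_j c j * b j) ->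
  exists c : 'I_s -> F, [/\ forall i, A (c i), exists i, c i != 0 &
    \sum_i c i * x i = 0].
Proof.
move=> ds span.
have span' i : exists c : 'I_d -> subfield_type fA, x i = \sum_j val (c j) * b j.
  have [c Ac E] := span i.
  have [c' c'E] := choice (fun j => subfield_lift fA (Ac j)).
  by exists c'; rewrite E; apply: eq_bigr => j _; rewrite c'E.
have [C CE] := choice span'.
pose M : 'M[subfield_type fA]_(s, d) := \matrix_(i, j) C i j.
have : kermx M != 0.
  rewrite kermx_eq0 /row_free; apply: contraTN (rank_leq_col M) => /eqP->.
  by rewrite -ltnNge.
case/matrix0Pn => i [j nz]; have := mulmx_ker M => /matrixP/(_ i) K.
exists (fun l => val (kermx M i l)); split.
- by move=> l; apply: subfield_valP.
- by exists j; rewrite raddf_eq0 //; exact: val_inj.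
under eq_bigr do rewrite CE mulr_sumr.
rewrite exchange_big big1 // => l _.
under eq_bigr do rewrite mulrA.
rewrite -mulr_suml; have := K l; rewrite !mxE => /(congr1 val).
rewrite raddf_sum raddf0 => E; rewrite [X in X * _](_ : _ = 0) ?mul0r //.
rewrite -[RHS]E; apply: eq_bigr => m _; rewrite [M m l]mxE.
exact: (esym (rmorphM (val : subfield_type fA -> F) _ _)).
Qed.

Lemma alg_over_span d (b : 'I_d -> F) y :
  (forall n, exists2 c : 'I_d -> F, forall j, A (c j) & y ^+ n = \sum_j c j * b j) ->
  alg_over A y.
Proof.
move=> span.
have [c [Ac [i ci] E]] := @dependent d.+1 d (fun n => y ^+ n) b (ltnSn d) (fun i => span i).
exists (\sum_i c i *: 'X^i); split.
- apply/eqP => /polyP/(_ i)/eqP; rewrite coef0 coef_sum (bigD1 i) //=.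
  rewrite coefZ coefXn eqxx mulr1 big1 ?addr0 ?(negPf ci) // => j ji.
  by rewrite coefZ coefXn eq_sym (inj_eq val_inj) (negPf ji) mulr0.
- apply: sr_poly_sum => [|j _]; first exact: sf_ring.
  apply: sr_polyZ => //; first exact: sf_ring.
  by move=> l; rewrite coefXn; apply: sr_nat; exact: sf_ring.
- rewrite rootE horner_sum -[X in _ == X]E; apply/eqP/eq_bigr => j _.
  by rewrite hornerZ hornerXn.
Qed.

End AlgOver.

(** * Constants and places of a function field *)

Section FunctionField.
Variables (k K : fieldType) (i : {rmorphism k -> K}).
Variables (Kbar : closedFieldType) (iota : {rmorphism K -> Kbar}).

Definition kbar : set Kbar := [set z | algebraicOver (iota \o i) z].

Lemma kbarE : kbar = alg_over (range (iota \o i)).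
Proof.
apply/seteqP; split=> [z [p p0 pz]|z [p [p0 Ap pz]]].
  exists (map_poly (iota \o i) p); split=> //; first by rewrite map_poly_eq0.
  by move=> j; rewrite coef_map; exists p`_j.
have [c cE] := choice (fun j => let: ex_intro2 c _ e := Ap j in ex_intro _ c e).
have pE : map_poly (iota \o i) (\poly_(j < size p) c j) = p.
  apply/polyP => j; rewrite coef_map coef_poly; case: ltnP => [_|H].
    exact: cE.
  by rewrite raddf0 nth_default.
exists (\poly_(j < size p) c j); last by rewrite pE.
by rewrite -(map_poly_eq0 (iota \o i)) pE.
Qed.

Lemma kbar_subfield : subfield_set kbar.
Proof. by rewrite kbarE; apply/alg_over_subfield/range_subfield. Qed.
Let fkb := kbar_subfield.
Let rkb := sf_ring fkb.

Lemma range_kbar : range (iota \o i) `<=` kbar.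
Proof. by rewrite kbarE; apply/alg_over_sub/range_subfield. Qed.

Lemma kbar_root (p : {poly Kbar}) z :
  p != 0 -> (forall j, kbar p`_j) -> root p z -> kbar z.
Proof.
move=> p0 Ap pz; rewrite kbarE; apply: (alg_over_closed _ p0 pz).
  exact: range_subfield.
by move=> j; rewrite -kbarE.
Qed.

Lemma kbar_transc (p : {poly Kbar}) y :
  ~ kbar y -> p != 0 -> (forall j, kbar p`_j) -> p.[y] != 0.
Proof. by move=> ny p0 Ap; apply/eqP => py; apply: ny; apply: kbar_root Ap _ => //; apply/eqP. Qed.

Lemma kbar_split (p : {poly Kbar}) : p != 0 -> (forall j, kbar p`_j) ->
  exists rs : seq Kbar, [/\ p = lead_coef p *: \prod_(z <- rs) ('X - z%:P),
    forall z, z \in rs -> kbar z & kbar (lead_coef p)].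
Proof.
move=> p0 Ap; have [rs E] := closed_field_poly_normal p; exists rs; split; [by []| |exact: Ap].
move=> z zrs; apply: (kbar_root p0 Ap).
by rewrite E rootZ ?lead_coef_eq0 // root_prod_XsubC.
Qed.

Lemma kbar_prodXsubC (rs : seq Kbar) : (forall z, z \in rs -> kbar z) ->
  forall j, kbar (\prod_(z <- rs) ('X - z%:P))`_j.
Proof.
move=> H; rewrite big_seq; apply: sr_poly_prod => // z zrs.
by apply: sr_polyB => //; [apply: sr_polyX|apply: sr_polyC => //; apply: H].
Qed.

Definition adj (y : Kbar) : set Kbar := field_gen (kbar `|` [set y]).

Lemma adj_subfield y : subfield_set (adj y).
Proof. exact: field_gen_subfield. Qed.
Lemma adj_kbar y : kbar `<=` adj y.
Proof. by move=> z kz; apply: field_gen_sub; left. Qed.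
Lemma adj_id y : adj y y.
Proof. by apply: field_gen_sub; right. Qed.

Lemma adj_frac y u : adj y u -> exists p q : {poly Kbar},
  [/\ forall j, kbar p`_j, forall j, kbar q`_j, q.[y] != 0 & u = p.[y] / q.[y]].
Proof.
have k1 j : kbar (1 : {poly Kbar})`_j.
  by rewrite -polyC1; apply: (sr_polyC rkb); exact: sr1.
apply: (@field_gen_min _ _ [set u | exists p q : {poly Kbar},
  [/\ forall j, kbar p`_j, forall j, kbar q`_j, q.[y] != 0 & u = p.[y] / q.[y]]]).
  apply/subfield_setP; split.
  - by exists 1, 1; split; rewrite ?hornerC ?divr1 ?oner_neq0.
  - move=> _ _ [p [q [kp kq q0 ->]]] [p' [q' [kp' kq' q0' ->]]].
    exists (p * q' - p' * q), (q * q'); split; rewrite ?hornerE ?mulf_neq0 //.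
    + by apply: sr_polyB => //; apply: sr_polyM.
    + exact: sr_polyM.
    + by field; rewrite q0 q0'.
  - move=> _ _ [p [q [kp kq q0 ->]]] [p' [q' [kp' kq' q0' ->]]].
    case: (eqVneq p'.[y] 0) => [->|p0'].
      exists 0, 1; split=> [j|//||]; rewrite ?hornerE ?oner_neq0 //.
        by rewrite coef0; exact: (sr0 rkb).
      by rewrite invr0 mulr0 ?mul0r.
    exists (p * q'), (q * p'); split; rewrite ?hornerE ?mulf_neq0 //.
    + exact: sr_polyM.
    + exact: sr_polyM.
    + by field; rewrite q0 q0' p0'.
move=> z [kz|->].
  exists z%:P, 1; split=> //; rewrite ?hornerE ?divr1 ?oner_neq0 //.
    exact: sr_polyC.
exists 'X, 1; split=> //; rewrite ?hornerE ?divr1 ?oner_neq0 //.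
exact: sr_polyX.
Qed.

Lemma adj_common y n (u : 'I_n -> Kbar) : (forall j, adj y (u j)) ->
  exists (c : 'I_n -> {poly Kbar}) (d : {poly Kbar}),
  [/\ forall j l, kbar (c j)`_l, forall l, kbar d`_l, d.[y] != 0 &
      forall j, u j = (c j).[y] / d.[y]].
Proof.
move=> au.
have /choice[pq pqE] j : exists pq : {poly Kbar} * {poly Kbar},
  [/\ forall j, kbar pq.1`_j, forall j, kbar pq.2`_j, pq.2.[y] != 0 &
      u j = pq.1.[y] / pq.2.[y]].
  by have [p [q H]] := adj_frac (au j); exists (p, q).
exists (fun j => (pq j).1 * \prod_(l < n | l != j) (pq l).2), (\prod_l (pq l).2).
split.
- move=> j; apply: sr_polyM => //; first by case: (pqE j).
  by apply: sr_poly_prod => // l _; case: (pqE l).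
- by apply: sr_poly_prod => // l _; case: (pqE l).
- by rewrite horner_prod; apply/prodf_neq0 => l _; case: (pqE l).
- move=> j; rewrite hornerM !horner_prod.
  have -> : \prod_l (pq l).2.[y] = (pq j).2.[y] * \prod_(l < n | l != j) (pq l).2.[y].
    by rewrite (bigD1 j).
  have [_ _ q0 ->] := pqE j.
  have P0 : \prod_(l < n | l != j) (pq l).2.[y] != 0.
    by apply/prodf_neq0 => l _; case: (pqE l).
  by field; rewrite q0 P0.
Qed.

Definition kbar2 (G : {poly {poly Kbar}}) := forall a b, kbar (G`_a)`_b.

(** Denominators in kbar(y) are cleared. The outer variable of [G] stands for [x] and the inner one
    for [y], which allows their roles to be swapped. *)
Lemma adj_relation x y : alg_over (adj y) x ->
  exists G : {poly {poly Kbar}}, [/\ G != 0, kbar2 G & G.[x%:P].[y] = 0].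
Proof.
move=> [p [p0 Ap px]].
have [c [d [kc kd d0 E]]] := adj_common (fun j : 'I_(size p) => Ap j).
exists (\poly_(j < size p) oapp c 0 (insub j)).
have Gj (j : 'I_(size p)) : (\poly_(j < size p) oapp c 0 (insub j))`_j = c j.
  by rewrite coef_poly ltn_ord valK.
split.
- have sp : ((size p).-1 < size p)%N by rewrite prednK // size_poly_gt0.
  apply/eqP => /polyP/(_ (size p).-1); rewrite (Gj (Ordinal sp)) coef0 => c0.
  have := E (Ordinal sp); rewrite c0 horner0 mul0r /= -lead_coefE => /eqP.
  by rewrite lead_coef_eq0 (negPf p0).
- move=> a b; rewrite coef_poly; case: ifP => [H|_]; last by rewrite coef0; exact: (sr0 rkb).
  rewrite insubT /=; exact: kc.
- rewrite horner_poly horner_sum.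
  transitivity (d.[y] * p.[x]); last by rewrite (rootP px) mulr0.
  rewrite [p.[x]]horner_coef mulr_sumr; apply: eq_bigr => j _.
  rewrite valK hornerM -rmorphXn hornerC (E j) mulrA; congr (_ * _).
  by rewrite mulrC divfK.
Qed.

(** Steinitz exchange: the relation is read as a polynomial in [y] over kbar(x), and it stays
    nonzero because [x] is transcendental over the constants. *)
Lemma exchange x y : ~ kbar x -> alg_over (adj y) x -> alg_over (adj x) y.
Proof.
move=> nx /adj_relation[G [G0 kG Gxy]].
pose H := swapXY G.
have H0 : H != 0 by rewrite swapXY_eq0.
exists (map_poly (horner_eval x) H); split.
- apply/eqP => E.
  have : lead_coef H != 0 by rewrite lead_coef_eq0.
  move=> l0; have kl j : kbar (lead_coef H)`_j.
    by rewrite lead_coefE coef_swapXY; exact: kG.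
  have /negP := kbar_transc nx l0 kl; apply.
  by have /polyP/(_ (size H).-1) := E; rewrite coef_map coef0 => /eqP.
- move=> j; rewrite coef_map /= /horner_eval.
  apply: (sr_horner (sf_ring (adj_subfield x))); last exact: adj_id.
  by move=> l; apply: adj_kbar; rewrite coef_swapXY; apply: kG.
- by rewrite rootE -horner_swapXY /H swapXYK -Gxy.
Qed.

Hypothesis ffK : function_field_over i.
Hypothesis algKbar : forall z : Kbar, algebraicOver iota z.

(** This is transcendence degree one: everything is algebraic over kbar(t) for the given [t], and by
    exchange any transcendental [y] serves as well. *)
Lemma alg_over_adj x y : ~ kbar y -> alg_over (adj y) x.
Proof.
move=> ny; have [[t [nt [d [b span]]]] _] := ffK.
have base z : alg_over (adj (iota t)) z.
  have algK w : alg_over (adj (iota t)) (iota w).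
    pose A' := @field_gen K (range i `|` [set t]).
    have A'sub v : A' v -> adj (iota t) (iota v).
      move: v; apply: (@field_gen_min _ _ [set v | adj (iota t) (iota v)]).
        have fa := adj_subfield (iota t).
        apply/subfield_setP; split=> /=; first by rewrite rmorph1; exact: sf1.
        - by move=> u v' H H'; rewrite rmorphB; exact: (srB (sf_ring fa)).
        - by move=> u v' H H'; rewrite fmorph_div; exact: (sf_div fa).
      move=> _ [[c _ <-]|->]; last exact: adj_id.
      by apply: adj_kbar; apply: range_kbar; exists c.
    have [||p [p0 Ap pw]] := @alg_over_span K A' _ d b w.
    - exact: field_gen_subfield.
    - by move=> n; have [c Ac E] := span (w ^+ n); exists c.
    exists (map_poly iota p); split; rewrite ?map_poly_eq0 ?fmorph_root //.
    by move=> j; rewrite coef_map; apply: A'sub.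
  have [p p0 pz] := algKbar z.
  apply: (alg_over_closed _ _ pz); first exact: adj_subfield.
    by rewrite map_poly_eq0.
  by move=> j; rewrite coef_map; apply: algK.
have ty : alg_over (adj y) (iota t) by apply: exchange.
have fa := adj_subfield y; have faa := alg_over_subfield fa.
have sub : adj (iota t) `<=` alg_over (adj y).
  apply: field_gen_min => // z [kz|->] //.
  by apply: alg_over_sub => //; exact: adj_kbar.
have [p [p0 Ap px]] := base x.
by apply: (alg_over_closed fa p0 px) => j; apply: sub.
Qed.

Lemma relation x y : ~ kbar y ->
  exists G : {poly {poly Kbar}}, [/\ G != 0, kbar2 G & G.[x%:P].[y] = 0].
Proof. by move=> ny; apply/adj_relation/alg_over_adj. Qed.

End FunctionField.

Lemma vr_root (F : fieldType) (Q : set F) x n :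
  valuation_ring setT Q -> Q (x ^+ n.+1) -> Q x.
Proof.
move=> vQ Qx; have rQ := vr_ring vQ.
apply: (vr_integral (setT_subfield F) vQ (p := 'X^(n.+1) - (x ^+ n.+1)%:P)) => //.
- by rewrite rootE !hornerE subrr.
- apply: sr_polyB => //; last exact: sr_polyC.
  by move=> j; rewrite coefXn; exact: sr_nat.
- rewrite lead_coefE size_XnsubC // coefB coefXn coefC eqxx subr0.
  exact: unit1 vQ.
Qed.

(** * Places of the algebraic closure: residues and archimedean values *)

Section Place.
Variables (k K : fieldType) (i : {rmorphism k -> K}).
Variables (Kbar : closedFieldType) (iota : {rmorphism K -> Kbar}).
Local Notation kb := (kbar i iota).

Definition place (Q : set Kbar) :=
  [/\ valuation_ring setT Q, Q != setT & range (iota \o i) `<=` Q].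

Variable Q : set Kbar.
Hypothesis pQ : place Q.
Let vQ : valuation_ring setT Q. Proof. by case: pQ. Qed.
Let rQ := vr_ring vQ.
Let fT := setT_subfield Kbar.
Let rkb := sf_ring (kbar_subfield i iota).

Lemma place_kbar : kb `<=` Q.
Proof.
rewrite kbarE => z [p [p0 Ap pz]]; case: pQ => _ _ sub.
apply: (vr_integral fT vQ _ pz) => // [j|]; first by apply: sub.
have [c _ cE] : range (iota \o i) (lead_coef p) by exact: Ap.
split; first by rewrite lead_coef_eq0.
  exact: sub (Ap _).
by apply: sub; exists c^-1 => //=; rewrite !fmorphV -cE.
Qed.

Lemma place_kbar_unit c : kb c -> c != 0 -> unit_of Q c.
Proof.
move=> kc c0; split=> //; first exact: place_kbar.
by apply: place_kbar; exact: (sfV (kbar_subfield i iota)).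
Qed.

Lemma place_nontrivial : exists x, x != 0 /\ maxid Q x.
Proof.
have [x nQx] : exists x, ~ Q x.
  apply: contrapT => nex; case: pQ => _ /eqP QT _; apply: QT; apply/seteqP; split=> // x _.
  by apply: contrapT => nQ; apply: nex; exists x.
exists x^-1; split; last by right; rewrite invrK.
by rewrite invr_eq0; apply/eqP => x0; apply: nQx; rewrite x0; exact: (sr0 rQ).
Qed.

Lemma kbar_poly_unit (c : {poly Kbar}) y : c != 0 -> (forall j, kb c`_j) ->
  (forall b, kb b -> root c b -> unit_of Q (y - b)) -> unit_of Q c.[y].
Proof.
move=> c0 kc uy; have [rs [E krs kl]] := kbar_split c0 kc.
rewrite E hornerZ horner_prod; apply: (unitM vQ).
  by apply: place_kbar_unit => //; rewrite lead_coef_eq0.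
rewrite big_seq; apply: (unit_prod vQ) => z zrs; rewrite !hornerE; apply: uy; first exact: krs.
by rewrite E rootZ ?lead_coef_eq0 // root_prod_XsubC.
Qed.

Lemma residue_neq g b t : kb g -> kb b -> maxid Q (t - g) -> b != g ->
  unit_of Q (t - b).
Proof.
move=> kg kbb mt bg; have -> : t - b = (g - b) + (t - g) by ring.
apply: (unit_maxidD fT vQ) => //.
apply: place_kbar_unit; last by rewrite subr_eq0 eq_sym.
exact: (srB rkb).
Qed.

(** Over the constants [c] splits into linear factors, and among their values at [t] only [t - g]
    fails to be a unit. *)
Lemma kbar_poly_order (c : {poly Kbar}) t g : kb g -> maxid Q (t - g) ->
  t != g -> c != 0 -> (forall j, kb c`_j) ->
  exists n, unit_of Q (c.[t] / (t - g) ^+ n).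
Proof.
move=> kg mt tg c0 kc; have [rs [E krs kl]] := kbar_split c0 kc.
rewrite E hornerZ horner_prod.
have : unit_of Q (lead_coef c) by apply: place_kbar_unit => //; rewrite lead_coef_eq0.
elim: rs krs {E} => [|z rs IH] krs ul.
  by exists 0%N; rewrite big_nil expr0 divr1 mulr1.
have [|n un] := IH _ ul; first by move=> w wrs; apply: krs; rewrite inE wrs orbT.
have tg0 : t - g != 0 by rewrite subr_eq0.
rewrite big_cons hornerXsubC /=; case: (eqVneq z g) => [->|zg].
  exists n.+1; apply: eq_ind un _ _; rewrite exprS; field.
  by rewrite expf_neq0 // tg0.
exists n; rewrite mulrCA -mulrA; apply: (unitM vQ) => //.
by apply: residue_neq mt _ => //; apply: krs; rewrite mem_head.
Qed.

Hypothesis ffK : function_field_over i.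
Hypothesis algKbar : forall z : Kbar, algebraicOver iota z.

(** This turns transcendence degree one into information on values: two monomials in [x] of an
    algebraic relation between [x] and [y] must tie. *)
Lemma relation_tie x y : ~ kb y -> x != 0 -> exists (c c' : {poly Kbar}) (m n : nat),
  [/\ c != 0 /\ (forall j, kb c`_j), c' != 0 /\ (forall j, kb c'`_j), (m < n)%N &
      unit_of Q (c.[y] * x ^+ m / (c'.[y] * x ^+ n))].
Proof.
move=> ny x0; have [G [G0 kG E]] := relation ffK algKbar x ny.
have nz (c : {poly Kbar}) : c.[y] != 0 -> c != 0.
  by apply: contra => /eqP->; rewrite horner0.
have E' : \sum_(j < size G) (G`_j).[y] * x ^+ j = 0.
  rewrite -[RHS]E (horner_coef G) horner_sum; apply: eq_bigr => j _.
  by rewrite hornerM -rmorphXn hornerC.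
have sG : ((size G).-1 < size G)%N by rewrite prednK // size_poly_gt0.
have nz0 : (G`_(Ordinal sG)).[y] * x ^+ (Ordinal sG) != 0.
  rewrite mulf_neq0 ?expf_neq0 //; apply: (kbar_transc ny) => //.
  by rewrite /= -lead_coefE lead_coef_eq0.
have [a [b [ab za zb u]]] := tie fT vQ (fun=> I) nz0 E'.
move: za zb; rewrite !mulf_eq0 => /norP[za _] /norP[zb _].
move: (nz _ za) (nz _ zb) => {}za {}zb.
case: (ltngtP a b) => H.
- by exists G`_a, G`_b, a, b.
- exists G`_b, G`_a, b, a; split=> //; rewrite -invf_div; exact: unitV.
- by move/eqP: ab; case; apply/val_inj.
Qed.

(** Otherwise every nonzero polynomial in [y] over the constants is a unit, and the tie in a
    relation between [y] and a nonzero nonunit [x] makes a power of [x] a unit. *)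
Lemma residue y : Q y -> exists b, kb b /\ maxid Q (y - b).
Proof.
move=> Qy; apply: contrapT => nex.
have ny : ~ kb y by move=> ky; apply: nex; exists y; rewrite subrr; split=> //; left.
have uy (c : {poly Kbar}) : c != 0 -> (forall j, kb c`_j) -> unit_of Q c.[y].
  move=> c0 kc; apply: kbar_poly_unit => // b kbb _; case: (maxidP (Q := Q) (x := y - b)).
  - by apply: (srB rQ) => //; exact: place_kbar.
  - by move=> m; case: nex; exists b.
  - by [].
have [x [x0 mx]] := place_nontrivial.
have [c [c' [m [n [[c0 kc] [c'0 kc'] mn u]]]]] := relation_tie ny x0.
have ux : unit_of Q (x ^+ (n - m)).
  have -> : x ^+ (n - m) = c.[y] / c'.[y] / (c.[y] * x ^+ m / (c'.[y] * x ^+ n)).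
    have [c0' _ _] := uy _ c0 kc; have [c'0' _ _] := uy _ c'0 kc'.
    rewrite -{2}(subnK (ltnW mn)) exprD; field.
    by rewrite c0' c'0' !expf_neq0.
  by apply: (unit_div vQ) => //; apply: (unit_div vQ); apply: uy.
apply: (maxid_nunit (Q := Q) _ ux); rewrite -(subnSK mn) exprS.
by apply: (maxidMr vQ) => //; apply: (srX rQ _); exact: maxidW vQ _ I mx.
Qed.

(** Polynomials in [x] over the constants have the value of a power of [x]. So a tie in a relation
    between [x] and [z] gives a positive power of [z] the value of a quotient of powers of [x]; a
    root is then extracted by integral closedness. *)
Lemma archimedean x z : x != 0 -> maxid Q x -> z != 0 -> exists N, Q (x ^+ N / z).
Proof.
move=> x0 mx z0.
have nx : ~ kb x by move=> kx; apply: (maxid_nunit mx); apply: place_kbar_unit.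
have Qx := maxidW vQ I mx.
have [c [c' [m [n [[c0 kc] [c'0 kc'] mn u]]]]] := relation_tie nx z0.
have k0 : kb 0 by exact: (sr0 rkb).
have ox (d : {poly Kbar}) : d != 0 -> (forall j, kb d`_j) ->
    exists n, unit_of Q (d.[x] / x ^+ n).
  by move=> d0 kd; have := @kbar_poly_order d x 0 k0; rewrite subr0; apply.
have [a ua] := ox _ c0 kc; have [b ub] := ox _ c'0 kc'.
have c0' : c.[x] != 0 by exact: (kbar_transc nx).
have c'0' : c'.[x] != 0 by exact: (kbar_transc nx).
exists a.+1; apply: (@vr_root _ _ _ (n - m).-1 vQ).
have mn0 : (0 < n - m)%N by rewrite subn_gt0.
rewrite prednK //.
have -> : (x ^+ a.+1 / z) ^+ (n - m) =
   x ^+ (a.+1 * (n - m) - a) * x ^+ b * ((c.[x] / x ^+ a)^-1 * (c'.[x] / x ^+ b) *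
     (c.[x] * z ^+ m / (c'.[x] * z ^+ n))).
  rewrite expr_div_n -exprM.
  have -> : x ^+ (a.+1 * (n - m)) = x ^+ (a.+1 * (n - m) - a) * x ^+ a.
    rewrite -exprD subnK //; apply: (leq_trans (leqnSn a)).
    by rewrite leq_pmulr.
  have -> : z ^+ n = z ^+ (n - m) * z ^+ m by rewrite -exprD subnK // ltnW.
  by field; rewrite ?c0' ?c'0' ?x0 ?expf_neq0.
apply: (srM rQ); first by apply: (srM rQ); apply: (srX rQ _).
by apply: unitW; apply: (unitM vQ) => //; apply: (unitM vQ) => //; apply: unitV.
Qed.

End Place.

(** * Dense extensions and value groups *)

(* An annihilating polynomial of least degree is separable at [u]. *)
Lemma separable_relation (F : fieldType) (A : set F) u :
  [pchar F] =i pred0 -> subfield_set A -> alg_over A u ->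
  exists p : {poly F}, [/\ forall j, A p`_j, root p u & p^`().[u] != 0].
Proof.
move=> ch0 fA [p0 H0].
pose P n := `[< exists p : {poly F}, [/\ p != 0, forall j, A p`_j, root p u & size p = n] >].
have exP : exists n, P n.
  by exists (size p0); apply/asboolP; exists p0; case: H0.
case: (ex_minnP exP) => n /asboolP[p [pn0 Ap pu sp]] minp.
exists p; split=> //; apply/negP => p'u.
have sp1 : (1 < size p)%N by apply: root_size_gt1 pu.
have p'0 : p^`() != 0.
  apply/eqP => /polyP/(_ (size p).-2)/eqP; rewrite coef0 coef_deriv.
  case: (size p) sp1 (lead_coefE p) => [|[|s]] //= _ E.
  rewrite -E -mulr_natr mulf_eq0 lead_coef_eq0 (negPf pn0) /=.
  by have /pcharf0P -> := ch0.
have : P (size p^`()).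
  by apply/asboolP; exists p^`(); split=> //; apply: (sr_deriv (sf_ring fA)).
by move/minp; rewrite -sp leqNgt lt_size_deriv.
Qed.

Section Density.
Variables (F : fieldType) (Q : set F).
Hypothesis vQ : valuation_ring setT Q.
Let rQ := vr_ring vQ.
Let fT := setT_subfield F.
Variable w : F.
Hypotheses (w0 : w != 0) (mw : maxid Q w).
Let Qw : Q w := maxidW vQ I mw.

(* Closure of [L] for the topology defined by the valuation ring [Q]. *)
Definition cl (L : set F) : set F :=
  [set y | forall z, z != 0 -> exists x, L x /\ Q ((y - x) / z)].

Lemma cl_sub L : L `<=` cl L.
Proof. by move=> x Lx z z0; exists x; rewrite subrr mul0r; split=> //; exact: (sr0 rQ). Qed.

Lemma cl_cl L : cl (cl L) `<=` cl L.
Proof.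
move=> y cy z z0; have [x [cx H]] := cy z z0; have [x' [Lx' H']] := cx z z0.
exists x'; split=> //; have -> : (y - x') / z = (y - x) / z + (x - x') / z by ring.
exact: (srD rQ).
Qed.

Lemma common_bound z z' : z != 0 -> z' != 0 ->
  exists v, [/\ v != 0, Q (v / z) & Q (v / z')].
Proof.
move=> z0 z'0; case: (vr_total vQ (x := z / z') I) => H.
  by exists z; split=> //; rewrite divff //; exact: (sr1 rQ).
exists z'; split=> //; first by rewrite -invf_div.
by rewrite divff //; exact: (sr1 rQ).
Qed.

Lemma Q_div_trans x v z : v != 0 -> Q (x / v) -> Q (v / z) -> Q (x / z).
Proof.
move=> v0 H H'; have -> : x / z = (x / v) * (v / z) by rewrite mulrA divfK.
exact: (srM rQ).
Qed.

Lemma near_unit y x : y != 0 -> Q ((y - x) / (w * y)) -> unit_of Q (x / y).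
Proof.
move=> y0 H; have -> : x / y = 1 + - (w * ((y - x) / (w * y))).
  by field; rewrite w0 y0.
apply: (unit_maxidD fT vQ) => //; first exact: (unit1 vQ).
by apply: (maxidN vQ); apply: (maxidMr vQ).
Qed.

Lemma cl_value L y : cl L y -> y != 0 ->
  exists x, [/\ L x, x != 0 & unit_of Q (y / x)].
Proof.
move=> cy y0; have [|x [Lx H]] := cy (w * y); first by rewrite mulf_neq0.
have u := near_unit y0 H; exists x; split=> //; last first.
  by rewrite -invf_div; apply: unitV.
by case: u => /[!mulf_eq0] /norP[].
Qed.

Lemma cl_residue L y b : cl L y -> maxid Q (y - b) ->
  exists x, L x /\ maxid Q (x - b).
Proof.
move=> cy m; have [x [Lx H]] := cy w w0; exists x; split=> //.
have -> : x - b = (y - b) - w * ((y - x) / w) by field.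
by apply: (maxidB fT vQ) => //; apply: (maxidMr vQ).
Qed.

Lemma cl_subfield L : subfield_set L -> subfield_set (cl L).
Proof.
move=> fL; have rL := sf_ring fL; apply/subfield_setP; split.
- by apply: cl_sub; exact: (sr1 rL).
- move=> y y' cy cy' z z0; have [x [Lx H]] := cy z z0.
  have [x' [Lx' H']] := cy' z z0; exists (x - x'); split; first exact: (srB rL).
  have -> : (y - y' - (x - x')) / z = (y - x) / z - (y' - x') / z by ring.
  exact: (srB rQ).
- move=> y y' cy cy'; case: (eqVneq y' 0) => [->|y'0].
    by rewrite invr0 mulr0; apply: cl_sub; exact: (sr0 rL).
  move=> z z0; have [|x [Lx H]] := cy (y' * z); first by rewrite mulf_neq0.
  (* The approximation of the denominator must be fine enough both to differ from [y'] by a unit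
     factor and to keep its error small after multiplication by [x]. *)
  have [x' [Lx' ux' H']] : exists x', [/\ L x', unit_of Q (x' / y') &
      Q (x * (y' - x') / (y' * y' * z))].
    case: (eqVneq x 0) => [->|x0].
      have [|x' [Lx' H']] := cy' (w * y'); first by rewrite mulf_neq0.
      exists x'; split=> //; first exact: near_unit.
      by rewrite !mul0r; exact: (sr0 rQ).
    have [||v [v0 Qv Qv']] := @common_bound (w * y') (y' * y' * z / x).
    - by rewrite mulf_neq0.
    - by rewrite !mulf_neq0 ?invr_eq0.
    have [x' [Lx' H']] := cy' v v0; exists x'; split=> //.
      by apply: near_unit => //; apply: Q_div_trans H' Qv.
    have -> : x * (y' - x') / (y' * y' * z) = (y' - x') / (y' * y' * z / x).
      by field; rewrite x0 y'0 z0.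
    by apply: Q_div_trans H' Qv'.
  have x'0 : x' != 0 by case: ux' => /[!mulf_eq0] /norP[].
  exists (x / x'); split; first exact: (sf_div fL).
  have -> : (y / y' - x / x') / z =
      (y - x) / (y' * z) - x * (y' - x') / (y' * y' * z) * (x' / y')^-1.
    by field; rewrite x'0 y'0 z0.
  apply: (srB rQ) => //; apply: (srM rQ) => //.
  by apply: unitW; apply: unitV.
Qed.

Lemma poly_congr (p : {poly F}) x y : (forall j, Q p`_j) -> Q x -> Q y ->
  exists2 s, Q s & p.[y] = p.[x] + (y - x) * s.
Proof.
move=> Qp Qx Qy; have Qyx : Q (y - x) by exact: (srB rQ).
have [r Qr] := sr_taylor rQ Qp Qx Qyx; rewrite addrC subrK => E.
exists (p^`().[x] + (y - x) * r); last by rewrite E; ring.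
apply: (srD rQ); last exact: (srM rQ).
by apply: (sr_horner rQ) => //; exact: (sr_deriv rQ).
Qed.

Hypothesis arch : forall x z, x != 0 -> maxid Q x -> z != 0 ->
  exists N, Q (x ^+ N / z).

(* Newton's iteration: the error is squared at each step. *)
Lemma hensel L (g : {poly F}) al a : subfield_set L ->
  (forall j, L g`_j) -> (forall j, Q g`_j) -> root g al ->
  L a -> Q al -> maxid Q (al - a) -> unit_of Q g^`().[al] -> cl L al.
Proof.
move=> fL Lg Qg gal La Qal ma ug.
have rL := sf_ring fL.
(* Of the squaring only one further factor [al - a] per step is recorded, which is enough by the
   archimedean property. *)
have step n : exists b, L b /\ exists2 q, Q q & al - b = (al - a) ^+ n.+1 * q.
  elim: n => [|n [b [Lb [q Qq E]]]].
    by exists a; split=> //; exists 1; rewrite ?expr1 ?mulr1 //; exact: (sr1 rQ).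
  have mb : maxid Q (al - b).
    rewrite E exprS -mulrA; apply: (maxidMr vQ) => //; apply: (srM rQ) => //.
    by apply: (srX rQ); exact: (maxidW vQ).
  have Qb : Q b.
    by have -> : b = al - (al - b) by [ring]; apply: (srB rQ) => //; exact: (maxidW vQ).
  have Qh : Q (al - b) by exact: (srB rQ).
  have Qa : Q (al - a) by exact: (maxidW vQ).
  have [r Qr] := sr_taylor rQ Qg Qb Qh; rewrite addrC subrK (rootP gal) => Et.
  have ub : unit_of Q g^`().[b].
    have [s Qs ->] := poly_congr (sr_deriv rQ Qg) Qal Qb.
    apply: (unit_maxidD fT vQ) => //; apply: (maxidMr vQ) => //.
    by rewrite -opprB; exact: (maxidN vQ).
  have [ub0 _ ubV] := ub.
  exists (b - g.[b] / g^`().[b]); split.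
    apply: (srB rL) => //; apply: (sf_div fL); first exact: (sr_horner rL).
    by apply: (sr_horner rL) => //; exact: (sr_deriv rL).
  exists ((al - a) ^+ n * q ^+ 2 * - r * (g^`().[b])^-1).
    apply: (srM rQ) => //; apply: (srM rQ); last exact: (srN rQ).
    by apply: (srM rQ); apply: (srX rQ).
  have -> : al - (b - g.[b] / g^`().[b]) = - ((al - b) ^+ 2 * r) / g^`().[b].
    have -> : g.[b] = - ((al - b) * g^`().[b] + (al - b) ^+ 2 * r).
      by apply/eqP; rewrite -addr_eq0 Et; apply/eqP; ring.
    by field; rewrite ub0.
  by rewrite E !exprS; ring.
move=> z z0; case: (eqVneq (al - a) 0) => [E|n0].
  by exists a; rewrite E mul0r; split=> //; exact: (sr0 rQ).
have [N QN] := arch n0 ma z0; have [b [Lb [q Qq E]]] := step N.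
exists b; split=> //; rewrite E exprS.
have -> : (al - a) * (al - a) ^+ N * q / z = (al - a) * q * ((al - a) ^+ N / z) by ring.
apply: (srM rQ) => //; apply: (srM rQ) => //; exact: (maxidW vQ).
Qed.

End Density.

(** * Extensions that do not enlarge the value group *)

Section Immediate.
Variables (k K : fieldType) (i : {rmorphism k -> K}).
Variables (Kbar : closedFieldType) (iota : {rmorphism K -> Kbar}).
Hypothesis ffK : function_field_over i.
Hypothesis algKbar : forall z : Kbar, algebraicOver iota z.
Hypothesis char0 : [pchar Kbar] =i pred0.
Local Notation kb := (kbar i iota).
Let fkb := kbar_subfield i iota.
Let rkb := sf_ring fkb.
Let fT := setT_subfield Kbar.

Variable Q : set Kbar.
Hypothesis pQ : place i iota Q.
Let vQ : valuation_ring setT Q. Proof. by case: pQ. Qed.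
Let rQ := vr_ring vQ.

Definition same_values (L M : set Kbar) :=
  forall y, M y -> y != 0 -> exists x, [/\ L x, x != 0 & unit_of Q (y / x)].

Lemma same_values_trans L M N :
  same_values L M -> same_values M N -> same_values L N.
Proof.
move=> LM MN y Ny y0; have [x [Mx x0 u]] := MN y Ny y0.
have [x' [Lx' x'0 u']] := LM x Mx x0; exists x'; split=> //.
have -> : y / x' = (y / x) * (x / x') by rewrite mulrA divfK.
exact: (unitM vQ).
Qed.

Lemma same_values_cl L : same_values L (cl Q L).
Proof.
have [w [w0 mw]] := place_nontrivial pQ.
by move=> y; exact: (cl_value vQ w0 mw).
Qed.

Lemma place_cl_subfield L : subfield_set L -> subfield_set (cl Q L).
Proof. have [w [w0 mw]] := place_nontrivial pQ; exact: (cl_subfield vQ w0 mw). Qed.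

Lemma place_hensel L (g : {poly Kbar}) al a : subfield_set L ->
  (forall j, L g`_j) -> (forall j, Q g`_j) -> root g al ->
  L a -> Q al -> maxid Q (al - a) -> unit_of Q g^`().[al] -> cl Q L al.
Proof. by apply: (hensel vQ) => x z; exact: (archimedean pQ ffK algKbar). Qed.

Lemma kbar_maxid c : kb c -> maxid Q c -> c = 0.
Proof.
move=> kc mc; apply/eqP; apply: contraT => c0.
by case: (maxid_nunit mc); exact: (place_kbar_unit pQ).
Qed.

(** [c] is a root of a polynomial over k whose derivative at [c] is a nonzero constant, hence a
    unit; Newton's iteration started at [s] converges to [c]. *)
Lemma residue_in_cl L c s : subfield_set L -> range (iota \o i) `<=` L ->
  kb c -> L s -> maxid Q (s - c) -> cl Q L c.
Proof.
move=> fL kL kc Ls m; have kc' := kc; rewrite kbarE in kc'.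
have [p [Ap pc p'c]] := separable_relation char0 (range_subfield _) kc'.
have kp j : kb p`_j by apply: range_kbar.
apply: (@place_hensel L p c s) => //.
- by move=> j; exact: kL.
- by move=> j; exact: (place_kbar pQ).
- exact: (place_kbar pQ).
- by rewrite -opprB; exact: (maxidN vQ).
- apply: (place_kbar_unit pQ) => //; apply: (sr_horner rkb) => //.
  exact: (sr_deriv rkb).
Qed.

Section Descent.
Variable L : set Kbar.
Hypothesis fL : subfield_set L.
Hypothesis resL : forall c s, kb c -> L s -> maxid Q (s - c) -> L c.
Let rL := sf_ring fL.

Let span : set Kbar := [set y | exists s : seq (Kbar * Kbar),
  (forall x, x \in s -> L x.1 /\ kb x.2) /\ y = \sum_(x <- s) x.1 * x.2].

(** Induction on the number of nonzero [a j]. After division by a dominant [a m] the coefficients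
    have constant residues [r j], which [resL] puts in [L]. If the sum of the [r j * c j] is
    nonzero, it is a unit, and the whole sum has the value of [a m]. *)
Lemma span_value : same_values L span.
Proof.
suff H : forall N n (a c : 'I_n -> Kbar), (forall j, L (a j)) -> (forall j, kb (c j)) ->
    (#|[pred j | a j != 0%R]| <= N)%N -> \sum_j a j * c j != 0 ->
    exists x, [/\ L x, x != 0 & unit_of Q ((\sum_j a j * c j) / x)].
  move=> y [s [Hs ->]] y0.
  have E : \sum_(x <- s) x.1 * x.2 = \sum_(j < size s)
      (tnth (in_tuple s) j).1 * (tnth (in_tuple s) j).2 by rewrite big_tnth.
  rewrite E in y0 *; apply: (H _ _ _ _ _ _ (leqnn _)) => // j.
    by case: (Hs _ (mem_tnth j (in_tuple s))).
  by case: (Hs _ (mem_tnth j (in_tuple s))).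
elim=> [|N IH] n a c La kc card y0.
  case/negP: y0; apply/eqP; apply: big1 => j _.
  move: card; rewrite leqn0 => /eqP/card0_eq/(_ j).
  by rewrite !inE => /negbFE/eqP->; rewrite mul0r.
have [j0 aj0] : exists j, a j != 0.
  apply: contrapT => nex; case/negP: y0; apply/eqP; apply: big1 => j _.
  case: (eqVneq (a j) 0) => [->|aj]; first by rewrite mul0r.
  by case: nex; exists j.
have [m am Hm] := max_value fT vQ (fun=> I) aj0.
have /choice[r rE] j : exists b, kb b /\ maxid Q (a j / a m - b).
  exact: (residue pQ ffK algKbar).
have Lr j : L (r j).
  by case: (rE j) => krj; apply: resL => //; exact: (sf_div fL).
have rm : r m = 1.
  case: (rE m) => krm; rewrite divff // => m1; apply/eqP; rewrite eq_sym -subr_eq0.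
  by apply/eqP/kbar_maxid => //; apply: (srB rkb) => //; exact: (sr1 rkb).
have r0 j : a j = 0 -> r j = 0.
  case: (rE j) => krj + a0; rewrite a0 mul0r sub0r => /(maxidN vQ); rewrite opprK.
  exact: kbar_maxid.
(* When this combination vanishes, subtracting [a m] times it changes nothing, removes the term [m]
   and creates no new nonzero coefficient. *)
case: (eqVneq (\sum_j r j * c j) 0) => [w0|w0].
  have E : \sum_j a j * c j = \sum_j (a j - a m * r j) * c j.
    transitivity (\sum_j a j * c j - a m * \sum_j r j * c j); last first.
      by rewrite mulr_sumr -sumrB; apply: eq_bigr => j _; ring.
    by rewrite w0 mulr0 subr0.
  rewrite E; apply: IH => //; last by rewrite -E.
    by move=> j; apply: (srB rL) => //; exact: (srM rL).
  rewrite -ltnS; apply: leq_trans card; apply: proper_card; apply/properP; split.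
    apply/fintype.subsetP => j; rewrite !inE /=; apply: contra => /eqP aj.
    by rewrite aj r0 // mulr0 subrr.
  by exists m; rewrite !inE // rm mulr1 subrr eqxx.
exists (a m); split=> //.
have -> : (\sum_j a j * c j) / a m =
    \sum_j r j * c j + \sum_j (a j / a m - r j) * c j.
  rewrite -big_split mulr_suml; apply: eq_bigr => j _ /=; ring.
apply: (unit_maxidD fT vQ) => //; last first.
  apply: (maxid_sum fT vQ) => // j _; apply: (maxidMr vQ); first by case: (rE j).
  exact: (place_kbar pQ).
apply: (place_kbar_unit pQ) => //; apply: (sr_sum rkb) => j _.
by apply: (srM rkb) => //; case: (rE j).
Qed.

Let span_ring : subring_closed [in span].
Proof.
apply/subring_setP; split.
- exists [:: (1, 1)]; rewrite big_seq1 mulr1; split=> // x; rewrite inE => /eqP->.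
  by split; [exact: (sr1 rL)|exact: (sr1 rkb)].
- move=> _ _ [s [Hs ->]] [s' [Hs' ->]].
  exists (s ++ [seq (- x.1, x.2) | x <- s']); split.
    move=> x; rewrite mem_cat => /orP[/Hs//|/mapP[z /Hs'[Lz kz] ->]].
    by split=> //; exact: (srN rL).
  rewrite big_cat big_map /= -sumrN; congr (_ + _).
  by apply: eq_bigr => x _; rewrite mulNr.
- move=> _ _ [s [Hs ->]] [s' [Hs' ->]].
  exists [seq (x.1 * y.1, x.2 * y.2) | x <- s, y <- s']; split.
    move=> x /allpairsP[[z z'] [/Hs[Lz kz] /Hs'[Lz' kz'] ->]].
    by split; [exact: (srM rL)|exact: (srM rkb)].
  rewrite big_allpairs_dep mulr_suml; apply: eq_bigr => x _; rewrite mulr_sumr.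
  by apply: eq_bigr => y _ /=; ring.
Qed.

Lemma constants_value : same_values L (field_gen (L `|` kb)).
Proof.
have sp1 : span 1 := sr1 span_ring.
have sub : @field_gen Kbar (L `|` kb) `<=`
    [set z | exists p q, [/\ span p, span q, q != 0 & z = p / q]].
  apply: field_gen_min.
    apply/subfield_setP; split.
    - by exists 1, 1; rewrite divr1 oner_neq0.
    - move=> _ _ [p [q [sp sq q0 ->]]] [p' [q' [sp' sq' q'0 ->]]].
      exists (p * q' - p' * q), (q * q'); split; rewrite ?mulf_neq0 //.
      + by apply: (srB span_ring); apply: (srM span_ring).
      + exact: (srM span_ring).
      + by field; rewrite q0 q'0.
    - move=> _ _ [p [q [sp sq q0 ->]]] [p' [q' [sp' sq' q'0 ->]]].
      case: (eqVneq p' 0) => [->|p'0].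
        exists 0, 1; split=> //; rewrite ?oner_neq0 //; first exact: (sr0 span_ring).
        by rewrite mul0r invr0 mulr0 mul0r.
      exists (p * q'), (q * p'); split; rewrite ?mulf_neq0 //.
      + exact: (srM span_ring).
      + exact: (srM span_ring).
      + by field; rewrite q0 q'0 p'0.
  move=> z [Lz|kz].
    exists z, 1; split; rewrite ?divr1 ?oner_neq0 //.
    exists [:: (z, 1)]; rewrite big_seq1 mulr1; split=> // x; rewrite inE => /eqP->.
    by split=> //; exact: (sr1 rkb).
  exists z, 1; split; rewrite ?divr1 ?oner_neq0 //.
  exists [:: (1, z)]; rewrite big_seq1 mul1r; split=> // x; rewrite inE => /eqP->.
  by split=> //; exact: (sr1 rL).
move=> y /sub[p [q [sp sq q0 ->]]]; rewrite mulf_eq0 => /norP[p0 _].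
have [x [Lx x0 u]] := span_value sp p0.
have [x' [Lx' x'0 u']] := span_value sq q0.
exists (x / x'); split; [exact: (sf_div fL)|by rewrite mulf_neq0 ?invr_eq0|].
have -> : p / q / (x / x') = (p / x) / (q / x') by field; rewrite q0 x0 x'0.
exact: (unit_div vQ).
Qed.

End Descent.

Variable L : set Kbar.
Hypothesis fL : subfield_set L.
Hypothesis kL : range (iota \o i) `<=` L.

(* A large field, closed under adjunction of constants and of elements that
   are etale at [Q], in which the value group of [L] does not grow. *)
Definition etale_closure : set Kbar := cl Q (field_gen (cl Q L `|` kb)).

Let M := @field_gen Kbar (cl Q L `|` kb).
Let fM : subfield_set M := field_gen_subfield _.

Lemma etale_closure_subfield : subfield_set etale_closure.
Proof. exact: place_cl_subfield. Qed.

Lemma etale_closure_kbar : kb `<=` etale_closure.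
Proof. by move=> c kc; apply: (cl_sub vQ); apply: field_gen_sub; right. Qed.

Lemma etale_closure_sub : L `<=` etale_closure.
Proof.
by move=> c Lc; apply: (cl_sub vQ); apply: field_gen_sub; left; exact: (cl_sub vQ).
Qed.

(** The inner closure contains the constants that are residues of its elements, which is the
    condition for adjoining all constants without new values; taking a closure never adds values. *)
Lemma etale_closure_values : same_values L etale_closure.
Proof.
apply: same_values_trans (@same_values_cl M).
apply: same_values_trans (@same_values_cl L) _.
apply: constants_value; first exact: place_cl_subfield.
move=> c s kc cs m.
have [w [w0 mw]] := place_nontrivial pQ.
have [x [Lx mx]] := cl_residue vQ w0 mw cs m.
exact: (residue_in_cl fL kL kc Lx mx).
Qed.

(** The residue of [al] is a constant and all constants are present, so Newton's iteration always
    has a starting point. *)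
Lemma etale_closure_etale (g : {poly Kbar}) al :
  (forall j, etale_closure g`_j) -> (forall j, Q g`_j) -> root g al ->
  Q al -> unit_of Q g^`().[al] -> etale_closure al.
Proof.
move=> Lg Qg gal Qal ug; have [b [kb_b mb]] := residue pQ ffK algKbar Qal.
apply: (cl_cl vQ); apply: (place_hensel etale_closure_subfield Lg Qg gal _ Qal mb ug).
exact: etale_closure_kbar.
Qed.

End Immediate.

(** * Primes and ramification *)

Section Approximation.
Variable F : fieldType.
Implicit Types (P O : set F) (x y z : F).

Lemma vr_separate P O : valuation_ring setT P -> valuation_ring setT O ->
  ~ P `<=` O -> ~ O `<=` P -> exists z, maxid P z /\ ~ O z.
Proof.
move=> vP vO nPO nOP.
have [a Pa nOa] : exists2 a, P a & ~ O a.
  apply: contrapT => nex; apply: nPO => a Pa; apply: contrapT => nO.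
  by apply: nex; exists a.
have [b Ob nPb] : exists2 b, O b & ~ P b.
  apply: contrapT => nex; apply: nOP => b Ob; apply: contrapT => nP.
  by apply: nex; exists b.
have b0 : b != 0 by apply/eqP => b0; apply: nPb; rewrite b0; exact: (sr0 (vr_ring vP)).
exists (a / b); split.
  by apply: (maxidMl vP) => //; right; rewrite invrK.
by move=> /(srM (vr_ring vO)) /(_ Ob); rewrite divfK.
Qed.

(** If [x + z ^+ N] is in [P], then [z] is not, and [z ^+ M] dominates [z ^+ N]. So at most one
    exponent can cancel the pole of [x]. *)
Lemma vr_pow_gap P x z N M : valuation_ring setT P -> ~ P x -> (N < M)%N ->
  P (x + z ^+ N) -> ~ P (x + z ^+ M).
Proof.
move=> vP nPx NM PN PM; have rP := vr_ring vP; have fT := setT_subfield F.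
have nN : ~ P (z ^+ N) by move=> H; apply: nPx; rewrite -(addrK (z ^+ N) x); exact: (srB rP).
have nz : ~ P z by move=> /(srX rP N).
have D : P (z ^+ N * (z ^+ (M - N) - 1)).
  have -> : z ^+ N * (z ^+ (M - N) - 1) = (x + z ^+ M) - (x + z ^+ N).
    by rewrite mulrBr -exprD subnKC ?(ltnW NM) //; ring.
  exact: (srB rP).
have z0 : z != 0 by apply/eqP => z0; apply: nz; rewrite z0; exact: (sr0 rP).
have mV : maxid P (z ^+ (M - N))^-1.
  right; rewrite invrK -(subnSK NM) => /(vr_root vP); exact: nz.
have u : unit_of P (1 - (z ^+ (M - N))^-1).
  by apply: (unit_maxidD fT vP) => //; [exact: (unit1 vP)|exact: (maxidN vP)].
apply: nN; have -> : z ^+ N = z ^+ N * (z ^+ (M - N) - 1) *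
    ((1 - (z ^+ (M - N))^-1)^-1 * (z ^+ (M - N))^-1).
  have zMN : z ^+ (M - N) != 0 by rewrite expf_neq0.
  have [u0 _ _] := u.
  have u1 : z ^+ (M - N) - 1 != 0.
    have -> : z ^+ (M - N) - 1 = z ^+ (M - N) * (1 - (z ^+ (M - N))^-1) by field.
    by rewrite mulf_neq0.
  by field; rewrite u1 zMN.
apply: (srM rP) => //; apply: (srM rP); first by apply: unitW; apply: unitV.
exact: (maxidW vP).
Qed.

(** It suffices to find [x] in the maximal ideal of [P] and in no ring of the list, and to take the
    inverse of [1 + x]. When [x] meets the next ring, a high power of an element separating [P] from
    that ring is added; large exponents spoil none of the others. *)
Lemma vr_approximation P (Os : seq (set F)) : valuation_ring setT P ->
  (forall O, O \in Os -> [/\ valuation_ring setT O, ~ P `<=` O & ~ O `<=` P]) ->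
  exists x, unit_of P x /\ forall O, O \in Os -> maxid O x.
Proof.
move=> vP HO; have rP := vr_ring vP; have fT := setT_subfield F.
suff [x [mx nx]] : exists x, maxid P x /\ forall O, O \in Os -> ~ O x.
  exists (1 + x)^-1; split.
    apply: unitV; apply: (unit_maxidD fT vP) => //; exact: (unit1 vP).
  move=> O OOs; right; rewrite invrK => H; apply: (nx O OOs).
  have [vO _ _] := HO O OOs; have -> : x = (1 + x) - 1 by ring.
  by apply: (srB (vr_ring vO)) => //; exact: (sr1 (vr_ring vO)).
elim: Os HO => [_|O Os IH HO]; first by exists 0; split=> //; left.
have [|x [mx nx]] := IH; first by move=> O' O'Os; apply: HO; rewrite inE O'Os orbT.
have [vO nPO nOP] := HO O (mem_head _ _).
case: (pselect (O x)) => [Ox|nOx]; last first.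
  by exists x; split=> // O'; rewrite inE => /orP[/eqP->|/nx].
have [z [mz nOz]] := vr_separate vP vO nPO nOP.
have [M HM] : exists M, forall N, (M <= N)%N -> forall O', O' \in Os -> ~ O' (x + z ^+ N).
  elim: Os {IH} nx HO => [|O' Os IH] nx HO; first by exists 0%N.
  have [||M HM] := IH.
  - by move=> O'' H; apply: nx; rewrite inE H orbT.
  - by move=> O'' H; apply: HO; move: H; rewrite !inE => /orP[->//|->]; rewrite !orbT.
  have nO'x : ~ O' x by apply: nx; rewrite mem_head.
  have [vO' _ _] : [/\ valuation_ring setT O', ~ P `<=` O' & ~ O' `<=` P].
    by apply: HO; rewrite !inE eqxx orbT.
  case: (pselect (exists N, O' (x + z ^+ N))) => [[N ON]|nex].
    exists (maxn M N.+1) => N'; rewrite geq_max => /andP[MN' NN'] O''.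
    rewrite inE => /orP[/eqP->|]; last exact: HM.
    exact: vr_pow_gap vO' nO'x NN' ON.
  exists M => N MN O''; rewrite inE => /orP[/eqP->|]; last exact: HM.
  by move=> H; apply: nex; exists N.
exists (x + z ^+ M.+1); split.
  apply: (maxidD fT vP) => //; rewrite exprS; apply: (maxidMr vP) => //.
  by apply: (srX rP); exact: (maxidW vP).
move=> O'; rewrite inE => /orP[/eqP-> H|]; last by apply: HM.
apply: nOz; apply: (@vr_root _ _ _ M vO).
have -> : z ^+ M.+1 = (x + z ^+ M.+1) - x by ring.
exact: (srB (vr_ring vO)).
Qed.

End Approximation.

(** Common factors X are divided out, so that the relation remains nontrivial when it is reduced at
    a place where [w] vanishes. *)
Lemma common_zero_reduction (F : fieldType) (A : set F) n (p : 'I_n -> {poly F})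
    (x : 'I_n -> F) w : subfield_set A ->
  w != 0 -> (forall j l, A (p j)`_l) -> (exists j, p j != 0) ->
  \sum_j (p j).[w] * x j = 0 ->
  exists q : 'I_n -> {poly F}, [/\ forall j l, A (q j)`_l,
    exists j, (q j).[0] != 0 & \sum_j (q j).[w] * x j = 0].
Proof.
move=> fA w0; have rA := sf_ring fA.
have [N] := ubnP (\max_j size (p j)); elim: N p => // N IH p /ltnSE sN Ap [j0 pj0] S0.
case: (pselect (exists j, (p j).[0] != 0)) => [nz|z]; first by exists p.
have z' j : (p j).[0] = 0.
  by apply/eqP; apply/negPn/negP => H; apply: z; exists j.
pose q j := \poly_(l < (size (p j)).-1) (p j)`_l.+1.
have pq j : p j = q j * 'X.
  apply/polyP => -[|l]; rewrite coefMX //=; first by rewrite -horner_coef0 z'.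
  rewrite coef_poly; case: ltnP => // H; rewrite nth_default //.
  by move: H; case: (size (p j)).
have sq j : q j != 0 -> (size (q j) < size (p j))%N.
  by move=> q0; rewrite pq size_mulX.
apply: (IH q).
- case: N sN {IH} => [|N] sN.
    have := leq_trans (leq_bigmax j0) sN; rewrite leqn0 size_poly_eq0.
    by rewrite (negPf pj0).
  rewrite ltnS; apply/bigmax_leqP => j _; case: (eqVneq (q j) 0) => [->|/sq H].
    by rewrite size_poly0.
  by rewrite -ltnS; apply: (leq_trans H); apply: leq_trans (leq_bigmax j) sN.
- move=> j l; rewrite coef_poly; case: ifP => // _; exact: (sr0 rA).
- by exists j0; apply: contra pj0; rewrite pq => /eqP->; rewrite mul0r.
- apply: (mulIf w0); rewrite mul0r -[RHS]S0 mulr_suml; apply: eq_bigr => j _.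
  by rewrite [in RHS]pq hornerM hornerX mulrAC.
Qed.

(** * Primes of K and the places above them *)

Section Primes.
Variables (k K : fieldType) (i : {rmorphism k -> K}).
Variables (Kbar : closedFieldType) (iota : {rmorphism K -> Kbar}).
Hypothesis ffK : function_field_over i.
Hypothesis algKbar : forall z : Kbar, algebraicOver iota z.
Local Notation kb := (kbar i iota).
Let fkb := kbar_subfield i iota.
Let rkb := sf_ring fkb.
Let fT := setT_subfield Kbar.

Lemma valuation_ring_cap (F : fieldType) (L Q : set F) : subfield_set L ->
  valuation_ring setT Q -> valuation_ring L (Q `&` L).
Proof.
move=> fL vQ; have rQ := vr_ring vQ; have rL := sf_ring fL; split.
- by move=> x [].
- apply/subring_setP; split.
  + by split; [exact: (sr1 rQ)|exact: (sr1 rL)].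
  + by move=> x y [? ?] [? ?]; split; [exact: (srB rQ)|exact: (srB rL)].
  + by move=> x y [? ?] [? ?]; split; [exact: (srM rQ)|exact: (srM rL)].
- move=> x Lx; case: (vr_total vQ (x := x) I) => H; [left|right]; split=> //.
  exact: (sfV fL).
Qed.

Lemma place_prime Q : place i iota Q -> prime_of i (iota @^-1` Q).
Proof.
move=> [vQ QT kQ]; have rQ := vr_ring vQ; split.
- split=> //.
    apply/subring_setP; split=> [|x y|x y] /=; first by rewrite rmorph1; exact: (sr1 rQ).
      by rewrite rmorphB; exact: (srB rQ).
    by rewrite rmorphM; exact: (srM rQ).
  by move=> x _ /=; rewrite fmorphV; exact: (vr_total vQ).
- apply/eqP => E; move/eqP: QT; apply; apply/seteqP; split=> // z _.
  have KQ x : Q (iota x) by have : (iota @^-1` Q) x by rewrite E.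
  have [p p0 pz] := algKbar z.
  apply: (vr_integral fT vQ _ pz) => // [j|]; first by rewrite coef_map; exact: KQ.
  rewrite lead_coef_map; split; first by rewrite fmorph_eq0 lead_coef_eq0.
    exact: KQ.
  by rewrite -fmorphV; exact: KQ.
- by move=> _ [c _ <-] /=; apply: kQ; exists c.
Qed.

Lemma range_sub_place P Q : prime_of i P -> valuation_ring setT Q ->
  iota @^-1` Q = P -> place i iota Q.
Proof.
move=> [_ PT kP] vQ E; split=> //.
  apply/eqP => QT; move/eqP: PT; apply; rewrite -E QT; exact/seteqP.
by move=> _ [c _ <-] /=; have : (iota @^-1` Q) (i c) by rewrite E; apply: kP; exists c.
Qed.

(** Extending the valuation ring of [L] to Kbar changes neither its trace on K nor which elements of
    [L] are units. *)
Lemma ramified_place P (L : set Kbar) : prime_of i P -> subfield_set L ->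
  range iota `<=` L -> ramifies_in iota P L ->
  exists Q, [/\ place i iota Q, iota @^-1` Q = P &
    exists y, [/\ L y, y != 0 & forall x : K, x != 0 -> ~ unit_of Q (y / iota x)]].
Proof.
move=> pP fL KL [O [vO E [y [Ly y0 Hy]]]].
have OL : O != L.
  apply/eqP => OL; apply: (Hy 1 (oner_neq0 _)); rewrite rmorph1 divr1 OL.
  by split=> //; exact: (sfV fL).
have [Q [vQ QL]] := extend_valuation fL vO OL.
have EQ : iota @^-1` Q = P.
  rewrite -E -QL; apply/seteqP; split=> x /=; last by case.
  by move=> Qx; split=> //; apply: KL; exists x.
exists Q; split=> //; first exact: (range_sub_place pP).
exists y; split=> // x x0 [u0 Qu QV]; apply: (Hy x x0).
have Lu : L (y / iota x) by apply: (sf_div fL) => //; apply: KL; exists x.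
by split=> //; rewrite -QL; split=> //; exact: (sfV fL).
Qed.

Lemma unramified_values P (L Q : set Kbar) : subfield_set L ->
  place i iota Q -> iota @^-1` Q = P -> range iota `<=` L -> ~ ramifies_in iota P L ->
  same_values Q (range iota) L.
Proof.
move=> fL [vQ QT kQ] E KL nram y Ly y0; apply: contrapT => nex; apply: nram.
exists (Q `&` L); split; first exact: valuation_ring_cap.
  rewrite -E; apply/seteqP; split=> x /=; first by case.
  by move=> Qx; split=> //; apply: KL; exists x.
exists y; split=> // x x0 [u0 [Qu _] [QV _]]; apply: nex; exists (iota x).
by split; [exists x|rewrite fmorph_eq0|split].
Qed.

Lemma prime_extends P : prime_of i P -> exists Q, place i iota Q /\ iota @^-1` Q = P.
Proof.
move=> pP; have [vP PT kP] := pP; have rP := vr_ring vP.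
have fR := range_subfield iota.
have vO : valuation_ring (range iota) (iota @` P).
  split.
  - by move=> _ [x Px <-]; exists x.
  - apply/subring_setP; split.
    + by exists 1; [exact: (sr1 rP)|rewrite rmorph1].
    + move=> _ _ [x Px <-] [y Py <-]; exists (x - y); last by rewrite rmorphB.
      exact: (srB rP).
    + move=> _ _ [x Px <-] [y Py <-]; exists (x * y); last by rewrite rmorphM.
      exact: (srM rP).
  - move=> _ [x _ <-]; case: (vr_total vP (x := x) I) => H; [left|right].
      by exists x.
    by exists x^-1; rewrite ?fmorphV.
have OT : iota @` P != range iota.
  apply/eqP => E; move/eqP: PT; apply; apply/seteqP; split=> // x _.
  have : range iota (iota x) by exists x.
  by rewrite -E => -[x' Px' /fmorph_inj <-].
have [Q [vQ QL]] := extend_valuation fR vO OT.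
have EQ : iota @^-1` Q = P.
  apply/seteqP; split=> x /= H.
    have : (Q `&` range iota) (iota x) by split=> //; exists x.
    by rewrite QL => -[x' Px' /fmorph_inj <-].
  have : (iota @` P) (iota x) by exists x.
  by rewrite -QL => -[].
by exists Q; split=> //; exact: (range_sub_place pP).
Qed.

(** Rank one: if [x] is in [P'] but not in [P], a power of its inverse brings any [z] into [P], and
    multiplying back by that power of [x] puts [z] in [P'], which would be everything. *)
Lemma prime_sub_eq P P' : prime_of i P -> prime_of i P' -> P `<=` P' -> P = P'.
Proof.
move=> pP pP' sub; apply/seteqP; split=> // x P'x; apply: contrapT => nPx.
have [Q [pQ EQ]] := prime_extends pP.
have [vQ _ _] := pQ; have [vP' P'T _] := pP'; have rP' := vr_ring vP'.
have [vP _ _] := pP.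
have x0 : x != 0 by apply/eqP => x0; apply: nPx; rewrite x0; exact: (sr0 (vr_ring vP)).
move/eqP: P'T; apply; apply/seteqP; split=> // z _.
case: (eqVneq z 0) => [->|z0]; first exact: (sr0 rP').
have [|||N QN] := @archimedean _ _ _ _ _ _ pQ ffK algKbar (iota x)^-1 (iota z)^-1.
- by rewrite invr_eq0 fmorph_eq0.
- by right; rewrite invrK => H; apply: nPx; rewrite -EQ.
- by rewrite invr_eq0 fmorph_eq0.
have : P' (x^-1 ^+ N * z).
  by apply: sub; rewrite -EQ /= rmorphM rmorphXn fmorphV -[iota z]invrK.
move=> /(srM rP' (srX rP' N P'x)); rewrite mulrA -exprMn divff // expr1n mul1r //.
Qed.

Lemma transc_iota t : ~ algebraicOver i t -> ~ kb (iota t).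
Proof.
move=> nt [p p0]; rewrite map_poly_comp fmorph_root => pt; apply: nt.
by exists p.
Qed.

Lemma adj_range (t : K) v w : adj i iota v (iota t) ->
  @field_gen K (range i `|` [set t]) w -> adj i iota v (iota w).
Proof.
move=> at_; have fa := adj_subfield i iota v; have ra := sf_ring fa; move: w.
apply: (@field_gen_min _ _ [set w | adj i iota v (iota w)]).
  apply/subfield_setP; split=> /= [|x y|x y]; first by rewrite rmorph1; exact: (sr1 ra).
    by rewrite rmorphB; exact: (srB ra).
  by rewrite fmorph_div; exact: (sf_div fa).
move=> _ [[c _ <-]|->] //=.
by apply: adj_kbar; apply: range_kbar; exists c.
Qed.

Definition primes_at v : set (set K) :=
  [set P | prime_of i P /\ exists Q, [/\ place i iota Q, iota @^-1` Q = P & maxid Q v]].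

(** There are at most [d] such primes. Given d + 1 of them, take x_j a unit at the j-th prime and in
    the maximal ideal at the others. The x_j are dependent over k(t), hence over the polynomials in
    [v]; once the coefficients do not all vanish at 0, at a suitable prime exactly one term is a
    unit and the sum cannot be 0. *)
Lemma finite_primes_at t d (b : 'I_d -> K) v : v != 0 -> adj i iota v (iota t) ->
  (forall y : K, exists2 c : 'I_d -> K,
         forall j, field_gen (range i `|` [set t]) (c j) &
         y = \sum_(j < d) c j * b j) ->
  finite_set (primes_at v).
Proof.
move=> v0 av span; apply: contrapT => inf.
have [B BA cB] := infinite_set_fset d.+1 inf.
pose s := take d.+1 (finmap.enum_fset B).
have us : uniq s by apply: take_uniq; exact: finmap.fset_uniq.
have ss : size s = d.+1.
  by rewrite size_take; move: cB; rewrite leq_eqVlt => /orP[/eqP<-|->]; rewrite ?ltnn.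
have sA P : P \in s -> primes_at v P by move=> /mem_take H; apply: BA.
pose P_ (j : 'I_d.+1) := nth setT s j.
have Ps j : P_ j \in s by rewrite mem_nth // ss.
have Pinj j l : j != l -> P_ j != P_ l.
  by move=> jl; rewrite nth_uniq // ss.
have /choice[x xE] (j : 'I_d.+1) : exists x, unit_of (P_ j) x /\
    forall l, l != j -> maxid (P_ l) x.
  have [pj _] := sA _ (Ps j); have [vj _ _] := pj.
  have [O|x [ux mx]] := @vr_approximation _ (P_ j) [seq P_ l | l <- enum 'I_d.+1 & l != j] vj.
    case/mapP => l; rewrite mem_filter => /andP[lj _] ->.
    have [pl _] := sA _ (Ps l); have [vl _ _] := pl; split=> // /prime_sub_eq H.
      by move: (Pinj _ _ lj); rewrite (H pj pl) eqxx.
    by move: (Pinj _ _ lj); rewrite (H pl pj) eqxx.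
  exists x; split=> // l lj; apply: mx; apply: map_f.
  by rewrite mem_filter lj mem_enum.
have [c [Ac [j0 cj0] S0]] :=
  @dependent K _ (field_gen_subfield _) d.+1 d x b (ltnSn d) (fun j => span (x j)).
have [p [D [kp kD D0 pE]]] := adj_common (fun j => adj_range av (Ac j)).
have S1 : \sum_j (p j).[v] * iota (x j) = 0.
  transitivity (D.[v] * iota (\sum_j c j * x j)); last by rewrite S0 rmorph0 mulr0.
  rewrite rmorph_sum mulr_sumr; apply: eq_bigr => j _.
  by rewrite rmorphM pE mulrA; congr (_ * _); rewrite mulrC divfK.
have pj0 : exists j, p j != 0.
  exists j0; apply: contra cj0 => /eqP p0.
  by rewrite -(fmorph_eq0 iota) pE p0 horner0 mul0r.
have [q [kq [j qj] Sq]] := common_zero_reduction fkb v0 kp pj0 S1.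
have [pj [Q [pQ EQ mv]]] := sA _ (Ps j).
have [vQ _ _] := pQ; have rQ := vr_ring vQ.
have Qv := maxidW vQ I mv.
have Qq l : Q (q l).[v].
  by apply: (sr_horner rQ) => // m; exact: (place_kbar pQ).
have uP z : unit_of (P_ j) z -> unit_of Q (iota z).
  by rewrite -EQ => -[z0 Qz QzV]; split; rewrite ?fmorph_eq0 -?fmorphV.
have mP z : maxid (P_ j) z -> maxid Q (iota z).
  by rewrite -EQ => -[->|nz]; [left; rewrite rmorph0|right; rewrite -fmorphV].
have uj : unit_of Q ((q j).[v] * iota (x j)).
  apply: (unitM vQ); last by apply: uP; case: (xE j).
  have [r Qr ->] := poly_congr vQ (fun m => place_kbar pQ (kq j m)) (sr0 rQ) Qv.
  rewrite subr0; apply: (unit_maxidD fT vQ) => //; last exact: (maxidMr vQ).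
  apply: (place_kbar_unit pQ) => //; apply: (sr_horner rkb) => //.
  exact: (sr0 rkb).
have : unit_of Q (\sum_j (q j).[v] * iota (x j)).
  rewrite (bigD1 j) //=; apply: (unit_maxidD fT vQ) => //.
  apply: (maxid_sum fT vQ) => // l lj; apply: (maxidMl vQ) => //; apply: mP.
  by case: (xE l) => _; apply; rewrite eq_sym.
by rewrite Sq => -[/eqP].
Qed.

End Primes.

(** * Finiteness of exceptional primes and residues *)

Section Generic.
Variables (k K : fieldType) (i : {rmorphism k -> K}).
Variables (Kbar : closedFieldType) (iota : {rmorphism K -> Kbar}).
Hypothesis ffK : function_field_over i.
Hypothesis algKbar : forall z : Kbar, algebraicOver iota z.
Hypothesis char0 : [pchar Kbar] =i pred0.
Local Notation kb := (kbar i iota).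
Local Notation place := (place i iota).
Let fkb := kbar_subfield i iota.
Let rkb := sf_ring fkb.
Let fT := setT_subfield Kbar.

(** [u] is a root of a polynomial over kbar[t] and is integral wherever the leading coefficient is a
    unit; [bad] lists the roots of that coefficient. *)
Lemma generic_integral t u : ~ kb t -> exists bad : seq Kbar,
  (forall g, g \in bad -> kb g) /\
  forall Q g, place Q -> kb g -> maxid Q (t - g) -> g \notin bad -> Q u.
Proof.
move=> nt; have [G [G0 kG E]] := relation ffK algKbar u nt.
have c0 : lead_coef G != 0 by rewrite lead_coef_eq0.
have [bad [cE kbad _]] := kbar_split c0 (kG _).
exists bad; split=> // Q g pQ kg m gbad; have [vQ _ _] := pQ; have rQ := vr_ring vQ.
have Qt : Q t.
  rewrite -(subrK g t); apply: (srD rQ); first exact: (maxidW vQ).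
  exact: (place_kbar pQ).
have uc : unit_of Q (lead_coef G).[t].
  apply: (kbar_poly_unit pQ) => //; first exact: kG.
  move=> b kb_b; rewrite cE rootZ ?lead_coef_eq0 // root_prod_XsubC => bb.
  by apply: (residue_neq pQ kg) => //; apply: contraNneq gbad => <-.
have lE : lead_coef (map_poly (horner_eval t) G) = (lead_coef G).[t].
  by rewrite lead_coef_map_eq // /horner_eval; case: uc.
apply: (vr_integral fT vQ (p := map_poly (horner_eval t) G)) => //.
- by rewrite rootE -horner_swapXY horner2_swapXY E.
- move=> j; rewrite coef_map; apply: (sr_horner rQ) => // l.
  exact: (place_kbar pQ).
- by rewrite lE.
Qed.

Lemma generic_unit t u : ~ kb t -> u != 0 -> exists bad : seq Kbar,
  forall Q g, place Q -> kb g -> maxid Q (t - g) -> g \notin bad -> unit_of Q u.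
Proof.
move=> nt u0; have [bad [_ H]] := generic_integral u nt.
have [bad' [_ H']] := generic_integral u^-1 nt.
exists (bad ++ bad') => Q g pQ kg m; rewrite mem_cat negb_or => /andP[gb gb'].
by split=> //; [exact: H gb|exact: H' gb'].
Qed.

Lemma generic_units t (us : seq Kbar) : ~ kb t -> (forall u, u \in us -> u != 0) ->
  exists bad : seq Kbar, forall Q g, place Q -> kb g -> maxid Q (t - g) ->
    g \notin bad -> forall u, u \in us -> unit_of Q u.
Proof.
move=> nt; elim: us => [|u us IH] Hu; first by exists [::].
have [|bad H] := IH; first by move=> v vus; apply: Hu; rewrite inE vus orbT.
have [bad' H'] := generic_unit nt (Hu u (mem_head _ _)).
exists (bad ++ bad') => Q g pQ kg m; rewrite mem_cat negb_or => /andP[gb gb'] v.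
by rewrite inE => /orP[/eqP->|]; [exact: H' gb'|exact: (H Q g)].
Qed.

(** At a place above a pole of [z], either [t] has a pole too or its residue is in the finite list
    of [generic_integral]. *)
Lemma finite_poles (z : K) : finite_set [set P | prime_of i P /\ ~ P z].
Proof.
have [[t [nt [d [b span]]]] _] := ffK; have nT := @transc_iota _ _ _ _ iota _ nt.
have [bad [kbad H]] := generic_integral (iota z) nT.
have T0 : iota t != 0.
  by apply/eqP => T0; apply: nT; rewrite T0; exact: (sr0 rkb).
have fin v : v != 0 -> adj i iota v (iota t) -> finite_set (primes_at i iota v).
  by move=> v0 av; exact: (finite_primes_at ffK algKbar v0 av span).
apply: (@sub_finite_set _ _ (primes_at i iota (iota t)^-1 `|`
    \bigcup_(g in [set` bad]) primes_at i iota (iota t - g))).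
  move=> P [pP nPz]; have [Q [pQ EQ]] := prime_extends iota pP; have [vQ _ _] := pQ.
  case: (pselect (Q (iota t))) => [QT|nQT]; last first.
    by left; split=> //; exists Q; split=> //; right; rewrite invrK.
  have [g [kg mg]] := residue pQ ffK algKbar QT.
  right; exists g; last by split=> //; exists Q.
  by apply: contrapT => /negP gb; apply: nPz; rewrite -EQ; exact: (H Q g).
rewrite finite_setU; split.
  apply: fin; first by rewrite invr_eq0.
  by rewrite -[X in adj _ _ _ X]invrK; apply: (sfV (adj_subfield _ _ _)); exact: adj_id.
apply: bigcup_finite; first exact: finite_seq.
move=> g gb; have kg := kbad g gb; apply: fin.
  by rewrite subr_eq0; apply/eqP => Tg; apply: nT; rewrite Tg.
rewrite -[X in adj _ _ _ X](subrK g); apply: (srD (sf_ring (adj_subfield _ _ _))).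
  exact: adj_id.
exact: adj_kbar.
Qed.

(** A pole of [u], or of its inverse, at any place above P forces a pole at P of a coefficient of a
    monic equation over K. *)
Lemma finite_nonunits u : u != 0 -> finite_set [set P | prime_of i P /\
  exists Q, [/\ place Q, iota @^-1` Q = P & ~ unit_of Q u]].
Proof.
move=> u0.
have fin v : finite_set [set P | prime_of i P /\
    exists Q, [/\ place Q, iota @^-1` Q = P & ~ Q v]].
  have [p /monicP pm pv] := (integral_algebraic iota v).1 (algKbar v).
  apply: (@sub_finite_set _ _ (\bigcup_(z in [set` (p : seq K)]) [set P | prime_of i P /\ ~ P z])).
    move=> P [pP [Q [pQ EQ nQ]]]; have [vQ _ _] := pQ.
    apply: contrapT => nP; apply: nQ.
    have Pp j : Q (iota p`_j).
      have [Hj|Hj] := ltnP j (size p); last first.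
        by rewrite nth_default // rmorph0; exact: (sr0 (vr_ring vQ)).
      apply: contrapT => nQj; apply: nP; exists p`_j; first exact: mem_nth.
      by split=> //; rewrite -EQ.
    apply: (vr_integral fT vQ _ pv) => // [j|]; first by rewrite coef_map; exact: Pp.
    by rewrite lead_coef_map pm rmorph1; exact: (unit1 vQ).
  by apply: bigcup_finite; [exact: finite_seq|move=> z _; exact: finite_poles].
apply: (@sub_finite_set _ _ ([set P | prime_of i P /\
    exists Q, [/\ place Q, iota @^-1` Q = P & ~ Q u]] `|` [set P | prime_of i P /\
    exists Q, [/\ place Q, iota @^-1` Q = P & ~ Q u^-1]])).
  move=> P [pP [Q [pQ EQ nu]]].
  case: (pselect (Q u)) => [Qu|nQu]; last by left; split=> //; exists Q.
  by right; split=> //; exists Q; split=> // QV; apply: nu; split.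
by rewrite finite_setU; split; exact: fin.
Qed.

(** The list is chosen before the place: the coefficients of a separable equation, [al] itself and
    the derivative there. Zeros are dropped, being integral anyway, so that units may be required of
    the rest. *)
Lemma etale_criterion (A : set Kbar) al : subfield_set A -> alg_over A al ->
  exists us : seq Kbar, (forall u, u \in us -> u != 0) /\
    forall Q L, place Q -> (forall u, u \in us -> unit_of Q u) ->
      A `<=` etale_closure i iota Q L -> etale_closure i iota Q L al.
Proof.
move=> fA aal; have [p [Ap pal p'al]] := separable_relation char0 fA aal.
exists [seq u <- [:: al, p^`().[al] & (p : seq Kbar)] | u != 0]; split.
  by move=> u; rewrite mem_filter => /andP[].
move=> Q L pQ H AM; have [vQ _ _] := pQ; have rQ := vr_ring vQ.
have HQ u : u \in [:: al, p^`().[al] & (p : seq Kbar)] -> Q u.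
  move=> uin; case: (eqVneq u 0) => [->|u0]; first exact: (sr0 rQ).
  by apply: unitW; apply: H; rewrite mem_filter u0.
apply: (etale_closure_etale ffK algKbar pQ (g := p)) => //.
- by move=> j; exact: AM.
- move=> j; have [Hj|Hj] := ltnP j (size p); last by rewrite nth_default //; exact: (sr0 rQ).
  by apply: HQ; rewrite !inE mem_nth ?orbT.
- by apply: HQ; rewrite mem_head.
- by apply: H; rewrite mem_filter p'al !inE eqxx orbT.
Qed.

Lemma etale_criterion_seq (A : set Kbar) (als : seq Kbar) : subfield_set A ->
  (forall al, al \in als -> alg_over A al) ->
  exists us : seq Kbar, (forall u, u \in us -> u != 0) /\
    forall Q L, place Q -> (forall u, u \in us -> unit_of Q u) ->
      A `<=` etale_closure i iota Q L ->
      forall al, al \in als -> etale_closure i iota Q L al.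
Proof.
move=> fA; elim: als => [|al als IH] H; first by exists [::].
have [|us [Hus Eus]] := IH; first by move=> b bals; apply: H; rewrite inE bals orbT.
have [us' [Hus' Eus']] := etale_criterion fA (H al (mem_head _ _)).
exists (us ++ us'); split.
  by move=> u; rewrite mem_cat => /orP[/Hus|/Hus'].
move=> Q L pQ Hu AM b; rewrite inE => /orP[/eqP->|].
  by apply: Eus' => // u uin; apply: Hu; rewrite mem_cat uin orbT.
by apply: Eus => // u uin; apply: Hu; rewrite mem_cat uin.
Qed.

End Generic.

(** A primitive element [th] is sent to a root [r] of its minimal polynomial; [f] does not depend on
    the chosen representatives because every polynomial over K vanishing at [th] vanishes at [r]. *)
Lemma finite_extension_embedding (K : fieldType) (E : fieldExtType K)
    (Kbar : closedFieldType) (iota : {rmorphism K -> Kbar}) : [pchar K] =i pred0 ->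
  exists j : {rmorphism E -> Kbar}, forall x, j (in_alg E x) = iota x.
Proof.
move=> ch0.
have sep : separable 1 {:E}.
  apply/separableP => y _; apply: pcharf0_separable => p.
  by rewrite (fmorph_pchar (in_alg E)); exact: ch0.
have gen := eq_adjoin_separable_generator sep (sub1v _).
set th := separable_generator 1 {:E} in gen.
have /polyOver1P[q0 q0E] := minPolyOver 1 th.
have repr y : exists q : {poly K}, y = (map_poly (in_alg E) q).[th].
  have : y \in <<1; th>>%VS by rewrite -gen memvf.
  by move/Fadjoin_polyP => [p /polyOver1P[q ->] ->]; exists q.
have [q qE] := choice repr.
have sq0 : size (map_poly iota q0) != 1%N.
  by rewrite size_map_poly -(size_map_poly (in_alg E)) -q0E size_minPoly.
have /closed_rootP[r rq0] := sq0.
have zero (p : {poly K}) : (map_poly (in_alg E) p).[th] = 0 -> (map_poly iota p).[r] = 0.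
  move=> pth; have : minPoly 1 th %| map_poly (in_alg E) p.
    apply: minPoly_dvdp; last exact/eqP.
    by apply/polyOver1P; exists p.
  rewrite q0E dvdp_map => /dvdpP[s ->]; rewrite rmorphM hornerM (rootP rq0) mulr0 //.
pose f y := (map_poly iota (q y)).[r].
have fE p : f (map_poly (in_alg E) p).[th] = (map_poly iota p).[r].
  apply/eqP; rewrite -subr_eq0 /f -hornerN -hornerD -rmorphN -rmorphD; apply/eqP/zero.
  by rewrite rmorphB hornerD hornerN -qE subrr.
have fz : zmod_morphism f.
  by move=> x y; rewrite [in LHS](qE x) [in LHS](qE y) -hornerN -hornerD -rmorphN -rmorphD fE rmorphB hornerD hornerN.
have fm : monoid_morphism f.
  split=> [|x y]; first by have := fE 1; rewrite !rmorph1 !hornerC.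
  by rewrite [in LHS](qE x) [in LHS](qE y) -hornerM -rmorphM fE rmorphM hornerM.
pose F : {rmorphism E -> Kbar} := HB.pack f (GRing.isZmodMorphism.Build _ _ f fz)
  (GRing.isMonoidMorphism.Build _ _ f fm).
exists F => x; have := fE x%:P; rewrite !map_polyC !hornerC; exact.
Qed.

(** * Rational maps as pairs of forms *)

Section RatMap.
Variable F : fieldType.
Implicit Types (p q r s : {poly F}) (a : option F) (n m : nat).

(* Value at a point of the projective line of a form of degree [n], given by
   its dehomogenization; infinity is the point (1 : 0). *)
Definition ev n p a : F := if a is Some x then p.[x] else p`_n.

Definition pt (u v : F) : option F := if v == 0 then None else Some (u / v).

Definition ratmap n p q a : option F := pt (ev n p a) (ev n q a).

Definition nondeg n p q := [/\ (size p <= n.+1)%N, (size q <= n.+1)%N &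
  forall a, ~ (ev n p a = 0 /\ ev n q a = 0)].

(** Composition of forms: [p], homogenized in degree [n], is evaluated at the pair (r, s). *)
Definition hcomp n p r s : {poly F} :=
  \sum_(i < n.+1) p`_i *: (r ^+ i * s ^+ (n - i)).

Lemma pt_scale c u v : c != 0 -> pt (c * u) (c * v) = pt u v.
Proof.
move=> c0; rewrite /pt mulf_eq0 (negPf c0) /=; case: eqVneq => // v0.
by congr Some; field; rewrite c0 v0.
Qed.

Lemma pt_eq u v u' v' : ~ (u = 0 /\ v = 0) -> ~ (u' = 0 /\ v' = 0) ->
  pt u v = pt u' v' <-> u * v' = v * u'.
Proof.
move=> nz nz'; rewrite /pt; case: eqVneq => [v0|v0]; case: eqVneq => [v0'|v0'].
- by rewrite v0 v0' mulr0 mul0r.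
- split=> // /esym; rewrite v0 mul0r => /esym/eqP; rewrite mulf_eq0 (negPf v0') orbF.
  by move=> /eqP u0; case: nz.
- split=> // /eqP; rewrite v0' mulr0 eq_sym mulf_eq0 (negPf v0) => /eqP u0.
  by case: nz'.
split=> [[E]|E]; last by congr Some; apply/eqP; rewrite eqr_div // E mulrC.
by move/eqP: E; rewrite eqr_div // => /eqP->; rewrite mulrC.
Qed.

Lemma ratmap_scale n c p q a : c != 0 -> ratmap n (c *: p) (c *: q) a = ratmap n p q a.
Proof.
move=> c0; rewrite /ratmap.
by case: a => [x|]; rewrite /= ?hornerZ ?coefZ pt_scale.
Qed.

Lemma size_form_mul n m p q : (size p <= n.+1)%N -> (size q <= m.+1)%N ->
  (size (p * q)%R <= (n + m).+1)%N.
Proof.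
move=> sp sq; apply: leq_trans (size_polyMleq _ _) _.
by rewrite -subn1 leq_subLR add1n -addnS -addSn leq_add.
Qed.

Lemma ev_mul n m p q a : (size p <= n.+1)%N -> (size q <= m.+1)%N ->
  ev (n + m) (p * q) a = ev n p a * ev m q a.
Proof.
case: a => [x|] sp sq; first exact: hornerM.
rewrite /= coefM (bigD1 (inord n)) //= inordK ?ltnS ?leq_addr // addKn.
rewrite big1 ?addr0 // => j; rewrite -val_eqE /= inordK ?ltnS ?leq_addr // => jn.
case: (ltngtP j n) jn => // H _.
  rewrite [q`__]nth_default ?mulr0 //; apply: (leq_trans sq).
  by rewrite -(ltn_add2l j) subnKC ?ltn_add2r // -ltnS.
by rewrite nth_default ?mul0r // (leq_trans sp).
Qed.

Lemma ev_exp m r k a : (size r <= m.+1)%N ->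
  (size (r ^+ k)%R <= (k * m).+1)%N /\ ev (k * m) (r ^+ k) a = ev m r a ^+ k.
Proof.
move=> sr; elim: k => [|k [sk IH]].
  rewrite mul0n !expr0 size_poly1; split=> //.
  by case: a => [x|] /=; rewrite ?hornerC // coef1.
by rewrite mulSn exprS; split; [exact: size_form_mul|rewrite ev_mul // IH exprS].
Qed.

Lemma ev_hcomp n m p r s a : (size r <= m.+1)%N -> (size s <= m.+1)%N ->
  (size (hcomp n p r s) <= (n * m).+1)%N /\
  ev (n * m) (hcomp n p r s) a =
    \sum_(i < n.+1) p`_i * (ev m r a ^+ i * ev m s a ^+ (n - i)).
Proof.
move=> sr ss.
have D (i : 'I_n.+1) : (n * m = i * m + (n - i) * m)%N.
  by rewrite -mulnDl subnKC // -ltnS.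
have T (i : 'I_n.+1) : (size (r ^+ i * s ^+ (n - i))%R <= (n * m).+1)%N /\
    ev (n * m) (r ^+ i * s ^+ (n - i)) a = ev m r a ^+ i * ev m s a ^+ (n - i).
  have [s1 e1] := ev_exp i a sr; have [s2 e2] := ev_exp (n - i) a ss.
  by rewrite (D i); split;
    [exact: size_form_mul|rewrite ev_mul // e1 e2].
split.
  apply: (leq_trans (size_sum _ _ _)); apply/bigmax_leqP => i _.
  by apply: leq_trans (size_scale_leq _ _) _; case: (T i).
have -> : ev (n * m) (hcomp n p r s) a =
    \sum_(i < n.+1) p`_i * ev (n * m) (r ^+ i * s ^+ (n - i)) a.
  case: a {T} => [x|] /=; rewrite /hcomp ?horner_sum ?coef_sum.
    by apply: eq_bigr => i _; rewrite hornerZ.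
  by apply: eq_bigr => i _; rewrite coefZ.
by apply: eq_bigr => i _; case: (T i) => _ ->.
Qed.

(** The scalar that carries the normalized coordinates of [pt u v], either (1, 0) or (z, 1), to (u,
    v). *)
Definition pt_factor (u v : F) : F := if v == 0 then u else v.

Lemma form_value n p u v : (size p <= n.+1)%N ->
  \sum_(i < n.+1) p`_i * (u ^+ i * v ^+ (n - i)) =
    pt_factor u v ^+ n * ev n p (pt u v).
Proof.
move=> sp; rewrite /pt_factor /pt; case: eqVneq => [->|v0] /=.
  rewrite big_ord_recr /= subnn expr0 mulr1 big1 ?add0r 1?mulrC // => i _.
  by rewrite expr0n subn_eq0 leqNgt ltn_ord /= !mulr0.
rewrite (horner_coef_wide _ sp) mulr_sumr; apply: eq_bigr => i _.
rewrite [RHS]mulrCA; congr (_ * _); rewrite expr_div_n.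
have -> : v ^+ n = v ^+ (n - i) * v ^+ i by rewrite -exprD subnK // -ltnS.
by field; rewrite expf_neq0.
Qed.

Lemma pt_factor_neq0 u v : ~ (u = 0 /\ v = 0) -> pt_factor u v != 0.
Proof.
move=> nz; rewrite /pt_factor; case: (eqVneq v 0) => // v0; apply/eqP => u0; exact: nz.
Qed.

Lemma nondeg_hcomp n m p q r s : nondeg n p q -> nondeg m r s ->
  nondeg (n * m) (hcomp n p r s) (hcomp n q r s).
Proof.
move=> [sp sq nz] [sr ss nz']; split.
- by case: (ev_hcomp n p None sr ss).
- by case: (ev_hcomp n q None sr ss).
move=> a; have [_ ->] := ev_hcomp n p a sr ss; have [_ ->] := ev_hcomp n q a sr ss.
rewrite !form_value // => -[/eqP e1 /eqP e2].
have f0 : pt_factor (ev m r a) (ev m s a) ^+ n != 0.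
  by rewrite expf_neq0 // pt_factor_neq0.
move: e1 e2; rewrite !mulf_eq0 (negPf f0) /= => /eqP e1 /eqP e2.
exact: (nz _ (conj e1 e2)).
Qed.

Lemma ratmap_hcomp n m p q r s a : nondeg n p q -> nondeg m r s ->
  ratmap (n * m) (hcomp n p r s) (hcomp n q r s) a = ratmap n p q (ratmap m r s a).
Proof.
move=> [sp sq nz] [sr ss nz']; rewrite /ratmap.
have [_ ->] := ev_hcomp n p a sr ss; have [_ ->] := ev_hcomp n q a sr ss.
by rewrite !form_value // pt_scale // expf_neq0 // pt_factor_neq0.
Qed.

Lemma nondeg_size n p q : nondeg n p q -> maxn (size p) (size q) = n.+1.
Proof.
move=> [sp sq nz]; apply/eqP; rewrite eqn_leq geq_max sp sq /= leqNgt; apply/negP.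
rewrite gtn_max !ltnS => /andP[sp' sq']; apply: (nz None).
by rewrite /= !nth_default.
Qed.

Lemma nondeg_scale n c p q : c != 0 -> nondeg n p q -> nondeg n (c *: p) (c *: q).
Proof.
move=> c0 [sp sq nz]; split; rewrite ?size_scale // => a [e1 e2]; apply: (nz a).
have E r : ev n (c *: r) a = c * ev n r a by case: (a) => [x|] /=; rewrite ?hornerZ ?coefZ.
move: e1 e2; rewrite !E => /eqP + /eqP; rewrite !mulf_eq0 (negPf c0) /=.
by move=> /eqP-> /eqP->.
Qed.

Lemma coprime_proportional p q p' q' : coprimep p q -> coprimep p' q' ->
  q != 0 -> q' != 0 -> p * q' = q * p' ->
  exists c, [/\ c != 0, p' = c *: p & q' = c *: q].
Proof.
move=> cpq cpq' q0 q0' E.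
have qq' : q %| q'.
  by rewrite -(Gauss_dvdpr q' (q := p)) 1?coprimep_sym // E dvdp_mulr.
have q'q : q' %| q.
  rewrite -(Gauss_dvdpl q (q := p')) -?E ?dvdp_mull //.
  by rewrite coprimep_sym.
have : q %= q' by rewrite /eqp qq' q'q.
move=> /eqpP[[c1 c2] /= /andP[c10 c20] Ec].
have q'E : q' = (c1 / c2) *: q.
  by rewrite mulrC -scalerA Ec scalerA mulVf // scale1r.
exists (c1 / c2); split=> //; first by rewrite mulf_neq0 ?invr_eq0.
by apply: (mulfI q0); rewrite -E q'E -!scalerAr; congr (_ *: _); rewrite mulrC.
Qed.

End RatMap.

Lemma map_hcomp (F E : fieldType) (j : {rmorphism F -> E}) n (p r s : {poly F}) :
  map_poly j (hcomp n p r s) = hcomp n (map_poly j p) (map_poly j r) (map_poly j s).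
Proof.
rewrite /hcomp rmorph_sum; apply: eq_bigr => l _.
by rewrite /= map_polyZ rmorphM !rmorphXn coef_map.
Qed.

Lemma ratmap_map (F E : fieldType) (j : {rmorphism F -> E}) n (p q : {poly F}) a :
  ratmap n (map_poly j p) (map_poly j q) (omap j a) = omap j (ratmap n p q a).
Proof.
have H r : ev n (map_poly j r) (omap j a) = j (ev n r a).
  by case: a => [x|] /=; rewrite ?horner_map ?coef_map.
rewrite /ratmap /pt !H fmorph_eq0; case: eqP => //= _.
by rewrite fmorph_div.
Qed.

(** * Uniqueness of the forms over an algebraically closed field *)

Section Closed.
Variable E : closedFieldType.
Implicit Types p q : {poly E}.

Lemma nondeg_coprime n p q : nondeg n p q -> coprimep p q.
Proof.
move=> [_ _ nz]; rewrite /coprimep; apply/negPn/negP => /closed_rootP[x].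
by rewrite root_gcd => /andP[/eqP px /eqP qx]; apply: (nz (Some x)).
Qed.

Lemma nondeg_neq0 n p q : (0 < n)%N -> nondeg n p q -> q != 0.
Proof.
case: n => // n _ [sp sq nz]; apply/eqP => q0; subst q.
have p1 : size p == 1%N.
  apply/negPn/negP => /closed_rootP[x /eqP px]; apply: (nz (Some x)).
  by rewrite /= horner0.
apply: (nz None); rewrite /= coef0 nth_default //; by rewrite (eqP p1).
Qed.

Lemma poly_vanish p : (forall x, p.[x] = 0) -> p = 0.
Proof.
move=> H; have s1 : size (p + 1) == 1%N.
  apply/negPn/negP => /closed_rootP[x]; rewrite rootE hornerD H hornerC add0r.
  by rewrite oner_eq0.
have /size_poly1P[c c0 pc] := s1.
have -> : p = (c - 1)%:P by rewrite polyCB -pc addrK.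
by have := H 0; rewrite -[p](addrK 1) pc -polyC1 -polyCB hornerC => ->.
Qed.

Lemma ratmap_inj n m p q p' q' : nondeg n p q -> nondeg m p' q' ->
  q != 0 -> (forall a, ratmap n p q a = ratmap m p' q' a) ->
  n = m /\ exists c, [/\ c != 0, p' = c *: p & q' = c *: q].
Proof.
move=> nd nd' q0 H; have [sp sq nz] := nd; have [sp' sq' nz'] := nd'.
have X : p * q' = q * p'.
  apply/eqP; rewrite -subr_eq0; apply/eqP/poly_vanish => x.
  rewrite hornerD hornerN !hornerM; apply/eqP; rewrite subr_eq0; apply/eqP.
  by apply/(pt_eq (nz (Some x)) (nz' (Some x))); exact: (H (Some x)).
have q0' : q' != 0.
  apply/eqP => q'0; move/eqP: X; rewrite q'0 mulr0 eq_sym mulf_eq0 (negPf q0) /=.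
  by move/eqP => p'0; apply: (nz' None); rewrite p'0 q'0 /= coef0.
have [c [c0 E1 E2]] := coprime_proportional (nondeg_coprime nd) (nondeg_coprime nd') q0 q0' X.
split; last by exists c.
have := nondeg_size nd'; rewrite E1 E2 !size_scale // (nondeg_size nd).
by case.
Qed.

End Closed.

(** * Fractions in lowest terms and their evaluation *)

Section RatFunctions.
Variables (F : fieldType).
Implicit Types f g : {fraction {poly F}}.
Local Notation "p %:F" := (FracField.tofrac p).

Lemma frac_repr f : \d_(repr f) != 0 /\ f = (\n_(repr f))%:F / (\d_(repr f))%:F.
Proof.
have d0 : \d_(repr f) != 0 by exact: denom_ratioP.
split=> //; apply: (mulIf (x := (\d_(repr f))%:F)); first by rewrite tofrac_eq0.
rewrite divfK ?tofrac_eq0 // -[X in X * _](reprK f).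
have key (x : {ratio {poly F}}) : (\pi_(FracField.type {poly F}) x)%qT * (\d_x)%:F = (\n_x)%:F.
  unlock FracField.tofrac; rewrite -[LHS]FracField.pi_mul; apply/eqmodP.
  rewrite /= FracField.equivfE /FracField.mulf.
  rewrite !numden_Ratio ?mulf_neq0 ?oner_neq0 ?denom_ratioP //.
  by rewrite !mulr1 mulrC.
exact: key.
Qed.

Lemma rat_coprime f : [/\ coprimep (rat_num f) (rat_den f), rat_den f != 0 &
  f = (rat_num f)%:F / (rat_den f)%:F].
Proof.
have [d0 fE] := frac_repr f; rewrite /rat_num /rat_den.
set n := (\n_(repr f)) in fE *; set d := (\d_(repr f)) in d0 fE *.
have g0 : rat_gcd f != 0 by rewrite gcdp_eq0 (negPf d0) andbF.
have dE : d = d %/ rat_gcd f * rat_gcd f by rewrite divpK // dvdp_gcdr.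
have nE : n = n %/ rat_gcd f * rat_gcd f by rewrite divpK // dvdp_gcdl.
have dg0 : d %/ rat_gcd f != 0 by apply: contraNneq d0 => H; rewrite dE H mul0r.
split=> //; first by apply: coprimep_div_gcd; rewrite d0 orbT.
rewrite [LHS]fE {1}nE {1}dE !rmorphM /= invfM mulrACA divff ?mulr1 //.
by rewrite tofrac_eq0.
Qed.

Lemma rat_reduced f p q : coprimep p q -> q != 0 -> f = p%:F / q%:F ->
  exists c, [/\ c != 0, rat_num f = c *: p & rat_den f = c *: q].
Proof.
move=> cpq q0 fE; have [cnd d0 fE'] := rat_coprime f.
apply: coprime_proportional => //; apply/eqP.
rewrite -tofrac_eq !rmorphM /=; apply/eqP.
have q0' : q%:F != 0 by rewrite tofrac_eq0.
have d0' : (rat_den f)%:F != 0 by rewrite tofrac_eq0.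
have pE : f * q%:F = p%:F by rewrite fE (divfK q0').
have nE : f * (rat_den f)%:F = (rat_num f)%:F by rewrite {1}fE' (divfK d0').
by rewrite -pE -nE -mulrA [RHS]mulrCA.
Qed.

Lemma rat_evalE f a : rat_eval f a = ratmap (rat_deg f) (rat_num f) (rat_den f) a.
Proof. by case: a. Qed.

End RatFunctions.

Lemma frac_shift (F : fieldType) (c x u v : F) : u != 0 -> v != 0 ->
  c * (x / v) = c * (x * u) / (u * v).
Proof. by move=> u0 v0; field; rewrite u0 v0. Qed.

Lemma frac_cancel (F : fieldType) (a b s : F) : s != 0 -> b != 0 ->
  (a / s) / (b / s) = a / b.
Proof. by move=> s0 b0; field; rewrite s0 b0. Qed.

Section RatMapEval.
Variables (F : fieldType) (E : closedFieldType) (j : {rmorphism F -> E}).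
Implicit Types f g : {fraction {poly F}}.
Local Notation "p %:F" := (FracField.tofrac p).

Lemma rat_deg_nondeg f p q n : q != 0 -> f = p%:F / q%:F ->
  nondeg n (map_poly j p) (map_poly j q) -> rat_deg f = n.
Proof.
move=> q0 fE nd.
have cpq : coprimep p q by rewrite -(coprimep_map j); exact: nondeg_coprime nd.
have [c [c0 nE dE]] := rat_reduced cpq q0 fE.
have := nondeg_size nd; rewrite !size_map_poly => smax.
by rewrite /rat_deg nE dE !size_scale // smax.
Qed.

Lemma rat_nondeg f :
  nondeg (rat_deg f) (map_poly j (rat_num f)) (map_poly j (rat_den f)).
Proof.
have [cnd d0 _] := rat_coprime f.
have m0 : (0 < maxn (size (rat_num f)) (size (rat_den f)))%N.
  by rewrite leq_max !size_poly_gt0 d0 orbT.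
have sn : (rat_deg f).+1 = maxn (size (rat_num f)) (size (rat_den f)) by rewrite prednK.
split; rewrite ?size_map_poly ?sn ?leq_maxl ?leq_maxr // => -[x|] /=.
  move=> [/eqP px /eqP qx]; have : coprimep (map_poly j (rat_num f)) (map_poly j (rat_den f)).
    by rewrite coprimep_map.
  by move/coprimep_root => /(_ x px); rewrite (eqP qx) eqxx.
rewrite !coef_map => -[/eqP + /eqP]; rewrite !fmorph_eq0 => /eqP n0 /eqP d0'.
have : (size (rat_num f) <= rat_deg f)%N /\ (size (rat_den f) <= rat_deg f)%N.
  have H (p : {poly F}) : (size p <= (rat_deg f).+1)%N -> p`_(rat_deg f) = 0 ->
      (size p <= rat_deg f)%N.
    move=> sp p0; rewrite leqNgt; apply/negP => lt.
    have sE : size p = (rat_deg f).+1 by apply/eqP; rewrite eqn_leq sp lt.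
    have : lead_coef p = 0 by rewrite lead_coefE sE.
    by move/eqP; rewrite lead_coef_eq0 => /eqP p00; rewrite p00 size_poly0 in lt.
  by split; apply: H => //; rewrite sn ?leq_maxl ?leq_maxr.
by move=> /andP; rewrite -geq_max -sn ltnn.
Qed.

Lemma rat_map_eval_frac f p q n a : q != 0 -> f = p%:F / q%:F ->
  nondeg n (map_poly j p) (map_poly j q) ->
  rat_eval (rat_map j f) a = ratmap n (map_poly j p) (map_poly j q) a.
Proof.
move=> q0 fE nd.
have cpq : coprimep p q by rewrite -(coprimep_map j); exact: nondeg_coprime nd.
have [c [c0 nE dE]] := rat_reduced cpq q0 fE.
have jc0 : j c != 0 by rewrite fmorph_eq0.
have gE : rat_map j f = FracField.tofrac (map_poly j (rat_num f)) /
  FracField.tofrac (map_poly j (rat_den f)) by [].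
have cc : coprimep (map_poly j (rat_num f)) (map_poly j (rat_den f)).
  by rewrite coprimep_map; case: (rat_coprime f).
have d0 : map_poly j (rat_den f) != 0 by rewrite map_poly_eq0; case: (rat_coprime f).
have [e [e0 nE' dE']] := rat_reduced cc d0 gE.
have ec0 : e * j c != 0 by rewrite mulf_neq0.
rewrite rat_evalE nE' dE' nE dE !map_polyZ !scalerA ratmap_scale //; congr ratmap.
have := nondeg_size (nondeg_scale ec0 nd).
by rewrite /rat_deg nE' dE' nE dE !map_polyZ !scalerA => ->.
Qed.

Lemma rat_map_eval f a : rat_eval (rat_map j f) a =
  ratmap (rat_deg f) (map_poly j (rat_num f)) (map_poly j (rat_den f)) a.
Proof.
by have [_ d0 fE] := rat_coprime f; apply: rat_map_eval_frac fE (rat_nondeg f).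
Qed.

Lemma rat_eval_map f a :
  rat_eval (rat_map j f) (omap j a) = omap j (rat_eval f a).
Proof. by rewrite rat_map_eval ratmap_map rat_evalE. Qed.

Lemma rat_X_eval a : rat_eval (rat_map j (rat_X F)) a = a.
Proof.
have nd : nondeg 1 (map_poly j 'X) (map_poly j 1).
  rewrite map_polyX rmorph1; split; rewrite ?size_polyX ?size_poly1 // => -[x|] /=.
    by rewrite hornerC => -[_ /eqP]; rewrite oner_eq0.
  by rewrite coefX => -[/eqP]; rewrite oner_eq0.
rewrite (@rat_map_eval_frac _ 'X 1 1 a) ?oner_neq0 //; last first.
  by rewrite /rat_X rmorph1 divr1.
rewrite map_polyX rmorph1 /ratmap /pt; case: a => [x|] /=.
  by rewrite hornerC hornerX oner_eq0 divr1.
by rewrite coef1 eqxx.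
Qed.

(** Evaluating numerator and denominator of [f] at [g] gives homogeneous compositions over the same
    power of the denominator of [g], which cancels. The positive degree of [g] keeps the composed
    denominator nonzero. *)
Lemma rat_comp_eval f g a : (0 < rat_deg g)%N ->
  rat_eval (rat_map j (rat_comp f g)) a =
  rat_eval (rat_map j f) (rat_eval (rat_map j g) a).
Proof.
move=> m0; set n := rat_deg f; set m := rat_deg g in m0 *.
set r := rat_num g; set s := rat_den g.
have [_ s0 gE] := rat_coprime g.
have [sn sd _] := rat_nondeg f; rewrite !size_map_poly -/n in sn sd.
pose h (p : {poly F}) := hcomp n p r s.
have evE (p : {poly F}) : (size p <= n.+1)%N ->
    (map_poly (fun c => FracField.tofrac c%:P) p).[g] = (h p)%:F / (s ^+ n)%:F.
  move=> sp; pose t : {rmorphism F -> {fraction {poly F}}} :=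
    @FracField.tofrac {poly F} \o @polyC F.
  rewrite -[map_poly _ p]/(map_poly t p) (@horner_coef_wide _ n.+1) ?size_map_poly //.
  rewrite /h /hcomp rmorph_sum mulr_suml; apply: eq_bigr => l _.
  have s0' : s%:F != 0 by rewrite tofrac_eq0.
  have E1 : s%:F ^+ n = s%:F ^+ (n - l) * s%:F ^+ l by rewrite -exprD subnK // -ltnS.
  rewrite coef_map /t /= -mul_polyC gE !rmorphM !rmorphXn /= -/r -/s E1 expr_div_n.
  by apply: frac_shift; rewrite expf_neq0.
have nd : nondeg (n * m) (map_poly j (h (rat_num f))) (map_poly j (h (rat_den f))).
  by rewrite !map_hcomp; apply: nondeg_hcomp; exact: rat_nondeg.
have Q0 : h (rat_den f) != 0.
  rewrite -(map_poly_eq0 j); case: (posnP n) => [n0|n0].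
    rewrite /h n0 /hcomp big_ord1 !expr0 mulr1 alg_polyC map_polyC polyC_eq0 fmorph_eq0.
    have [_ d0 _] := rat_coprime f; apply: contraNneq d0 => c0.
    by move: sd; rewrite n0 => /size1_polyC->; rewrite c0.
  by apply: nondeg_neq0 nd; rewrite muln_gt0 n0.
rewrite (@rat_map_eval_frac _ (h (rat_num f)) (h (rat_den f)) (n * m) a) //; last first.
  have sn0 : (s ^+ n)%:F != 0 by rewrite tofrac_eq0 expf_neq0.
  have Q0' : (h (rat_den f))%:F != 0 by rewrite tofrac_eq0.
  exact: etrans (f_equal2 (fun x y => x / y) (evE _ sn) (evE _ sd))
    (frac_cancel _ sn0 Q0').
rewrite !map_hcomp ratmap_hcomp; [|exact: rat_nondeg|exact: rat_nondeg].
by rewrite !rat_map_eval.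
Qed.

End RatMapEval.

(** * Moebius transformations *)

Section Moebius.
Variable F : fieldType.
Implicit Types (a b c d u v : F) (x y : option F).

Definition mob a b c d : option F -> option F :=
  ratmap 1 (a *: 'X + b%:P) (c *: 'X + d%:P).

Lemma ev_linear a b x : ev 1 (a *: 'X + b%:P) x = if x is Some z then a * z + b else a.
Proof.
case: x => [z|] /=; first by rewrite !hornerE.
by rewrite coefD coefZ coefX coefC /= mulr1 addr0.
Qed.

Lemma size_linear a b : (size (a *: 'X + b%:P)%R <= 2)%N.
Proof.
rewrite (leq_trans (size_polyD _ _)) // geq_max (leq_trans (size_scale_leq _ _)) ?size_polyX //.
by rewrite (leq_trans (size_polyC_leq1 _)).
Qed.

Lemma optP x : exists u v, ~ (u = 0 /\ v = 0) /\ x = pt u v.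
Proof.
case: x => [z|].
  exists z, 1; rewrite /pt oner_eq0 divr1; split=> // -[_ /eqP].
  by rewrite oner_eq0.
by exists 1, 0; rewrite /pt eqxx; split=> // -[/eqP]; rewrite oner_eq0.
Qed.

Lemma mob_pt a b c d u v : ~ (u = 0 /\ v = 0) ->
  mob a b c d (pt u v) = pt (a * u + b * v) (c * u + d * v).
Proof.
move=> nz; rewrite /mob /ratmap !ev_linear.
have -> : pt u v = if v == 0 then None else Some (u / v) by [].
case: (eqVneq v 0) => [v0|v0] /=.
  have u0 : u != 0 by apply/eqP => u0; apply: nz.
  by rewrite v0 !mulr0 !addr0 mulrC [c * u]mulrC pt_scale.
by rewrite -(pt_scale _ _ v0); congr pt; field.
Qed.

Lemma mob_vec a b c d u v : a * d - b * c != 0 -> ~ (u = 0 /\ v = 0) ->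
  ~ (a * u + b * v = 0 /\ c * u + d * v = 0).
Proof.
move=> D nz [e1 e2]; apply: nz; split; apply: (mulfI D); rewrite mulr0.
  have -> : (a * d - b * c) * u = d * (a * u + b * v) - b * (c * u + d * v) by ring.
  by rewrite e1 e2 !mulr0 subrr.
have -> : (a * d - b * c) * v = a * (c * u + d * v) - c * (a * u + b * v) by ring.
by rewrite e1 e2 !mulr0 subrr.
Qed.

Lemma mob_comp a b c d a' b' c' d' x : a' * d' - b' * c' != 0 ->
  mob a b c d (mob a' b' c' d' x) =
  mob (a * a' + b * c') (a * b' + b * d') (c * a' + d * c') (c * b' + d * d') x.
Proof.
move=> D; have [u [v [nz ->]]] := optP x.
rewrite !mob_pt //; last exact: mob_vec.
by congr pt; ring.
Qed.

Lemma mob_id a x : a != 0 -> mob a 0 0 a x = x.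
Proof.
move=> a0; have [u [v [nz ->]]] := optP x.
by rewrite mob_pt // !mul0r addr0 add0r pt_scale.
Qed.

Lemma mobK a b c d x : a * d - b * c != 0 ->
  mob d (- b) (- c) a (mob a b c d x) = x.
Proof.
move=> D; rewrite mob_comp // -[RHS](mob_id _ D).
by congr mob; ring.
Qed.

Lemma mobVK a b c d x : a * d - b * c != 0 ->
  mob a b c d (mob d (- b) (- c) a x) = x.
Proof.
move=> D; have D' : d * a - - b * - c != 0 by rewrite mulrNN mulrC.
by have := mobK x D'; rewrite !opprK.
Qed.

Lemma mob_nondeg a b c d : a * d - b * c != 0 ->
  nondeg 1 (a *: 'X + b%:P) (c *: 'X + d%:P).
Proof.
move=> D; split; rewrite ?size_linear // => x; rewrite !ev_linear.
case: x => [z|].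
  have := @mob_vec a b c d z 1 D; rewrite !mulr1; apply => -[_ /eqP].
  by rewrite oner_eq0.
have := @mob_vec a b c d 1 0 D; rewrite !mulr1 !mulr0 !addr0; apply => -[/eqP].
by rewrite oner_eq0.
Qed.

Lemma nondeg1_det (p q : {poly F}) : q != 0 -> nondeg 1 p q ->
  [/\ p = p`_1 *: 'X + (p`_0)%:P, q = q`_1 *: 'X + (q`_0)%:P &
      p`_1 * q`_0 - p`_0 * q`_1 != 0].
Proof.
move=> q0 [sp sq nz].
have E (r : {poly F}) : (size r <= 2)%N -> r = r`_1 *: 'X + (r`_0)%:P.
  move=> sr; apply/polyP => -[|[|l]]; rewrite coefD coefZ coefX coefC /=.
  - by rewrite mulr0 add0r.
  - by rewrite mulr1 addr0.
  - by rewrite mulr0 addr0 nth_default // (leq_trans sr).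
have pE := E p sp; have qE := E q sq; split=> //; apply/eqP => D.
have q0' : q`_1 *: 'X + (q`_0)%:P != 0 by rewrite -qE.
have nz' y : ~ (ev 1 (p`_1 *: 'X + (p`_0)%:P) y = 0 /\ ev 1 (q`_1 *: 'X + (q`_0)%:P) y = 0).
  by rewrite -pE -qE.
move: D nz' q0'; move: p`_1 p`_0 q`_1 q`_0 => a b c d D nz' q0'.
case: (eqVneq c 0) => [c0|c0].
  have d0 : d != 0 by apply: contraNneq q0' => d0; rewrite c0 d0 scale0r addr0.
  apply: (nz' None); rewrite !ev_linear; split=> //.
  by move/eqP: D; rewrite c0 mulr0 subr0 mulf_eq0 (negPf d0) orbF => /eqP.
apply: (nz' (Some (- d / c))); rewrite !ev_linear; split; last by field.
have -> : a * (- d / c) + b = - (a * d - b * c) / c by field.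
by rewrite D oppr0 mul0r.
Qed.

End Moebius.

(** The form [h] has a multiple zero at [a], hence fewer distinct zeros than its degree. This
    converts [rat_mult] into a count of points, which a conjugation preserves. *)
Lemma critical_fibre (E : closedFieldType) (f : {fraction {poly E}}) a s :
  (0 < rat_deg f)%N -> (1 < rat_mult f a)%N -> uniq s ->
  (forall x, x \in s -> rat_eval f x = rat_eval f a) -> (size s < rat_deg f)%N.
Proof.
move=> d0; rewrite /rat_mult; set h := (if rat_eval f a is Some b then _ else _) => ma us Hs.
have nd : nondeg (rat_deg f) (rat_num f) (rat_den f).
  have := rat_nondeg (idfun : {rmorphism E -> E}) f.
  by rewrite !map_poly_id.
have [sn sd nz] := nd.
have h0 : h != 0.
  rewrite /h; case: (rat_eval f a) => [b|]; last exact: nondeg_neq0 nd.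
  apply: (@nondeg_neq0 _ _ (rat_den f) _ d0); split=> //.
    rewrite (leq_trans (size_polyD _ _)) // size_polyN geq_max sn.
    by rewrite (leq_trans (size_scale_leq _ _)).
  move=> x; case: x => [x|] /= [e1 e2]; [apply: (nz (Some x))|apply: (nz None)]; split=> //=.
    by move: e2; rewrite hornerD hornerN hornerZ e1 mulr0 subr0.
  by move: e2; rewrite coefB coefZ e1 mulr0 subr0.
have sh : (size h <= (rat_deg f).+1)%N.
  rewrite /h; case: (rat_eval f a) => [b|] //.
  rewrite (leq_trans (size_polyD _ _)) // size_polyN geq_max sn.
  by rewrite (leq_trans (size_scale_leq _ _)).
have ev0 x : rat_eval f x = rat_eval f a -> ev (rat_deg f) h x = 0.
  move=> E1; rewrite /h -E1 rat_evalE /ratmap /pt.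
  case: (eqVneq (ev (rat_deg f) (rat_den f) x) 0) => // e0.
  case: x {E1} e0 => [x|] /= e0; rewrite ?hornerD ?hornerN ?hornerZ ?coefB ?coefZ.
    by rewrite divfK // subrr.
  by rewrite divfK // subrr.
pose s' := pmap id s.
have us' : uniq s' by apply: (pmap_uniq (g := Some)) us => -[].
have rs' : all (root h) s'.
  apply/allP => x; rewrite mem_pmap map_id => xs.
  by apply/eqP; exact: (ev0 (Some x) (Hs _ xs)).
have ss : size s = (size s' + (None \in s))%N.
  rewrite size_pmap -(count_predC isSome s) -(count_uniq_mem None us).
  by congr addn; apply: eq_count; case.
have sizeN : None \in s -> (size h <= rat_deg f)%N.
  move=> /Hs/ev0 /= hd; rewrite leqNgt; apply/negP => lt.
  have sE : size h = (rat_deg f).+1 by apply/eqP; rewrite eqn_leq sh lt.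
  have : lead_coef h = 0 by rewrite lead_coefE sE.
  by move/eqP; rewrite lead_coef_eq0 (negPf h0).
move: ma; case: (a) => [x|].
  rewrite mup_geq // => /dvdpP[g gE].
  pose h1 := g * ('X - x%:P).
  have hE : h = h1 * ('X - x%:P) by rewrite gE /h1 expr2 mulrA.
  have h10 : h1 != 0 by apply: contraNneq h0 => H; rewrite hE H mul0r.
  have sh1 : size h = (size h1).+1 by rewrite hE size_Mmonic ?monicXsubC // size_XsubC addn2.
  have rh1 : all (root h1) s'.
    apply/allP => y /(allP rs'); rewrite hE rootM => /orP[//|].
    by rewrite root_XsubC => /eqP->; rewrite /h1 rootM root_XsubC eqxx orbT.
  have := max_poly_roots h10 rh1 us'; rewrite -ltnS -sh1 => H.
  rewrite ss; case: (boolP (None \in s)) => [Ns|_].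
    by apply: (leq_trans _ (sizeN Ns)); rewrite addnC; exact: H.
  by rewrite addn0 -ltnS; apply: leq_trans H sh.
have := max_poly_roots h0 rs' us' => H ma; rewrite ss.
have sh0 : (0 < size h)%N by rewrite size_poly_gt0.
have H2 : (size s' <= (size h).-1)%N by rewrite -ltnS prednK.
have H3 : ((size h).-1 + 2 <= rat_deg f)%N.
  by move: ma; rewrite ltn_subRL addn1 addn2.
apply: leq_trans H3; rewrite addn2 !ltnS -addn1 leq_add //.
by case: (_ \in _).
Qed.

(** * The constant model *)

Lemma sr_hcomp (F : fieldType) (A : set F) n (p r s : {poly F}) : subring_closed [in A] ->
  (forall l, A p`_l) -> (forall l, A r`_l) -> (forall l, A s`_l) ->
  forall l, A (hcomp n p r s)`_l.
Proof.
move=> rA Ap Ar As; apply: (sr_poly_sum rA) => l _; apply: (sr_polyZ rA) => //.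
by apply: (sr_polyM rA); apply: (sr_polyXn rA).
Qed.

Lemma sr_linear (F : fieldType) (A : set F) a b : subring_closed [in A] ->
  A a -> A b -> forall l, A (a *: 'X + b%:P)`_l.
Proof.
move=> rA Aa Ab; apply: (sr_polyD rA); last exact: (sr_polyC rA).
by apply: (sr_polyZ rA) => //; exact: (sr_polyX rA).
Qed.

Lemma P1_mob (F : fieldType) (A : set F) a b c d x : subfield_set A ->
  A a -> A b -> A c -> A d -> P1_of A x -> P1_of A (mob a b c d x).
Proof.
move=> fA Aa Ab Ac Ad Px; have rA := sf_ring fA.
rewrite /mob /ratmap !ev_linear /pt; case: eqP => [_|_]; first by left.
right; eexists; last reflexivity; apply: (sf_div fA).
  by case: Px => [->//|[z Az <-]]; apply: (srD rA) => //; exact: (srM rA).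
by case: Px => [->//|[z Az <-]]; apply: (srD rA) => //; exact: (srM rA).
Qed.

(** * Conjugation to a map with constant coefficients *)

Section NormalForm.
Variables (k K : fieldType) (i : {rmorphism k -> K}).
Variables (Kbar : closedFieldType) (iota : {rmorphism K -> Kbar}).
Local Notation kb := (kbar i iota).
Let fkb := kbar_subfield i iota.
Let rkb := sf_ring fkb.

(** [rat_over] provides a fraction over the constants that need not be in lowest terms. Since [A]
    and [B] divide [P] and [Q], their roots are constants, and the ratio of their leading
    coefficients is that of [P] and [Q]. *)
Lemma kbar_proportional (A B P Q : {poly Kbar}) : coprimep A B -> B != 0 -> Q != 0 ->
  (forall l, kb P`_l) -> (forall l, kb Q`_l) -> A * Q = B * P ->
  exists c, [/\ c != 0, forall l, kb (c *: A)`_l & forall l, kb (c *: B)`_l].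
Proof.
move=> cAB B0 Q0 kP kQ E.
have BQ : B %| Q.
  by rewrite -(Gauss_dvdpr Q (q := A)) 1?coprimep_sym // E dvdp_mulr.
have /dvdpP[C QE] := BQ.
have PE : P = C * A.
  by apply: (mulfI B0); rewrite -E QE; ring.
have C0 : C != 0 by apply: contraNneq Q0 => H; rewrite QE H mul0r.
have monic_kb (R S : {poly Kbar}) : R != 0 -> S != 0 -> (forall l, kb S`_l) -> R %| S ->
    forall l, kb ((lead_coef R)^-1 *: R)`_l.
  move=> R0 S0 kS RS; have [rs RE] := closed_field_poly_normal R.
  have -> : (lead_coef R)^-1 *: R = \prod_(z <- rs) ('X - z%:P).
    by rewrite {2}RE scalerA mulVf ?lead_coef_eq0 // scale1r.
  apply: kbar_prodXsubC => z zrs; apply: (kbar_root S0 kS).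
  have /dvdpP[T ->] := RS; rewrite rootM RE rootZ ?lead_coef_eq0 //.
  by rewrite root_prod_XsubC zrs orbT.
exists (lead_coef B)^-1; split; first by rewrite invr_eq0 lead_coef_eq0.
  case: (eqVneq A 0) => [->|A0].
    by move=> l; rewrite scaler0 coef0; exact: (sr0 rkb).
  have P0 : P != 0 by rewrite PE mulf_neq0.
  have -> : (lead_coef B)^-1 *: A =
      (lead_coef P / lead_coef Q) *: ((lead_coef A)^-1 *: A).
    rewrite scalerA PE QE !lead_coefM; congr (_ *: _); field.
    by rewrite !lead_coef_eq0 A0 B0 C0.
  apply: (sr_polyZ rkb); first by apply: (sf_div fkb); rewrite lead_coefE.
  by apply: monic_kb P0 kP _ => //; rewrite PE dvdp_mull.
exact: monic_kb Q0 kQ BQ.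
Qed.

Variables (phi : {fraction {poly K}}) (beta : option K).
Hypothesis deg_phi : (1 < rat_deg phi)%N.
Variables (K' : fieldExtType K) (j : {rmorphism K' -> Kbar}).
Hypothesis jE : forall x, j (in_alg K' x) = iota x.
Variable k' : set K'.
Hypothesis k'E : k' = [set y : K' | algebraicOver (in_alg K' \o i) y].
Variables (sigma sigmaV : {fraction {poly K'}}).
Hypothesis deg_sigma : rat_deg sigma = 1%N.
Hypothesis sigmaK : rat_comp sigma sigmaV = rat_X K'.
Hypothesis sigmaVK : rat_comp sigmaV sigma = rat_X K'.
Hypothesis isotriv : rat_over k'
  (rat_comp (rat_comp sigma (rat_map (in_alg K') phi)) sigmaV).

Local Notation Phi := (rat_eval (rat_map iota phi)).
Local Notation S := (rat_eval (rat_map j sigma)).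
Local Notation psi := (rat_comp (rat_comp sigma (rat_map (in_alg K') phi)) sigmaV).

Lemma kbar_k' y : k' y <-> kb (j y).
Proof.
have mE (p : {poly k}) : map_poly (iota \o i) p = map_poly j (map_poly (in_alg K' \o i) p).
  rewrite -map_poly_comp; apply: eq_map_poly => x /=; exact/esym/jE.
rewrite k'E; split=> -[p p0 py]; exists p => //.
  by rewrite mE fmorph_root.
by move: py; rewrite mE fmorph_root.
Qed.

Lemma Phi_eval y : rat_eval (rat_map j (rat_map (in_alg K') phi)) y = Phi y.
Proof.
have [_ d0 _] := rat_coprime phi.
have mE (p : {poly K}) : map_poly j (map_poly (in_alg K') p) = map_poly iota p.
  by rewrite -map_poly_comp; apply: eq_map_poly => x /=; exact: jE.
rewrite (@rat_map_eval_frac _ _ j _ (map_poly (in_alg K') (rat_num phi))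
   (map_poly (in_alg K') (rat_den phi)) (rat_deg phi)) ?map_poly_eq0 //.
  by rewrite !mE rat_map_eval.
by rewrite !mE; exact: rat_nondeg.
Qed.

Lemma in_alg_deg : rat_deg (rat_map (in_alg K') phi) = rat_deg phi.
Proof.
have [_ d0 _] := rat_coprime phi.
have mE (p : {poly K}) : map_poly j (map_poly (in_alg K') p) = map_poly iota p.
  by rewrite -map_poly_comp; apply: eq_map_poly => x /=; exact: jE.
apply: (@rat_deg_nondeg _ _ j _ (map_poly (in_alg K') (rat_num phi))
   (map_poly (in_alg K') (rat_den phi))); rewrite ?map_poly_eq0 //.
by rewrite !mE; exact: rat_nondeg.
Qed.

(** Were [sigmaV] constant, the composite with [sigma] would be constant and not [rat_X]. *)
Lemma sigmaV_deg : (0 < rat_deg sigmaV)%N.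
Proof.
rewrite lt0n; apply/negP => /eqP d0.
have [sn sd _] := rat_nondeg j sigmaV; rewrite !size_map_poly d0 in sn sd.
have [_ q0 sE] := rat_coprime sigmaV.
move: (size1_polyC sn) (size1_polyC sd) => nE dE.
set c := (rat_num sigmaV)`_0 in nE; set e := (rat_den sigmaV)`_0 in dE.
have e0 : e != 0 by apply: contraNneq q0 => e0; rewrite dE e0.
pose t : {rmorphism K' -> {fraction {poly K'}}} :=
  @FracField.tofrac {poly K'} \o @polyC K'.
have sc : sigmaV = t (c / e).
  rewrite sE nE dE /t /=; have -> : (c / e)%:P = c%:P * (e^-1)%:P :> {poly K'} by rewrite polyCM.
  apply: (mulIf (x := FracField.tofrac e%:P)); first by rewrite tofrac_eq0 polyC_eq0.
  rewrite (divfK (x := FracField.tofrac e%:P)); last by rewrite tofrac_eq0 polyC_eq0.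
  by rewrite -rmorphM -mulrA -polyCM mulVf // mulr1.
have ev_t (p : {poly K'}) : (map_poly (fun c => FracField.tofrac c%:P) p).[sigmaV] = t p.[c / e].
  by rewrite sc -[map_poly _ p]/(map_poly t p) horner_map.
have : t ((rat_num sigma).[c / e] / (rat_den sigma).[c / e]) = rat_X K'.
  by rewrite -sigmaK fmorph_div -!ev_t.
rewrite /t /rat_X /= => /eqP; rewrite tofrac_eq => /eqP /(congr1 (fun p : {poly K'} => size p)).
by rewrite size_polyX => /eqP; rewrite ltn_eqF // ltnS size_polyC_leq1.
Qed.

Lemma psi_semiconj y : rat_eval (rat_map j psi) (S y) = S (Phi y).
Proof.
rewrite rat_comp_eval ?sigmaV_deg // -[X in rat_eval _ X]rat_comp_eval ?deg_sigma //.
rewrite sigmaVK rat_X_eval rat_comp_eval ?in_alg_deg ?Phi_eval //.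
exact: ltnW.
Qed.

Definition extended_constants : set Kbar := field_gen (range j `|` kb).
Let fE : subfield_set extended_constants := field_gen_subfield _.
Let rE := sf_ring fE.

Lemma constant_model : exists n (A B : {poly Kbar}),
  [/\ nondeg n A B, forall l, kb A`_l, forall l, kb B`_l &
      forall y, ratmap n A B (S y) = S (Phi y)].
Proof.
have [c0 d0 E] := rat_coprime psi.
have [P [Q [kP kQ Q0 E']]] := isotriv.
have nd := rat_nondeg j psi.
have X : rat_num psi * Q = rat_den psi * P.
  apply/eqP; rewrite -tofrac_eq !rmorphM /=; apply/eqP.
  have Q0' : FracField.tofrac Q != 0 by rewrite tofrac_eq0.
  have d0' : FracField.tofrac (rat_den psi) != 0 by rewrite tofrac_eq0.
  have pE : psi * FracField.tofrac Q = FracField.tofrac P by rewrite E' (divfK Q0').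
  have nE : psi * FracField.tofrac (rat_den psi) = FracField.tofrac (rat_num psi).
    by rewrite {1}E (divfK d0').
  by rewrite -pE -nE -mulrA [RHS]mulrCA.
have [||||||c [c0' kA kB]] := @kbar_proportional (map_poly j (rat_num psi))
  (map_poly j (rat_den psi)) (map_poly j P) (map_poly j Q).
- exact: nondeg_coprime nd.
- by rewrite map_poly_eq0.
- by rewrite map_poly_eq0.
- by move=> l; rewrite coef_map; apply/kbar_k'; exact: kP.
- by move=> l; rewrite coef_map; apply/kbar_k'; exact: kQ.
- by rewrite -!rmorphM X.
exists (rat_deg psi), (c *: map_poly j (rat_num psi)), (c *: map_poly j (rat_den psi)).
split=> //; first exact: nondeg_scale.
by move=> y; rewrite ratmap_scale // -rat_map_eval psi_semiconj.
Qed.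

Lemma sigma_mob : exists a b c d, [/\ a * d - b * c != 0,
  [/\ extended_constants a, extended_constants b, extended_constants c &
      extended_constants d] & forall y, S y = mob a b c d y].
Proof.
have nd := rat_nondeg j sigma; rewrite deg_sigma in nd.
have [_ d0 _] := rat_coprime sigma.
have d0' : map_poly j (rat_den sigma) != 0 by rewrite map_poly_eq0.
have [nE dE D] := nondeg1_det d0' nd.
have Ej x : extended_constants (j x) by apply: field_gen_sub; left; exists x.
do 4!eexists; split; first exact: D.
  by rewrite !coef_map; split; exact: Ej.
by move=> y; rewrite rat_map_eval deg_sigma {1}nE {1}dE.
Qed.

(* Moving a fixed point to infinity makes the numerator of the constant model of
   larger degree than its denominator. *)
Lemma fixed_point n (A B : {poly Kbar}) : nondeg n A B ->
  (forall l, kb A`_l) -> (forall l, kb B`_l) ->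
  exists a b c d, [/\ a * d - b * c != 0, [/\ kb a, kb b, kb c & kb d] &
    mob a b c d (ratmap n A B (mob d (- b) (- c) a None)) = None].
Proof.
move=> nd kA kB; have [sA sB nz] := nd.
have k0 : kb 0 := sr0 rkb; have k1 : kb 1 := sr1 rkb.
case: (eqVneq (ratmap n A B None) None) => [E|E].
  exists 1, 0, 0, 1; split; [by rewrite mulr0 subr0 mulr1 oner_neq0|by []|].
  by rewrite oppr0 (mob_id None (oner_neq0 _)) E mob_id ?oner_neq0.
have Bn : B`_n != 0.
  by apply: contraNneq E => Bn; rewrite /ratmap /pt /= Bn eqxx.
have sBn : size B = n.+1.
  apply/eqP; rewrite eqn_leq sB ltnNge; apply: contra Bn => H.
  by rewrite nth_default.
have B0 : B != 0 by rewrite -size_poly_gt0 sBn.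
pose R := B * 'X - A.
have sR : size R = n.+2.
  by rewrite /R size_polyDl ?size_mulX ?sBn // size_polyN ltnS.
have R0 : R != 0 by rewrite -size_poly_gt0 sR.
have kR l : kb R`_l.
  move: l; apply: (sr_polyB rkb) => //; apply: (sr_polyM rkb) => //.
  exact: (sr_polyX rkb).
have /closed_rootP[z Rz] : size R != 1%N by rewrite sR.
have kz := kbar_root R0 kR Rz.
move: Rz; rewrite rootE /R !hornerE subr_eq0 => /eqP Rz.
have Bz : B.[z] != 0.
  by apply/eqP => Bz; apply: (nz (Some z)); rewrite /= -Rz Bz mul0r.
have Pz : ratmap n A B (Some z) = Some z.
  by rewrite /ratmap /pt /= (negPf Bz) -Rz mulrC mulKf.
exists 0, 1, 1, (- z); split.
- by rewrite mul0r sub0r mulr1 oppr_eq0 oner_neq0.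
- by split=> //; exact: (srN rkb).
have -> : mob (- z) (- 1) (- 1) 0 None = Some z.
  by rewrite /mob /ratmap !ev_linear /pt oppr_eq0 oner_eq0 divrNN divr1.
by rewrite Pz /mob /ratmap !ev_linear /pt mul1r subrr eqxx.
Qed.

(** The conjugation is [sigma] followed by a constant Moebius map that sends a fixed point of the
    constant model to infinity; being constant, that map does not affect whether the image of [beta]
    is constant. With infinity fixed, the numerator has full degree and can be made monic. *)
Theorem normal_form : exists a b c d (N D : {poly Kbar}),
  [/\ a * d - b * c != 0 /\ [/\ extended_constants a, extended_constants b,
        extended_constants c & extended_constants d],
      [/\ forall l, kb N`_l, forall l, kb D`_l, N \is monic,
           size N = (rat_deg phi).+1 & (size D <= rat_deg phi)%N],
      nondeg (rat_deg phi) N D,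
      forall y, ratmap (rat_deg phi) N D (mob a b c d y) = mob a b c d (Phi y) &
      P1_of k' (rat_eval sigma (omap (in_alg K') beta)) <->
      P1_of kb (mob a b c d (omap iota beta))].
Proof.
have [n [A [B [nd kA kB sc]]]] := constant_model.
have [s11 [s12 [s21 [s22 [Ds [E1 E2 E3 E4] SE]]]]] := sigma_mob.
have [v11 [v12 [v21 [v22 [Dv [k1 k2 k3 k4] fix_]]]]] := fixed_point nd kA kB.
have Ek : kb `<=` extended_constants by move=> z kz; apply: field_gen_sub; right.
have Dv' : v22 * v11 - - v12 * - v21 != 0 by rewrite mulrNN mulrC.
pose a := v11 * s11 + v12 * s21; pose b := v11 * s12 + v12 * s22.
pose c := v21 * s11 + v22 * s21; pose d := v21 * s12 + v22 * s22.
have DM : a * d - b * c != 0.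
  have -> : a * d - b * c = (v11 * v22 - v12 * v21) * (s11 * s22 - s12 * s21).
    by rewrite /a /b /c /d; ring.
  by rewrite mulf_neq0.
have DM' : d * a - - b * - c != 0 by rewrite mulrNN mulrC.
have ME y : mob a b c d y = mob v11 v12 v21 v22 (S y) by rewrite SE mob_comp.
pose N0 := hcomp 1 (v11 *: 'X + v12%:P) (hcomp n A (v22 *: 'X + (- v12)%:P) ((- v21) *: 'X + v11%:P))
  (hcomp n B (v22 *: 'X + (- v12)%:P) ((- v21) *: 'X + v11%:P)).
pose D0 := hcomp 1 (v21 *: 'X + v22%:P) (hcomp n A (v22 *: 'X + (- v12)%:P) ((- v21) *: 'X + v11%:P))
  (hcomp n B (v22 *: 'X + (- v12)%:P) ((- v21) *: 'X + v11%:P)).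
have nd1 := nondeg_hcomp nd (mob_nondeg Dv').
have nd0 : nondeg (1 * (n * 1)) N0 D0 := nondeg_hcomp (mob_nondeg Dv) nd1.
have rat0 y : ratmap (1 * (n * 1)) N0 D0 y =
    mob v11 v12 v21 v22 (ratmap n A B (mob v22 (- v12) (- v21) v11 y)).
  by rewrite /N0 /D0 (ratmap_hcomp _ (mob_nondeg Dv) nd1) (ratmap_hcomp _ nd (mob_nondeg Dv')).
have kN0 l : kb N0`_l.
  have kv12 := srN rkb k2; have kv21 := srN rkb k3.
  by move: l; apply: (sr_hcomp _ rkb); [exact: sr_linear|apply: (sr_hcomp _ rkb) => //; exact: sr_linear|apply: (sr_hcomp _ rkb) => //; exact: sr_linear].
have kD0 l : kb D0`_l.
  have kv12 := srN rkb k2; have kv21 := srN rkb k3.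
  by move: l; apply: (sr_hcomp _ rkb); [exact: sr_linear|apply: (sr_hcomp _ rkb) => //; exact: sr_linear|apply: (sr_hcomp _ rkb) => //; exact: sr_linear].
have nphi := rat_nondeg iota phi.
have nd2 := nondeg_hcomp nphi (mob_nondeg DM').
have nd3 := nondeg_hcomp (mob_nondeg DM) nd2.
(* The degree of the constant model is not computed: its conjugate and that of [phi] agree at every
   point, and a map determines the degree of its forms. *)
have deg0 : (1 * (n * 1) = rat_deg phi)%N.
  apply/esym; rewrite -[LHS]muln1 -[LHS]mul1n.
  have dphi : (0 < 1 * (rat_deg phi * 1))%N by rewrite mul1n muln1 ltnW.
  have [|//] := ratmap_inj nd3 nd0 (nondeg_neq0 dphi nd3).
  move=> y; rewrite (ratmap_hcomp _ (mob_nondeg DM) nd2) (ratmap_hcomp _ nphi (mob_nondeg DM')).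
  rewrite -rat_map_eval rat0 -[ratmap 1 (a *: _ + _) _ _]/(mob a b c d _).
  rewrite -[ratmap 1 (d *: _ + _) _ _]/(mob d (- b) (- c) a _).
  rewrite ME -sc; congr (mob _ _ _ _ (ratmap _ _ _ _)).
  by rewrite -[in RHS](mobVK y DM) ME mobK.
rewrite deg0 in nd0 rat0.
have N0D : N0`_(rat_deg phi) != 0 /\ D0`_(rat_deg phi) = 0.
  have := rat0 None; rewrite fix_ /ratmap /pt /=; case: eqP => // D00 _.
  by split=> //; apply/eqP => N00; case: nd0 => _ _ /(_ None); apply.
have [N0d D0d] := N0D; have [sN0 sD0 _] := nd0.
have eV0 : (N0`_(rat_deg phi))^-1 != 0 by rewrite invr_eq0.
have sN : size N0 = (rat_deg phi).+1.
  apply/eqP; rewrite eqn_leq sN0 ltnNge; apply: contra N0d => H.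
  by rewrite nth_default.
have ke : kb (N0`_(rat_deg phi))^-1 by apply: (sfV fkb).
exists a, b, c, d, ((N0`_(rat_deg phi))^-1 *: N0), ((N0`_(rat_deg phi))^-1 *: D0).
split.
- split=> //; split; apply: (srD rE); apply: (srM rE) => //; exact: Ek.
- split.
  + exact: (sr_polyZ rkb).
  + exact: (sr_polyZ rkb).
  + by rewrite monicE lead_coefZ lead_coefE sN /= mulVf.
  + by rewrite size_scale.
  + rewrite size_scale // leqNgt; apply/negP => lt.
    have sE : size D0 = (rat_deg phi).+1 by apply/eqP; rewrite eqn_leq sD0 lt.
    have : lead_coef D0 = 0 by rewrite lead_coefE sE.
    move/eqP; rewrite lead_coef_eq0 => /eqP D00.
    by move: lt; rewrite D00 size_poly0.
- exact: nondeg_scale.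
- by move=> y; rewrite ratmap_scale // rat0 ME mobK // sc -ME.
have jb : S (omap iota beta) = omap j (rat_eval sigma (omap (in_alg K') beta)).
  rewrite -rat_eval_map; congr (rat_eval _ _); case: beta => [x|] //=.
  by rewrite -jE.
rewrite ME jb; set sb := rat_eval sigma _.
have kn2 := srN rkb k2; have kn3 := srN rkb k3.
split=> [P|P].
  apply: P1_mob => //; case: P => [->|[x kx <-]]; first by left.
  by right; exists (j x) => //; exact/kbar_k'.
have : P1_of kb (omap j sb) by rewrite -(mobK (omap j sb) Dv); apply: P1_mob.
case=> [|[x kx]]; case: sb {jb P} => [z|] //=; first by left.
by move=> [xz]; right; exists z => //; apply/kbar_k'; rewrite -xz.
Qed.

End NormalForm.

(** * Preimages and reduction at a place *)

Section Dynamics.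
Variables (k K : fieldType) (i : {rmorphism k -> K}).
Variables (Kbar : closedFieldType) (iota : {rmorphism K -> Kbar}).
Hypothesis char0 : [pchar Kbar] =i pred0.
Local Notation kb := (kbar i iota).
Let fkb := kbar_subfield i iota.
Let rkb := sf_ring fkb.

Variables (d : nat) (N D : {poly Kbar}).
Hypothesis d1 : (1 < d)%N.
Hypotheses (kN : forall l, kb N`_l) (kD : forall l, kb D`_l).
Hypothesis mN : N \is monic.
Hypotheses (sN : size N = d.+1) (sD : (size D <= d)%N).
Hypothesis nd : nondeg d N D.
Local Notation Psi := (ratmap d N D).

Lemma D_neq0 : D != 0.
Proof. by apply: nondeg_neq0 nd; exact: ltnW. Qed.

Lemma Psi_inf : Psi None = None.
Proof. by rewrite /ratmap /pt /= [D`_d]nth_default // eqxx. Qed.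

Lemma iter_Psi_inf n : iter n Psi None = None.
Proof. by elim: n => //= n ->; exact: Psi_inf. Qed.

(** Because infinity is fixed, this is monic of degree [d] for every finite [y]: all preimages of
    [y] are finite, and integral wherever [y] is. *)
Definition fib (y : Kbar) : {poly Kbar} := N - y *: D.

Lemma fib_size y : size (fib y) = d.+1.
Proof.
rewrite /fib size_polyDl ?sN // size_polyN ltnS.
exact: leq_trans (size_scale_leq _ _) sD.
Qed.

Lemma fib_monic y : fib y \is monic.
Proof.
rewrite monicE lead_coefE fib_size /= /fib coefB coefZ [D`_d]nth_default // mulr0 subr0.
by have /monicP := mN; rewrite lead_coefE sN => /= ->.
Qed.

Lemma Psi_Some x y : Psi (Some x) = Some y <-> root (fib y) x.
Proof.
rewrite /ratmap /pt /= rootE /fib hornerD hornerN hornerZ subr_eq0.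
case: eqVneq => [Dx|Dx]; split=> //.
- rewrite Dx mulr0 => /eqP Nx; case: nd => _ _ /(_ (Some x)) []; split=> //.
- by move=> [<-]; rewrite divfK.
- by move=> /eqP ->; rewrite mulfK.
Qed.

Lemma Psi_ex x : D.[x] != 0 -> Psi (Some x) = Some (N.[x] / D.[x]).
Proof. by rewrite /ratmap /pt /= => /negPf ->. Qed.

Lemma kb_fib y l : kb y -> kb (fib y)`_l.
Proof. by move=> ky; move: l; apply: (sr_polyB rkb) => //; exact: (sr_polyZ rkb). Qed.

Lemma fib_neq0 y : fib y != 0.
Proof. exact: monic_neq0 (fib_monic y). Qed.

Lemma Psi_constant x : P1_of kb (Psi x) -> P1_of kb x.
Proof.
case: x => [x|]; last by left.
rewrite /ratmap /pt /=; case: eqVneq => [Dx|Dx].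
  by move=> _; right; exists x => //; apply: (kbar_root D_neq0 kD); apply/eqP.
case=> [//|[y ky [yE]]]; right; exists x => //.
apply: (kbar_root (fib_neq0 y)) => [l|]; first exact: kb_fib.
by apply/Psi_Some; rewrite Psi_ex // yE.
Qed.

Lemma Psi_kbar x : P1_of kb x -> P1_of kb (Psi x).
Proof.
case=> [->|[z kz <-]]; first by rewrite Psi_inf; left.
rewrite /ratmap /pt /=; case: eqP => _; first by left.
by right; eexists; last reflexivity; apply: (sf_div fkb); exact: (sr_horner rkb).
Qed.

Lemma iter_Psi_kbar n x : P1_of kb x -> P1_of kb (iter n Psi x).
Proof. by move=> Px; elim: n => //= n; exact: Psi_kbar. Qed.

Lemma iter_Psi_constant n x : P1_of kb (iter n Psi x) -> P1_of kb x.
Proof. by elim: n => //= n IH /Psi_constant. Qed.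

Definition crit_value (b : Kbar) := exists x, root (fib b) x /\ root (fib b)^`() x.

(** The double roots are zeros of the Wronskian [W]. It is nonzero, since [N] is prime to [D] and
    does not divide its own nonzero derivative, and it has constant coefficients. *)
Lemma crit_values_finite : exists cvs : seq Kbar,
  forall b, crit_value b -> b \in cvs /\ kb b.
Proof.
pose W := N^`() * D - N * D^`().
have N'0 : N^`() != 0.
  apply/eqP => /polyP/(_ d.-1)/eqP; rewrite coef0 coef_deriv prednK ?(ltnW d1) //.
  have /monicP := mN; rewrite lead_coefE sN => /= ->.
  by have /pcharf0P -> := char0; case: d d1.
have W0 : W != 0.
  rewrite subr_eq0; apply/eqP => E.
  have : N %| N^`().
    by rewrite -(Gauss_dvdpl N^`() (q := D)) ?(nondeg_coprime nd) // E dvdp_mulr.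
  move/(dvdp_leq N'0); rewrite leqNgt lt_size_deriv //.
  exact: monic_neq0.
have kW l : kb W`_l.
  by move: l; apply: (sr_polyB rkb); apply: (sr_polyM rkb) => //; exact: (sr_deriv rkb).
have [rs [WE krs _]] := kbar_split W0 kW.
exists [seq N.[x] / D.[x] | x <- rs] => b [x [r r']].
have /Psi_Some := r; rewrite /ratmap /pt /=; case: eqVneq => // Dx [bE].
have rW : root W x.
  move: r r'; rewrite !rootE /fib derivB derivZ !hornerE !subr_eq0 => /eqP e1 /eqP e2.
  by rewrite e1 e2; apply/eqP; ring.
have xrs : x \in rs by move: rW; rewrite WE rootZ ?lead_coef_eq0 // root_prod_XsubC.
split; first by rewrite -bE; apply/mapP; exists x.
by rewrite -bE; apply: (sf_div fkb); apply: (sr_horner rkb) => //; exact: krs.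
Qed.

Lemma full_fibre y : ~ crit_value y -> exists s : seq Kbar,
  [/\ uniq s, size s = d & forall x, x \in s <-> Psi (Some x) = Some y].
Proof.
move=> ny; have [rs E] := closed_field_poly_normal (fib y).
have {}E : fib y = \prod_(z <- rs) ('X - z%:P).
  by rewrite E (monicP (fib_monic y)) scale1r.
exists rs; split.
- apply/negPn/negP => nu; apply: ny.
  have [x [s1 rsE]] : exists x s1, perm_eq rs [:: x, x & s1].
    elim: (rs) nu => //= z s IH; rewrite negb_and negbK => /orP[zs|/IH[x [s1 H]]].
      by exists z, (rem z s); rewrite perm_cons perm_to_rem.
    exists x, (z :: s1).
    apply: (perm_trans (y := z :: [:: x, x & s1])); first by rewrite perm_cons.
    exact: permEl (perm_catCA [:: z] [:: x; x] s1).
  exists x; rewrite E (perm_big _ rsE) /= !big_cons.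
  move: (\prod_(z <- s1) _) => q; rewrite !rootE !derivE !hornerE !subrr.
  by rewrite /= !mul0r addr0 eqxx.
- by have := fib_size y; rewrite E size_prod_XsubC; case.
- move=> x; split=> [xrs|/Psi_Some]; last by rewrite E root_prod_XsubC.
  by apply/Psi_Some; rewrite E root_prod_XsubC.
Qed.

(** Iterated preimages of a transcendental [t] are transcendental while critical values are
    constants, so every fibre on the way has [d] points. *)
Lemma preimage_list t m : ~ kb t -> exists s : seq Kbar,
  [/\ uniq s, size s = (d ^ m)%N & forall x, x \in s <-> iter m Psi (Some x) = Some t].
Proof.
move=> nt; elim: m => [|m [s [us ss Hs]]].
  exists [:: t]; split=> // x; rewrite inE /=; split=> [/eqP->//|[->]]; exact: eqxx.
have [cvs Hcvs] := crit_values_finite.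
have ncrit x : x \in s -> ~ crit_value x.
  move=> /Hs xt /Hcvs[_ kx]; have : P1_of kb (Some x) by right; exists x.
  by move/(@iter_Psi_kbar m); rewrite xt => -[//|[z kz [zt]]]; apply: nt; rewrite -zt.
have /choice[fb Hfb] y : exists l : seq Kbar, y \in s ->
    [/\ uniq l, size l = d & forall x, x \in l <-> Psi (Some x) = Some y].
  case: (boolP (y \in s)) => [ys|_]; last by exists [::].
  by have [l Hl] := full_fibre (ncrit y ys); exists l.
exists [seq x | y <- s, x <- fb y]; split.
- apply: allpairs_uniq_dep => // [y /Hfb[]//|].
  move=> [y x] [y' x'] /allpairsPdep[u [v [us' vu [-> ->]]]] /allpairsPdep[u' [v' [us'' vu' [-> ->]]]] /= vv.
  subst v'; have [_ _ H] := Hfb u us'; have [_ _ H'] := Hfb u' us''.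
  have := (H v).1 vu; rewrite ((H' v).1 vu') => -[->] //.
- rewrite size_allpairs_dep expnS -ss -sumn_nseq; congr sumn.
  rewrite -[X in nseq X](size_map (fun y => size (fb y)) s); apply/all_pred1P.
  by rewrite all_map; apply/allP => y /Hfb[_ /= -> _].
move=> x; rewrite iterSr; split.
  move=> /allpairsPdep[y [z [ys zy ->]]]; have [_ _ H] := Hfb y ys.
  by rewrite ((H z).1 zy); exact/Hs.
case E : (Psi (Some x)) => [y|]; last by rewrite iter_Psi_inf.
move=> /Hs ys; apply/allpairsPdep; exists y, x; split=> //.
by have [_ _ H] := Hfb y ys; apply/H.
Qed.

(** * Reduction of iterated preimages at a place *)

Section AtPlace.
Variable Q : set Kbar.
Hypothesis pQ : place i iota Q.
Hypothesis ffK : function_field_over i.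
Hypothesis algKbar : forall z : Kbar, algebraicOver iota z.
Let vQ : valuation_ring setT Q. Proof. by case: pQ. Qed.
Let rQ := vr_ring vQ.
Let fT := setT_subfield Kbar.
Let kQ : kb `<=` Q := place_kbar pQ.
Local Notation mx := (maxid Q).

Lemma Q_residue x xi : kb xi -> mx (x - xi) -> Q x.
Proof.
move=> kx m; rewrite -(subrK xi x); apply: (srD rQ); first exact: (maxidW vQ).
exact: kQ.
Qed.

Lemma Q_fib y : Q y -> forall l, Q (fib y)`_l.
Proof.
move=> Qy l; apply: (sr_polyB rQ) => [{}l|{}l]; first exact: kQ.
by move: l; apply: (sr_polyZ rQ) => // l; exact: kQ.
Qed.

Lemma Q_preimage x y : Psi (Some x) = Some y -> Q y -> Q x.
Proof.
move=> /Psi_Some r Qy; apply: (vr_integral fT vQ _ r) => //; first exact: Q_fib.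
by rewrite (monicP (fib_monic y)); exact: (unit1 vQ).
Qed.

Lemma kb_congr (p : {poly Kbar}) x xi : (forall l, kb p`_l) -> kb xi ->
  mx (x - xi) -> mx (p.[x] - p.[xi]).
Proof.
move=> kp kx m; have Qx := Q_residue kx m.
have [s Qs ->] := poly_congr vQ (fun l => kQ (kp l)) (kQ kx) Qx.
by rewrite addrAC subrr add0r; exact: (maxidMr vQ).
Qed.

Lemma kb_maxid0 c : kb c -> mx c -> c = 0.
Proof. exact: kbar_maxid. Qed.

Lemma fib_congr y eta x xi : kb eta -> mx (y - eta) -> kb xi -> mx (x - xi) ->
  mx ((fib y).[x] - (fib eta).[xi]) /\ mx ((fib y)^`().[x] - (fib eta)^`().[xi]).
Proof.
move=> ke me kx mxi; have Qx := Q_residue kx mxi.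
have key (p q : {poly Kbar}) : (forall l, kb p`_l) -> (forall l, kb q`_l) ->
    mx ((p - y *: q).[x] - (p - eta *: q).[xi]).
  move=> kp kq; rewrite !hornerE.
  have -> : p.[x] - y * q.[x] - (p.[xi] - eta * q.[xi]) =
    (p.[x] - p.[xi]) + - ((y - eta) * q.[x] + eta * (q.[x] - q.[xi])) by ring.
  apply: (maxidD fT vQ) => //; first exact: kb_congr.
  apply: (maxidN vQ); apply: (maxidD fT vQ) => //.
    by apply: (maxidMr vQ) => //; apply: (sr_horner rQ) => // l; exact: kQ.
  by apply: (maxidMl vQ); [exact: kQ|exact: kb_congr].
split; first exact: key.
by rewrite /fib !derivB !derivZ; apply: key; exact: (sr_deriv rkb).
Qed.

Lemma Psi_residue x y xi eta : Psi (Some x) = Some y -> kb eta -> mx (y - eta) ->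
  kb xi -> mx (x - xi) -> Psi (Some xi) = Some eta.
Proof.
move=> /Psi_Some r ke me kx mxi; apply/Psi_Some; apply/eqP.
have [m _] := fib_congr ke me kx mxi; move: m; rewrite (rootP r) sub0r => /(maxidN vQ).
rewrite opprK; apply: kb_maxid0; apply: (sr_horner rkb) => // l; exact: kb_fib.
Qed.

Lemma Q_iter t g n z : kb g -> mx (t - g) -> iter n Psi (Some z) = Some t -> Q z.
Proof.
move=> kg mg; elim: n z => [|n IHn] z; first by move=> [->]; exact: Q_residue kg mg.
rewrite iterSr; case Ez : (Psi (Some z)) => [w|]; last by rewrite iter_Psi_inf.
by move/IHn; exact: Q_preimage.
Qed.

(** Consider the step at which the two orbits first merge: one fibre polynomial then has two
    distinct roots of equal residue, so its reduction has a double root, and the residue of the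
    common image is the critical value sought. *)
Lemma distinct_residues t g m x x' xi : kb g -> mx (t - g) ->
  iter m Psi (Some x) = Some t -> iter m Psi (Some x') = Some t ->
  x != x' -> kb xi -> mx (x - xi) -> mx (x' - xi) ->
  exists l eta, [/\ (l < m)%N, crit_value eta & iter l Psi (Some eta) = Some g].
Proof.
move=> kg mg; elim: m x x' xi => [|m IH] x x' xi.
  by move=> [->] [->]; rewrite eqxx.
rewrite !iterSr; case E : (Psi (Some x)) => [y|]; last by rewrite iter_Psi_inf.
case E' : (Psi (Some x')) => [y'|]; last by rewrite iter_Psi_inf.
move=> it it' xx kx m1 m2.
have Qiter n z := @Q_iter t g n z kg mg.
have [eta [ke me]] := residue pQ ffK algKbar (Qiter _ _ it).
have [eta' [ke' me']] := residue pQ ffK algKbar (Qiter _ _ it').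
have P1 := Psi_residue E ke me kx m1; have P2 := Psi_residue E' ke' me' kx m2.
have ee : eta' = eta by move: P1; rewrite P2 => -[].
subst eta'.
case: (eqVneq y y') => [yy|yy]; last first.
  have [l [e [lm ce ie]]] := IH y y' eta it it' yy ke me me'.
  by exists l, e; split=> //; exact: ltnW.
subst y'; exists m, eta; split=> //; last first.
  have it_res n z w : iter n Psi (Some z) = Some t -> kb w -> mx (z - w) ->
      iter n Psi (Some w) = Some g.
    elim: n z w => [|n IHn] z w.
      move=> [->] kw mw; congr Some; apply/eqP; rewrite -subr_eq0; apply/eqP/kb_maxid0.
        exact: (srB rkb).
      have -> : w - g = (t - g) - (t - w) by ring.
      exact: (maxidB fT vQ).
    rewrite !iterSr; case Ez : (Psi (Some z)) => [v|]; last by rewrite iter_Psi_inf.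
    move=> iv kw mw; have [u [ku mu]] := residue pQ ffK algKbar (Qiter _ _ iv).
    by rewrite (Psi_residue Ez ku mu kw mw); exact: IHn iv ku mu.
  exact: it_res it ke me.
exists xi; split; first by apply/Psi_Some.
have [_ md] := fib_congr ke me kx m1.
have mh : mx (x' - x).
  by have -> : x' - x = (x' - xi) - (x - xi) by [ring]; exact: (maxidB fT vQ).
have Qx := Q_residue kx m1; have Qy := Qiter _ _ it.
(* Both ends of the expansion are roots, so the derivative at [x] is a multiple of [x' - x] and
   vanishes modulo the maximal ideal. *)
have [r Qr] := sr_taylor rQ (Q_fib Qy) Qx (maxidW vQ I mh).
have -> : x + (x' - x) = x' by ring.
move/Psi_Some: E => E; move/Psi_Some: E' => E'.
rewrite (rootP E) (rootP E') add0r => T.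
have h0 : x' - x != 0 by rewrite subr_eq0 eq_sym.
have dE : (fib y)^`().[x] = - ((x' - x) * r).
  apply: (mulfI h0); apply/eqP; rewrite -subr_eq0; apply/eqP; rewrite [RHS]T; ring.
apply/eqP/kb_maxid0.
  by apply: (sr_horner rkb) => //; apply: (sr_deriv rkb) => l; exact: kb_fib.
have -> : (fib eta)^`().[xi] = - ((x' - x) * r) -
    ((fib y)^`().[x] - (fib eta)^`().[xi]) by rewrite dE; ring.
apply: (maxidB fT vQ) => //; apply: (maxidN vQ); exact: (maxidMr vQ).
Qed.

(** [fib y] is small at [xi], and as it is a product over its roots, one root [x] reduces to [xi].
    At [x], [fib eta] equals (y - eta) D(x); it is also (x - xi)^e times a unit, where [e] is the
    multiplicity of [xi], and D(x) is a unit. *)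
Lemma fib_step y eta xi : Psi (Some xi) = Some eta -> kb eta -> kb xi ->
  mx (y - eta) -> y != eta ->
  exists x e, [/\ Psi (Some x) = Some y, mx (x - xi), x != xi,
    unit_of Q ((x - xi) ^+ e / (y - eta)) &
    (0 < e)%N /\ (root (fib eta)^`() xi -> (1 < e)%N)].
Proof.
move=> P ke kx me ye.
have [e [q qxi fE]] := multiplicity_XsubC (fib eta) xi.
have {}qxi : ~~ root q xi by rewrite fib_neq0 in qxi.
have Dxi : D.[xi] != 0.
  by apply/eqP => D0; move: P; rewrite /ratmap /pt /= D0 eqxx.
have fyE z : (fib y).[z] = (fib eta).[z] - (y - eta) * D.[z].
  by rewrite /fib !hornerE; ring.
have [rs E] := closed_field_poly_normal (fib y).
have {}E : fib y = \prod_(z <- rs) ('X - z%:P).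
  by rewrite E (monicP (fib_monic y)) scale1r.
have r0 : root (fib eta) xi by apply/Psi_Some.
have Qy := Q_residue ke me.
have Qrs z : z \in rs -> Q z.
  move=> zrs; apply: (@Q_preimage z y) => //; apply/Psi_Some.
  by rewrite E root_prod_XsubC.
have [x xrs mxx] : exists2 x, x \in rs & mx (x - xi).
  have : mx (fib y).[xi].
    rewrite fyE (rootP r0) sub0r; apply: (maxidN vQ); apply: (maxidMr vQ) => //.
    by apply: (sr_horner rQ); [move=> l; exact: kQ|exact: kQ].
  rewrite E horner_prod; elim: (rs) Qrs => [_|z s IH Qs].
    by rewrite big_nil => /maxid_nunit; case; exact: (unit1 vQ).
  rewrite big_cons => /(maxid_prime vQ)[||m|m].
  - rewrite hornerXsubC; apply: (srB rQ); first exact: kQ.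
    by apply: Qs; rewrite mem_head.
  - rewrite -horner_prod; apply: (sr_horner rQ); last exact: kQ.
    rewrite big_seq; apply: (sr_poly_prod rQ) => w ws l; apply: (sr_polyB rQ) => {}l.
      exact: (sr_polyX rQ).
    by apply: (sr_polyC rQ); apply: Qs; rewrite inE ws orbT.
  - exists z; first exact: mem_head.
    by move: m; rewrite hornerXsubC -opprB => /(maxidN vQ); rewrite opprK.
  - have [|x xs mxx] := IH _ m; first by move=> w ws; apply: Qs; rewrite inE ws orbT.
    by exists x => //; rewrite inE xs orbT.
have Px : Psi (Some x) = Some y by apply/Psi_Some; rewrite E root_prod_XsubC.
have rx : root (fib y) x by apply/Psi_Some.
have unit_at (p : {poly Kbar}) : (forall l, kb p`_l) -> p.[xi] != 0 -> unit_of Q p.[x].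
  move=> kp pxi; rewrite -(subrK p.[xi] p.[x]) addrC; apply: (unit_maxidD fT vQ) => //.
    by apply: (place_kbar_unit pQ) => //; exact: (sr_horner rkb).
  exact: kb_congr.
have kq l : kb q`_l.
  have qE : q = fib eta %/ ('X - xi%:P) ^+ e.
    by rewrite fE mulpK // expf_neq0 // polyXsubC_eq0.
  have [rs' E'] := closed_field_poly_normal q.
  have mq : lead_coef q = 1.
    have /monicP := fib_monic eta; rewrite fE lead_coef_Mmonic //.
    by rewrite monic_exp // monicXsubC.
  rewrite E' mq scale1r; apply: kbar_prodXsubC => z zrs.
  apply: (kbar_root (fib_neq0 eta)) => [{}l|]; first exact: kb_fib.
  by rewrite fE rootM E' mq scale1r root_prod_XsubC zrs.
have uq : unit_of Q q.[x] by apply: unit_at.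
have uD : unit_of Q D.[x] by apply: unit_at.
have EQ : (x - xi) ^+ e * q.[x] = (y - eta) * D.[x].
  have := fyE x; rewrite (rootP rx) fE hornerM horner_exp hornerXsubC => /esym/eqP.
  by rewrite subr_eq0 mulrC => /eqP.
have ye0 : y - eta != 0 by rewrite subr_eq0.
have [q0 _ _] := uq; have [D0 _ _] := uD.
have xxi : x != xi.
  apply/eqP => xx; have := fyE x; rewrite (rootP rx) xx (rootP r0) sub0r => /eqP.
  by rewrite eq_sym oppr_eq0 mulf_eq0 (negPf ye0) (negPf Dxi).
exists x, e; split=> //.
  have -> : (x - xi) ^+ e / (y - eta) = D.[x] / q.[x].
    by apply/eqP; rewrite eqr_div // EQ mulrC.
  exact: (unit_div vQ).
split=> [|rd].
  rewrite lt0n; apply/eqP => e0; move: r0; rewrite fE e0 expr0 mulr1.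
  by rewrite (negPf qxi).
case: e fE {EQ} => [|[|e]] // fE; move: r0 rd; rewrite fE.
  by rewrite expr0 mulr1 (negPf qxi).
move=> _; rewrite expr1 rootE derivM derivXsubC mulr1 hornerD hornerM hornerXsubC.
by rewrite subrr mulr0 add0r -rootE (negPf qxi).
Qed.

(** The orbit from [b] to [g] is lifted backwards to one ending at [t]; the exponents of the
    successive steps multiply. *)
Lemma ramified_preimage t g l b : kb g -> mx (t - g) -> t != g -> kb b ->
  iter l Psi (Some b) = Some g ->
  exists y E, [/\ iter l Psi (Some y) = Some t, mx (y - b), y != b, (0 < E)%N &
    unit_of Q ((y - b) ^+ E / (t - g))].
Proof.
move=> kg mg tg; elim: l b => [|l IH] b kb_b.
  move=> [->]; exists t, 1%N; split=> //; rewrite expr1 divff ?subr_eq0 //.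
  exact: (unit1 vQ).
rewrite iterSr; case Eb : (Psi (Some b)) => [b1|]; last by rewrite iter_Psi_inf.
move=> ib; have kb1 : kb b1.
  have : P1_of kb (Some b1) by rewrite -Eb; apply: Psi_kbar; right; exists b.
  by case=> // -[z kz [<-]].
have [y1 [E [iy my yb E0 uE]]] := IH b1 kb1 ib.
have [x [e [Px mxx xb ue [e0 _]]]] := fib_step Eb kb1 kb_b my yb.
exists x, (e * E)%N; split=> //; rewrite ?iterSr ?Px ?muln_gt0 ?e0 //.
have yb0 : y1 - b1 != 0 by rewrite subr_eq0.
have -> : (x - b) ^+ (e * E) / (t - g) =
    ((x - b) ^+ e / (y1 - b1)) ^+ E * ((y1 - b1) ^+ E / (t - g)).
  rewrite expr_div_n exprM mulrA divfK // expf_neq0 //.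
by apply: (unitM vQ) => //; exact: (unitX vQ).
Qed.

Lemma ramified_critical t g l b : kb g -> mx (t - g) -> t != g -> crit_value b -> kb b ->
  iter l Psi (Some b) = Some g ->
  exists x c E, [/\ iter l.+1 Psi (Some x) = Some t, kb c, x != c, (1 < E)%N &
    unit_of Q ((x - c) ^+ E / (t - g))].
Proof.
move=> kg mg tg [c [rc rdc]] kb_b ib.
have kc : kb c by apply: (kbar_root (fib_neq0 b)) rc => l'; exact: kb_fib.
have Pc : Psi (Some c) = Some b by apply/Psi_Some.
have [y [E [iy my yb E0 uE]]] := ramified_preimage kg mg tg kb_b ib.
have [x [e [Px mxx xc ue [e0 e1]]]] := fib_step Pc kb_b kc my yb.
exists x, c, (e * E)%N; split=> //.
- by rewrite iterSr Px.
- by apply: leq_trans (e1 rdc) _; rewrite leq_pmulr.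
have yb0 : y - b != 0 by rewrite subr_eq0.
have -> : (x - c) ^+ (e * E) / (t - g) =
    ((x - c) ^+ e / (y - b)) ^+ E * ((y - b) ^+ E / (t - g)).
  by rewrite expr_div_n exprM mulrA divfK // expf_neq0.
by apply: (unitM vQ) => //; exact: (unitX vQ).
Qed.

End AtPlace.

End Dynamics.

(** * Orbits of critical values *)

Section Orbits.
Variables (T : eqType) (f : T -> T).
Implicit Types b c : T.

Definition wandering b := injective (fun n => iter n f b).
(** For wandering points with merging orbits the delay n - m is well defined; requiring it to be
    positive gives a strict order. *)
Definition precedes b c := exists n m, (m < n)%N /\ iter n f b = iter m f c.

Lemma precedes_trans b c e : precedes b c -> precedes c e -> precedes b e.
Proof.
move=> [n [m [mn E]]] [n' [m' [mn' E']]]; exists (n' + n)%N, (m' + m)%N.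
split; first by rewrite -addSn leq_add // ltnW.
by rewrite iterD E -iterD addnC iterD E' -iterD addnC.
Qed.

Lemma precedes_irrefl b : wandering b -> ~ precedes b b.
Proof. by move=> wb [n [m [mn /wb E]]]; rewrite E ltnn in mn. Qed.

Lemma precedes_wandering b c : wandering b -> precedes b c -> wandering c.
Proof.
move=> wb [n [m [_ E]]] p q /= Epq.
have /wb : iter (p + n) f b = iter (q + n) f b.
  rewrite !iterD E -!iterD addnC [(q + m)%N]addnC !iterD Epq //.
by move/addIn.
Qed.

(** On wandering points [precedes] is a strict order, and whatever a wandering point precedes is
    wandering too; so climbing through the finite list [C] must stop. *)
Lemma ex_maximal_wandering (C : seq T) b : wandering b -> exists b0,
  [/\ b0 = b \/ b0 \in C, wandering b0 & forall c, c \in C -> ~ precedes b0 c].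
Proof.
suff H : forall b, wandering b -> exists b0,
    [/\ b0 = b \/ (b0 \in C /\ precedes b b0), wandering b0 &
        forall c, c \in C -> ~ precedes b0 c].
  by move=> /H[b0 [B w p]]; exists b0; split=> //; case: B => [|[]]; [left|right].
elim: C {b} => [|c C IH] b wb; first by exists b; split=> //; left.
have [b0 [B w p]] := IH b wb.
case: (pselect (precedes b0 c)) => [b0c|nb0c]; last first.
  exists b0; split=> //.
    by case: B => [->|[bC bb]]; [left|right; rewrite inE bC orbT].
  by move=> e; rewrite inE => /orP[/eqP->|/p].
have wc := precedes_wandering w b0c.
have bc : precedes b c by case: B b0c => [->//|[_ bb0]]; exact: precedes_trans.
have [b1 [B1 w1 p1]] := IH c wc; exists b1; split=> //.
  case: B1 => [->|[b1C cb1]]; right; first by rewrite mem_head.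
  by rewrite inE b1C orbT; split=> //; exact: precedes_trans cb1.
move=> e; rewrite inE => /orP[/eqP->|/p1 //] b1c.
apply: (precedes_irrefl wc); case: B1 => [E|[_ cb1]]; first by rewrite -{1}E.
exact: precedes_trans cb1 b1c.
Qed.

Lemma not_wandering_finite b : ~ wandering b -> finite_set [set iter n f b | n in setT].
Proof.
move=> nw; have [p [q [pq E]]] : exists p q, (p < q)%N /\ iter p f b = iter q f b.
  apply: contrapT => nex; apply: nw => p q /= E.
  by case: (ltngtP p q) => // H; case: nex; [exists p, q|exists q, p].
apply: (@sub_finite_set _ _ ((fun n => iter n f b) @` `I_q)); last first.
  exact/finite_image/finite_II.
move=> _ [n _ <-]; elim/ltn_ind: n => n IH.
case: (ltnP n q) => [nq|qn]; first by exists n.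
have -> : iter n f b = iter (n - q + p) f b.
  by rewrite -{1}(subnK qn) iterD -E -iterD.
apply: IH; rewrite -{2}(subnK qn) ltn_add2l //.
Qed.

End Orbits.

Lemma eventually_notin (T : eqType) (u : nat -> T) (bad : seq T) : injective u ->
  exists N, forall n, (N <= n)%N -> u n \notin bad.
Proof.
move=> iu; elim: bad => [|x bad [N HN]]; first by exists 0%N.
case: (pselect (exists n, u n = x)) => [[n un]|nex].
  exists (maxn N n.+1) => m; rewrite geq_max inE negb_or => /andP[Nm nm].
  by rewrite HN // andbT -un (inj_eq iu) gtn_eqF.
exists N => n Nn; rewrite inE negb_or HN // andbT; apply/eqP => un.
by apply: nex; exists n.
Qed.

Lemma ex_common_nat (T : eqType) (P : T -> nat -> Prop) (s : seq T) :
  (forall x n m, x \in s -> ~ P x n -> ~ P x m -> n = m) ->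
  exists n, forall x, x \in s -> P x n.
Proof.
move=> H; suff [N HN] : exists N, forall n, (N <= n)%N -> forall x, x \in s -> P x n.
  by exists N; exact: HN.
elim: s H => [|x s IH] H; first by exists 0%N.
have [|N HN] := IH; first by move=> y n m ys; apply: H; rewrite inE ys orbT.
case: (pselect (exists n, ~ P x n)) => [[n Pn]|nex].
  exists (maxn N n.+1) => m; rewrite geq_max => /andP[Nm nm] y.
  rewrite inE => /orP[/eqP->|]; last exact: HN.
  apply: contrapT => Pm; have := H x n m (mem_head _ _) Pn Pm => E.
  by rewrite E ltnn in nm.
exists N => n Nn y; rewrite inE => /orP[/eqP->|]; last exact: HN.
by apply: contrapT => Pn; apply: nex; exists n.
Qed.

(** * Ramification in the preimage fields *)

Section Transfer.
Variables (k K : fieldType) (i : {rmorphism k -> K}).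
Variables (Kbar : closedFieldType) (iota : {rmorphism K -> Kbar}).
Hypothesis ffK : function_field_over i.
Hypothesis algKbar : forall z : Kbar, algebraicOver iota z.
Hypothesis char0 : [pchar Kbar] =i pred0.
Local Notation place := (place i iota).
Let fT := setT_subfield Kbar.

(* The inverse of [g'] modulo [g] has coefficients in K by Bezout and in [Q]
   by Lagrange interpolation at the roots; hence [g] is also separable modulo
   any other place above the same prime. *)
Lemma separable_transfer Q Q1 (G : {poly K}) (zs : seq Kbar) : place Q -> place Q1 ->
  iota @^-1` Q1 = iota @^-1` Q -> uniq zs -> size G = (size zs).+1 ->
  (forall z, z \in zs -> root (map_poly iota G) z /\ Q z) ->
  (forall z z', z \in zs -> z' \in zs -> z != z' -> unit_of Q (z - z')) ->
  forall z, z \in zs -> etale_closure i iota Q1 (range iota) z.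
Proof.
move=> pQ pQ1 EQ uz sG Hz Hzz; have [vQ _ _] := pQ; have [vQ1 _ _] := pQ1.
have rQ := vr_ring vQ; have rQ1 := vr_ring vQ1.
have G0 : G != 0 by rewrite -size_poly_gt0 sG.
pose g := (lead_coef G)^-1 *: G.
have gm : g \is monic by rewrite monicE lead_coefZ mulVf ?lead_coef_eq0.
have sg : size g = (size zs).+1 by rewrite size_scale // invr_eq0 lead_coef_eq0.
have gE : map_poly iota g = \prod_(z <- zs) ('X - z%:P).
  rewrite (all_roots_prod_XsubC (p := map_poly iota g) (rs := zs)).
  - by rewrite lead_coef_map (monicP gm) rmorph1 scale1r.
  - by rewrite size_map_poly.
  - apply/allP => z /Hz[rz _]; rewrite map_polyZ rootZ //.
    by rewrite fmorph_eq0 invr_eq0 lead_coef_eq0.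
  - by rewrite uniq_rootsE.
have cop : coprimep g g^`().
  rewrite -(coprimep_map iota) -[X in coprimep _ X]deriv_map.
  by have := separable_prod_XsubC zs; rewrite uz -gE unlock.
have [[u v] /= uv] := Bezout_eq1_coprimepP _ _ cop.
have zroot z : z \in zs -> (map_poly iota g).[z] = 0.
  by move=> zzs; apply/eqP; rewrite -rootE gE root_prod_XsubC.
have inv z : z \in zs -> (map_poly iota (v %% g)).[z] * (map_poly iota g)^`().[z] = 1.
  move=> zzs; have := congr1 (fun p => (map_poly iota p).[z]) uv.
  rewrite rmorphD !rmorphM rmorph1 /= hornerD !hornerM hornerC zroot // mulr0 add0r.
  rewrite -deriv_map {1}(divp_eq v g) rmorphD rmorphM /= hornerD hornerM zroot //.
  by rewrite mulr0 add0r.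
pose h z := \prod_(z' <- zs | z' != z) ('X - z'%:P).
have hE z : z \in zs -> map_poly iota g = ('X - z%:P) * h z.
  by move=> zzs; rewrite gE (bigD1_seq z).
have hz z : z \in zs -> (map_poly iota g)^`().[z] = (h z).[z].
  move=> zzs; rewrite (hE z) // derivM derivXsubC mul1r hornerD hornerM hornerXsubC.
  by rewrite subrr mul0r addr0.
have uh z : z \in zs -> unit_of Q (h z).[z].
  move=> zzs; rewrite /h horner_prod big_seq_cond; apply: (unit_prod vQ) => z' /andP[z's z'z].
  by rewrite hornerXsubC; apply: Hzz => //; rewrite eq_sym.
have hzw z w : w \in zs -> z != w -> (h z).[w] = 0.
  move=> ws zw; apply/eqP; rewrite -rootE /h -big_filter root_prod_XsubC mem_filter ws.
  by rewrite eq_sym zw.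
have sh z : z \in zs -> size (h z) = size zs.
  move=> zzs; have : size (map_poly iota g) = (size zs).+1 by rewrite size_map_poly.
  rewrite (hE z zzs) mulrC size_Mmonic ?monicXsubC //.
    by rewrite size_XsubC addn2 => -[].
  by rewrite /h -big_filter monic_neq0 // monic_prod_XsubC.
(* One inverse factor is the prescribed value at [z], the inverse of the derivative of [g]; the
   other normalizes the Lagrange polynomial [h z]. *)
pose Lp := \sum_(z <- zs) ((h z).[z]^-1 ^+ 2) *: h z.
have LpE w : w \in zs -> Lp.[w] = (h w).[w]^-1.
  move=> ws; rewrite /Lp horner_sum (bigD1_seq w) //= hornerZ big_seq_cond big1 ?addr0.
    by case: (uh w ws) => h0 _ _; rewrite expr2 -mulrA mulVf // mulr1.
  by move=> z /andP[zzs zw]; rewrite hornerZ (hzw z w) // mulr0.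
have vL : map_poly iota (v %% g) = Lp.
  apply/eqP; rewrite -subr_eq0; apply/eqP.
  apply: (roots_geq_poly_eq0 (rs := zs)) => //.
    apply/allP => z zzs; rewrite rootE hornerD hornerN LpE // subr_eq0; apply/eqP.
    have := inv z zzs; rewrite hz // => H.
    case: (uh z zzs) => h0 _ _; apply: (mulIf h0); rewrite H mulVf //.
  rewrite (leq_trans (size_polyD _ _)) // geq_max size_polyN; apply/andP; split.
    by rewrite size_map_poly -ltnS -sg ltn_modp monic_neq0.
  apply: (leq_trans (size_sum _ _ _)); apply/bigmax_leqP_seq => z zzs _.
  by rewrite (leq_trans (size_scale_leq _ _)) // sh.
have QL l : Q Lp`_l.
  rewrite /Lp big_seq; move: l; apply: (sr_poly_sum rQ) => z zzs.
  apply: (sr_polyZ rQ); first by apply: (srX rQ); case: (uh z zzs).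
  rewrite /h big_seq_cond; apply: (sr_poly_prod rQ) => z' /andP[z's _].
  by apply: (sr_polyB rQ); [exact: (sr_polyX rQ)|apply: (sr_polyC rQ); case: (Hz z')].
have QP x : Q (iota x) -> Q1 (iota x).
  by move=> Qx; have : (iota @^-1` Q1) x by rewrite EQ.
have Q1v l : Q1 (map_poly iota (v %% g))`_l.
  by rewrite coef_map; apply: QP; rewrite -coef_map vL.
have Q1g l : Q1 (map_poly iota g)`_l.
  rewrite coef_map; apply: QP; rewrite -coef_map gE big_seq; move: l.
  apply: (sr_poly_prod rQ) => z zzs.
  by apply: (sr_polyB rQ); [exact: (sr_polyX rQ)|apply: (sr_polyC rQ); case: (Hz z)].
move=> z zzs.
have rz : root (map_poly iota g) z by apply/eqP/zroot.
have Q1z : Q1 z.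
  apply: (vr_integral fT vQ1 _ rz) => //; rewrite lead_coef_map (monicP gm) rmorph1.
  exact: (unit1 vQ1).
apply: (etale_closure_etale ffK algKbar pQ1 _ Q1g rz Q1z).
  move=> l; rewrite coef_map; apply: (etale_closure_sub pQ1); by eexists.
have E1 := inv z zzs.
have Qa : Q1 (map_poly iota (v %% g)).[z] by exact: (sr_horner rQ1).
have Qb : Q1 (map_poly iota g)^`().[z].
  by apply: (sr_horner rQ1) => //; exact: (sr_deriv rQ1).
have b0 : (map_poly iota g)^`().[z] != 0.
  by apply/eqP => b0; move/eqP: E1; rewrite b0 mulr0 eq_sym oner_eq0.
split=> //; have -> : ((map_poly iota g)^`().[z])^-1 = (map_poly iota (v %% g)).[z].
  by apply: (mulIf b0); rewrite mulVf.
by [].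
Qed.

End Transfer.

(** * Preimage fields when the preimages have distinct residues *)

Section PreimageFields.
Variables (k K : fieldType) (i : {rmorphism k -> K}).
Variables (Kbar : closedFieldType) (iota : {rmorphism K -> Kbar}).
Hypothesis ffK : function_field_over i.
Hypothesis algKbar : forall z : Kbar, algebraicOver iota z.
Hypothesis char0 : [pchar Kbar] =i pred0.
Local Notation place := (place i iota).
Local Notation kb := (kbar i iota).
Let fT := setT_subfield Kbar.
Variables (phi : {fraction {poly K}}) (beta : option K).
Local Notation deg := (rat_deg phi).
Local Notation Phi := (rat_eval (rat_map iota phi)).
Local Notation K_ := (preimage_field iota phi beta).

Lemma iterate_pair m : exists p q : {poly K},
  nondeg (deg ^ m) (map_poly iota p) (map_poly iota q) /\
  forall x, ratmap (deg ^ m) (map_poly iota p) (map_poly iota q) x = iter m Phi x.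
Proof.
elim: m => [|m [p [q [nd H]]]].
  exists 'X, 1; rewrite map_polyX rmorph1 expn0; split.
    split; rewrite ?size_polyX ?size_poly1 // => -[x|] /=.
      by rewrite hornerC => -[_ /eqP]; rewrite oner_eq0.
    by rewrite coefX => -[/eqP]; rewrite oner_eq0.
  move=> [x|]; rewrite /ratmap /pt /=; last by rewrite coef1 eqxx.
  by rewrite hornerC hornerX oner_eq0 divr1.
have nd' := rat_nondeg iota phi.
exists (hcomp deg (rat_num phi) p q), (hcomp deg (rat_den phi) p q).
rewrite !map_hcomp expnS; split; first exact: nondeg_hcomp.
by move=> x; rewrite ratmap_hcomp // H -rat_map_eval.
Qed.

(** The preimages of [beta] are Moebius images of [xs] and may be infinite or have poles at Q. The
    coordinate 1 / (z - w), for a suitable natural number [w], is finite, integral and injective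
    modulo Q on all of them. As it is defined over K, its values are the roots of a polynomial over
    K, to which the transfer from Q to Q1 applies. *)
Lemma preimage_etale Q Q1 a b c d m (xs : seq Kbar) : place Q -> place Q1 ->
  iota @^-1` Q1 = iota @^-1` Q ->
  [/\ Q a, Q b, Q c & Q d] -> unit_of Q (a * d - b * c) ->
  uniq xs -> size xs = (deg ^ m)%N -> (forall x, x \in xs -> Q x) ->
  (forall x x', x \in xs -> x' \in xs -> x != x' -> unit_of Q (x - x')) ->
  (forall z, iter m Phi z = omap iota beta <->
     exists2 x, x \in xs & z = mob d (- b) (- c) a (Some x)) ->
  K_ m `<=` etale_closure i iota Q1 (range iota).
Proof.
move=> pQ pQ1 EQ [Qa Qb Qc Qd] uD uxs sxs Qxs Hxs fibre.
have [vQ _ _] := pQ; have rQ := vr_ring vQ.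
have D0 : a * d - b * c != 0 by case: uD.
pose u x := d * x - b; pose v x := a - c * x.
have Qu x : x \in xs -> Q (u x).
  by move=> xin; apply: (srB rQ) => //; apply: (srM rQ) => //; exact: Qxs.
have Qv x : x \in xs -> Q (v x).
  by move=> xin; apply: (srB rQ) => //; apply: (srM rQ) => //; exact: Qxs.
have mobE x : mob d (- b) (- c) a (Some x) = pt (u x) (v x).
  have -> : Some x = pt x 1 by rewrite /pt oner_eq0 divr1.
  rewrite mob_pt; last by move=> [_ /eqP]; rewrite oner_eq0.
  by congr pt; rewrite /u /v; ring.
have uvD x : c * u x + d * v x = a * d - b * c by rewrite /u /v; ring.
(* Two bad numbers for the same [x] would put both [u x] and [v x] in the maximal ideal, against
   [uvD]. So each [x] excludes at most one number. *)
have [w Hw] : exists w : nat, forall x, x \in xs -> unit_of Q (u x - w%:R * v x).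
  apply: (@ex_common_nat _ (fun x (w : nat) => unit_of Q (u x - w%:R * v x)) xs).
  move=> x n m' xin nu nu'; apply: contrapT => nm.
  have mmx (w : nat) : ~ unit_of Q (u x - w%:R * v x) -> maxid Q (u x - w%:R * v x).
    move=> H; have Qz : Q (u x - w%:R * v x).
      by apply: (srB rQ); [exact: Qu|apply: (srM rQ); [exact: (sr_nat rQ)|exact: Qv]].
    by case: (maxidP Qz).
  have m1 := mmx _ nu; have m2 := mmx _ nu'.
  have unm : unit_of Q (m'%:R - n%:R : Kbar).
    apply: (place_kbar_unit pQ).
      have rkb := sf_ring (kbar_subfield i iota).
      by apply: (srB rkb); exact: (sr_nat rkb).
    rewrite subr_eq0; apply/eqP => E; apply: nm; move/pcharf0P: char0 => ch.
    wlog lt : n m' {nu nu' m1 m2} E / (n <= m')%N.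
      by move=> W; case: (leqP n m') => [|/ltnW] H; [exact: W|apply/esym; exact: W].
    apply/eqP; rewrite eqn_leq lt /= -subn_eq0 -ch natrB //.
    by rewrite E subrr.
  have mv : maxid Q (v x).
    have -> : v x = ((u x - n%:R * v x) - (u x - m'%:R * v x)) * (m'%:R - n%:R)^-1.
      by field; case: unm.
    apply: (maxidMr vQ); first exact: (maxidB fT vQ).
    by case: unm.
  have mu : maxid Q (u x).
    have -> : u x = (u x - n%:R * v x) + n%:R * v x by ring.
    by apply: (maxidD fT vQ) => //; apply: (maxidMl vQ) => //; exact: (sr_nat rQ).
  apply: (maxid_nunit (Q := Q) _ uD); rewrite -(uvD x).
  by apply: (maxidD fT vQ) => //; exact: (maxidMl vQ).
pose e x := u x - w%:R * v x.
pose Z x := v x / e x.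
have e0 x : x \in xs -> e x != 0 by move=> /Hw[].
have QZ x : x \in xs -> Q (Z x).
  by move=> xin; apply: (srM rQ); [exact: Qv|case: (Hw x xin)].
have ZZ x x' : x \in xs -> x' \in xs -> Z x - Z x' = (a * d - b * c) * (x' - x) / (e x * e x').
  move=> xin xin'; have := e0 x xin; have := e0 x' xin'; rewrite /Z /e /u /v => h h'.
  by field; rewrite h h'.
have Zinj : {in xs &, injective Z}.
  move=> x x' xin xin' ZE; apply/eqP; rewrite eq_sym -subr_eq0.
  have := ZZ x x' xin xin'; rewrite ZE subrr => /esym/eqP.
  by rewrite !mulf_eq0 invr_eq0 mulf_eq0 (negPf D0) (negPf (e0 _ xin)) (negPf (e0 _ xin')) !orbF.
have [p [q [nd pq]]] := iterate_pair m.
have [b1 [b2 [bnz bE]]] : exists b1 b2 : K, ~ (b1 = 0 /\ b2 = 0) /\ beta = pt b1 b2.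
  exact: optP.
have bE' : omap iota beta = pt (iota b1) (iota b2).
  rewrite bE /pt fmorph_eq0; case: eqP => //= _; by rewrite fmorph_div.
have bnz' : ~ (iota b1 = 0 /\ iota b2 = 0).
  by move=> [/eqP + /eqP]; rewrite !fmorph_eq0 => /eqP ? /eqP ?; apply: bnz.
pose f := b2 *: p - b1 *: q.
have [sp sq nz] := nd; rewrite !size_map_poly in sp sq.
have evf z : ev (deg ^ m) (map_poly iota f) z =
    ev (deg ^ m) (map_poly iota p) z * iota b2 - ev (deg ^ m) (map_poly iota q) z * iota b1.
  rewrite /f rmorphB /= !map_polyZ; case: z => [z|] /=.
    by rewrite hornerD hornerN !hornerZ; ring.
  by rewrite coefB !coefZ; ring.
have fibf z : ev (deg ^ m) (map_poly iota f) z = 0 <-> iter m Phi z = omap iota beta.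
  rewrite -pq bE' /ratmap (pt_eq (nz z) bnz') evf.
  by split=> [/eqP|->]; [rewrite subr_eq0 => /eqP|rewrite subrr].
have sf : (size (map_poly iota f) <= (deg ^ m).+1)%N.
  rewrite size_map_poly (leq_trans (size_polyD _ _)) // size_polyN geq_max.
  by rewrite !(leq_trans (size_scale_leq _ _)).
(* The change of coordinate is inverted: coordinate Z belongs to the point (w Z + 1 : Z). *)
pose W : {poly K} := w%:R *: 'X + 1%:P.
pose G := hcomp (deg ^ m) f W 'X.
have WE : map_poly iota W = w%:R *: 'X + 1%:P.
  rewrite /W rmorphD /= map_polyZ map_polyX map_polyC /=.
  by rewrite rmorph1 rmorph_nat.
have sW : (size (map_poly iota W) <= 2)%N by rewrite WE size_linear.
have sX : (size ('X : {poly Kbar}) <= 2)%N by rewrite size_polyX.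
have GE : map_poly iota G = hcomp (deg ^ m) (map_poly iota f) (map_poly iota W) 'X.
  by rewrite map_hcomp map_polyX.
have [sG _] := ev_hcomp (deg ^ m) (map_poly iota f) None sW sX.
rewrite -GE size_map_poly muln1 in sG.
have evG z : ev (deg ^ m) (map_poly iota G) z =
    pt_factor (ev 1 (map_poly iota W) z) (ev 1 'X z) ^+ (deg ^ m) *
    ev (deg ^ m) (map_poly iota f) (pt (ev 1 (map_poly iota W) z) (ev 1 'X z)).
  have [_ H] := ev_hcomp (deg ^ m) (map_poly iota f) z sW sX.
  by rewrite GE -(form_value _ _ sf) -H muln1.
(* The coordinate is infinite only at the point [w], which lies outside the fibre by the choice of
   [w]; so [G] has full degree. *)
have Gtop : G`_(deg ^ m) != 0.
  rewrite -(fmorph_eq0 iota) -coef_map -[X in X != 0]/(ev (deg ^ m) (map_poly iota G) None).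
  rewrite evG WE ev_linear /= coefX /= mulf_neq0 //.
    rewrite expf_neq0 // /pt_factor oner_eq0 oner_neq0 //.
  apply/eqP => /fibf/fibre[x xin]; rewrite mobE /pt oner_eq0 divr1.
  case: eqP => // /eqP v0 [wE]; have := e0 x xin; rewrite /e wE divfK // subrr eqxx //.
have sGE : size G = (size [seq Z x | x <- xs]).+1.
  rewrite size_map sxs; apply/eqP; rewrite eqn_leq sG /= ltnNge.
  by apply: contra Gtop => H; rewrite nth_default.
have etale := @separable_transfer _ _ _ _ _ ffK algKbar Q Q1 G [seq Z x | x <- xs] pQ pQ1 EQ.
have {}etale z : z \in [seq Z x | x <- xs] -> etale_closure i iota Q1 (range iota) z.
  apply: etale => //.
  - by rewrite map_inj_in_uniq.
  - move=> _ /mapP[x xin ->]; split; last exact: QZ.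
    rewrite rootE -[X in X == 0]/(ev (deg ^ m) (map_poly iota G) (Some (Z x))) evG.
    rewrite WE ev_linear /= hornerX; apply/eqP.
    have -> : pt (w%:R * Z x + 1) (Z x) = pt (u x) (v x).
      rewrite -[RHS](pt_scale _ _ (c := (e x)^-1)) ?invr_eq0 ?e0 //; congr pt; last by rewrite mulrC.
      by have := e0 x xin; rewrite /Z /e => h; field.
    have /fibf -> : iter m Phi (pt (u x) (v x)) = omap iota beta.
      by apply/fibre; exists x => //; rewrite mobE.
    by rewrite mulr0.
  - move=> _ _ /mapP[x xin ->] /mapP[x' xin' ->] zz.
    have xx : x' != x by apply: contraNneq zz => ->.
    rewrite ZZ //; apply: (unit_div vQ); last by apply: (unitM vQ); exact: Hw.
    by apply: (unitM vQ) => //; exact: Hxs.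
have fM := etale_closure_subfield pQ1 (range iota).
have rM := sf_ring fM.
apply: field_gen_min => // z [zK|/fibre[x xin]]; first exact: (etale_closure_sub pQ1).
rewrite mobE /pt; case: eqP => // /eqP v0 [zE].
have EZ : etale_closure i iota Q1 (range iota) (Z x) by apply/etale/map_f.
have -> : z = w%:R + (Z x)^-1.
  have := e0 x xin; rewrite /Z zE invf_div => h; rewrite /e; by field.
by apply: (srD rM); [exact: (sr_nat rM)|exact: (sfV fM)].
Qed.

End PreimageFields.

Lemma finite_roots (F : closedFieldType) (p : {poly F}) : p != 0 ->
  finite_set [set x | root p x].
Proof.
move=> p0; have [rs E] := closed_field_poly_normal p.
apply: (@sub_finite_set _ _ [set` rs]); last exact: finite_seq.
by move=> x /=; rewrite {1}E rootZ ?lead_coef_eq0 // root_prod_XsubC.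
Qed.

(** * Critical orbits of the map and of its model *)

Section CriticalOrbit.
Variables (k K : fieldType) (i : {rmorphism k -> K}).
Variables (Kbar : closedFieldType) (iota : {rmorphism K -> Kbar}).
Hypothesis char0 : [pchar Kbar] =i pred0.
Variable phi : {fraction {poly K}}.
Hypothesis deg_phi : (1 < rat_deg phi)%N.
Local Notation kb := (kbar i iota).
Local Notation deg := (rat_deg phi).
Local Notation Phi := (rat_eval (rat_map iota phi)).
Variables (N D : {poly Kbar}) (a b c d : Kbar).
Hypotheses (kN : forall l, kb N`_l) (kD : forall l, kb D`_l).
Hypothesis mN : N \is monic.
Hypotheses (sN : size N = deg.+1) (sD : (size D <= deg)%N).
Hypothesis nd : nondeg deg N D.
Hypothesis det : a * d - b * c != 0.
Local Notation Psi := (ratmap deg N D).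
Hypothesis semiconj : forall y, Psi (mob a b c d y) = mob a b c d (Phi y).

Lemma iter_semiconj n y : iter n Psi (mob a b c d y) = mob a b c d (iter n Phi y).
Proof. by elim: n => //= n ->; exact: semiconj. Qed.

Lemma rat_deg_map : rat_deg (rat_map iota phi) = deg.
Proof.
apply: (@rat_deg_nondeg _ _ (idfun : {rmorphism Kbar -> Kbar}) _
  (map_poly iota (rat_num phi)) (map_poly iota (rat_den phi))) => //.
  by rewrite map_poly_eq0; case: (rat_coprime phi).
by rewrite ![map_poly idfun _]map_poly_id //; exact: rat_nondeg.
Qed.

(** The number of points of a fibre is transported by the conjugation: over a finite value that is
    not critical there are [deg] points, too many for the fibre of a critical point. *)
Lemma critical_value_image x : critical_points (rat_map iota phi) x ->
  forall y, mob a b c d (Phi x) = Some y -> crit_value N D y.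
Proof.
move=> cx y xy; apply: contrapT => ny.
have [s [us ss Hs]] := full_fibre mN sN sD nd ny.
have := @critical_fibre _ (rat_map iota phi) x
  [seq mob d (- b) (- c) a (Some z) | z <- s].
rewrite size_map ss rat_deg_map ltnn => H; suff : false by [].
apply: H => //; first exact: ltnW.
  rewrite map_inj_uniq // => z z' /(congr1 (mob a b c d)).
  by rewrite !mobVK // => -[].
move=> _ /mapP[z /Hs Pz ->]; rewrite -[LHS](mobK _ det) -semiconj mobVK // Pz -xy.
by rewrite mobK.
Qed.

(** If no critical value wanders, the conjugated postcritical set lies in [Y], made of the finite
    orbits of critical values, the fixed point infinity, and [X], which catches the critical points
    themselves through their images. *)
Lemma wandering_critical : ~ postcritically_finite (rat_map iota phi) ->
  exists y, crit_value N D y /\ wandering Psi (Some y).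
Proof.
move=> npcf; apply: contrapT => nex; apply: npcf.
have [cvs Hcvs] := crit_values_finite char0 deg_phi kN kD mN sN nd.
pose X : set (option Kbar) := [set None] `|` (Some @` [set x | root D x]) `|`
  \bigcup_(y in [set` cvs]) (Some @` [set x | root (fib N D y) x]).
pose Y : set (option Kbar) := X `|` [set None] `|`
  \bigcup_(y in [set` [seq y <- cvs | `[< crit_value N D y >]]])
     [set iter n Psi (Some y) | n in setT].
have D0 := D_neq0 deg_phi nd.
have finX : finite_set X.
  rewrite !finite_setU; split; first split.
  - exact: finite_set1.
  - exact/finite_image/finite_roots.
  apply: bigcup_finite; first exact: finite_seq.
  move=> y _; apply/finite_image/finite_roots; exact: (fib_neq0 mN sN sD).
have finY : finite_set Y.
  rewrite finite_setU; split.
    by rewrite finite_setU; split=> //; exact: finite_set1.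
  apply: bigcup_finite; first exact: finite_seq.
  move=> y /=; rewrite mem_filter => /andP[/asboolP cy _].
  by apply: not_wandering_finite => wy; apply: nex; exists y.
apply: (@sub_finite_set _ _ (mob d (- b) (- c) a @` Y)); last exact: finite_image.
move=> _ [x cx [n _ <-]]; exists (mob a b c d (iter n Phi x)); last by rewrite mobK.
case: n => [|n].
  left; left; rewrite /=; case E : (mob a b c d x) => [y|]; last by left; left.
  have := semiconj x; rewrite E; case E' : (mob a b c d (Phi x)) => [y'|] P.
    have [ycvs _] := Hcvs _ (critical_value_image cx E').
    by right; exists y' => //; exists y => //; apply/(Psi_Some nd).
  left; right; exists y => //; move: P; rewrite /ratmap /pt /= rootE.
  by case: eqVneq.
rewrite iterSr -iter_semiconj.
case E' : (mob a b c d (Phi x)) => [y'|].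
  have cv := critical_value_image cx E'; have [ycvs _] := Hcvs _ cv.
  right; exists y'; last by exists n.
  by rewrite /= mem_filter ycvs andbT; apply/asboolP.
by left; right; rewrite (iter_Psi_inf N sD).
Qed.

End CriticalOrbit.

(** * Places with a given residue, values of K, and the tower of preimage fields *)

Section Assembly.
Variables (k K : fieldType) (i : {rmorphism k -> K}).
Variables (Kbar : closedFieldType) (iota : {rmorphism K -> Kbar}).
Hypothesis ffK : function_field_over i.
Hypothesis algKbar : forall z : Kbar, algebraicOver iota z.
Hypothesis char0 : [pchar Kbar] =i pred0.
Local Notation place := (place i iota).
Local Notation kb := (kbar i iota).
Let fkb := kbar_subfield i iota.
Let rkb := sf_ring fkb.
Let fT := setT_subfield Kbar.

(** Chevalley's theorem is applied to kbar[t] and the element t - g. This is not invertible there: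
    as [t] is transcendental, p(t)(t - g) = 1 would hold as an identity of polynomials and fail at
    [g]. *)
Lemma place_at t g : ~ kb t -> kb g -> exists Q, place Q /\ maxid Q (t - g).
Proof.
move=> nt kg; have tg : t - g != 0.
  by rewrite subr_eq0; apply/eqP => E; apply: nt; rewrite E.
pose R : set Kbar := [set z | exists2 p : {poly Kbar}, (forall l, kb p`_l) & z = p.[t]].
have kR : kb `<=` R.
  by move=> z kz; exists z%:P; [exact: (sr_polyC rkb)|rewrite hornerC].
have rR : subring_closed [in R].
  apply/subring_setP; split.
  - by apply: kR; exact: (sr1 rkb).
  - move=> _ _ [p kp ->] [q kq ->]; exists (p - q); last by rewrite !hornerE.
    exact: (sr_polyB rkb).
  - move=> _ _ [p kp ->] [q kq ->]; exists (p * q); last by rewrite !hornerE.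
    exact: (sr_polyM rkb).
have [|m ->|m m' -> ->|m ->|B [vB RB BV]] := @chevalley _ R [set t - g] rR.
- move=> _ ->; exists ('X - g%:P); last by rewrite !hornerE.
  by apply: (sr_polyB rkb); [exact: (sr_polyX rkb)|exact: (sr_polyC rkb)].
- by [].
- by exists (t - g); rewrite divff //; split=> //; exact: (sr1 rR).
- move=> [p kp E]; pose q := p * ('X - g%:P) - 1.
  have kq l : kb q`_l.
    move: l; apply: (sr_polyB rkb); last exact: (sr_polyC rkb (sr1 rkb)).
    by apply: (sr_polyM rkb) => //; apply: (sr_polyB rkb); [exact: (sr_polyX rkb)|exact: (sr_polyC rkb)].
  have q0 : q != 0.
    apply/eqP => /(congr1 (fun p => p.[g])) /eqP.
    by rewrite /q !hornerE subrr mulr0 sub0r oppr_eq0 oner_eq0.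
  by have /negP[] := kbar_transc nt q0 kq; rewrite /q !hornerE -E mulVf // subrr.
have mB : maxid B (t - g) by right; exact: BV.
exists B; split=> //; split=> //.
  by apply/eqP => BT; apply: (BV (t - g)) => //; rewrite BT.
by move=> z Kz; apply/RB/kR; exact: range_kbar.
Qed.

Lemma algebraic_alg_over z : alg_over (range iota) z.
Proof.
have [p p0 pz] := algKbar z; exists (map_poly iota p); rewrite map_poly_eq0; split=> // l.
by rewrite coef_map; exists p`_l.
Qed.

(** Constants are always in the closure, so only a finite basis of K' over K has to be
    controlled. *)
Lemma extended_constants_etale (K' : fieldExtType K) (j : {rmorphism K' -> Kbar}) :
  (forall x, j (in_alg K' x) = iota x) ->
  exists us : seq Kbar, (forall u, u \in us -> u != 0) /\
    forall Q L, place Q -> (forall u, u \in us -> unit_of Q u) ->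
      range iota `<=` etale_closure i iota Q L ->
      extended_constants i iota j `<=` etale_closure i iota Q L.
Proof.
move=> jE.
have [us [us0 Hus]] := etale_criterion_seq ffK algKbar char0 (als := [seq j e | e <- vbasis {:K'}])
  (range_subfield iota) (fun z _ => algebraic_alg_over z).
exists us; split=> // Q L pQ uQ KM.
have fM := etale_closure_subfield pQ L; have rM := sf_ring fM.
apply: field_gen_min => // z [[y _ <-]|kz]; last exact: etale_closure_kbar.
rewrite (coord_vbasis (memvf y)) rmorph_sum; apply: (sr_sum rM) => l _.
rewrite -mulr_algl rmorphM /=; apply: (srM rM).
  by apply: KM; exists (coord (vbasis {:K'}) l y) => //; rewrite -jE.
apply: (Hus Q L pQ uQ KM); apply: map_f.
by rewrite mem_nth // size_tuple.
Qed.

(** [t] need not lie in K. The point is that the values of K at Q are among those of kbar(t), which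
    are explicit. *)
Lemma range_etale t : ~ kb t -> exists us : seq Kbar, (forall u, u \in us -> u != 0) /\
  forall Q, place Q -> (forall u, u \in us -> unit_of Q u) ->
    range iota `<=` etale_closure i iota Q (adj i iota t).
Proof.
move=> nt; have [[t0 [nt0 [d [b span]]]] _] := ffK.
pose als := iota t0 :: [seq iota (b l) | l <- enum 'I_d].
have [us [us0 Hus]] := etale_criterion_seq ffK algKbar char0 (als := als)
  (adj_subfield i iota t) (fun z _ => alg_over_adj ffK algKbar z nt).
exists us; split=> // Q pQ uQ.
have fM := etale_closure_subfield pQ (adj i iota t); have rM := sf_ring fM.
have H := Hus Q (adj i iota t) pQ uQ (etale_closure_sub pQ (L := adj i iota t)).
move=> _ [y _ <-]; have [c Ac ->] := span y.
rewrite rmorph_sum; apply: (sr_sum rM) => l _; rewrite rmorphM; apply: (srM rM); last first.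
  by apply: H; rewrite inE; apply/orP; right; apply: map_f; rewrite mem_enum.
have : forall w, field_gen (range i `|` [set t0]) w ->
    [set w | etale_closure i iota Q (adj i iota t) (iota w)] w.
  apply: field_gen_min.
    apply/subfield_setP; split=> /= [|x x' Mx Mx'|x x' Mx Mx'].
    - by rewrite rmorph1; exact: (sr1 rM).
    - by rewrite rmorphB; exact: (srB rM).
    - by rewrite fmorph_div; exact: (sf_div fM).
  move=> _ [[e _ <-]|->] /=; last by apply: H; rewrite mem_head.
  by apply: (etale_closure_kbar pQ); apply: range_kbar; exists e.
by apply; exact: Ac.
Qed.

(** The pair of exponents stands for their difference, the possibly negative order of [w] at [g]. *)
Lemma adj_order Q t g w : place Q -> kb g -> maxid Q (t - g) -> t != g ->
  ~ kb t -> adj i iota t w -> w != 0 ->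
  exists m n, unit_of Q (w * (t - g) ^+ m / (t - g) ^+ n).
Proof.
move=> pQ kg mt tg nt /adj_frac[p [q [kp kq q0 ->]]]; have [vQ _ _] := pQ.
rewrite mulf_eq0 => /norP[p0 _].
have nz (r : {poly Kbar}) : r.[t] != 0 -> r != 0.
  by apply: contra => /eqP->; rewrite horner0.
have [n un] := kbar_poly_order pQ kg mt tg (nz _ p0) kp.
have [m um] := kbar_poly_order pQ kg mt tg (nz _ q0) kq.
exists m, n.
have tg0 : t - g != 0 by rewrite subr_eq0.
have -> : p.[t] / q.[t] * (t - g) ^+ m / (t - g) ^+ n =
    (p.[t] / (t - g) ^+ n) / (q.[t] / (t - g) ^+ m).
  by field; rewrite q0 !expf_neq0.
exact: (unit_div vQ).
Qed.

Lemma pi_power_unit Q (v : Kbar) m n : place Q -> v != 0 -> maxid Q v ->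
  unit_of Q (v ^+ m / v ^+ n) -> m = n.
Proof.
move=> pQ v0 mv; have [vQ _ _] := pQ.
have key r s : (r < s)%N -> ~ unit_of Q (v ^+ s / v ^+ r).
  move=> rs; apply: maxid_nunit.
  have -> : v ^+ s / v ^+ r = v * v ^+ (s - r.+1).
    by rewrite -exprS subnSK // -{1}(subnK (ltnW rs)) exprD mulfK // expf_neq0.
  by apply: (maxidMr vQ) => //; apply: (srX (vr_ring vQ)); exact: (maxidW vQ).
case: (ltngtP m n) => // H u; last by case: (key _ _ H).
by case: (key _ _ H); rewrite -invf_div; exact: unitV.
Qed.

Variables (phi : {fraction {poly K}}) (beta : option K).
Hypothesis deg_phi : (1 < rat_deg phi)%N.
Local Notation deg := (rat_deg phi).
Local Notation Phi := (rat_eval (rat_map iota phi)).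
Local Notation K_ := (preimage_field iota phi beta).

Lemma preimage_field_range n : range iota `<=` K_ n.
Proof. by move=> z Kz; apply: field_gen_sub; left. Qed.

(** A preimage of level n is the value of [phi] at one of level n + 1. This is what makes the union
    of the fields a field. *)
Lemma preimage_field_incl n : K_ n `<=` K_ n.+1.
Proof.
have fK := @field_gen_subfield Kbar (range iota `|` [set x | iter_preimage iota phi beta n.+1 (Some x)]).
have rK := sf_ring fK.
have Kn (p : {poly K}) x : K_ n.+1 x -> K_ n.+1 (map_poly iota p).[x].
  move=> Kx; apply: (sr_horner rK) => // l; rewrite coef_map.
  by apply: preimage_field_range; exists p`_l.
apply: field_gen_min => // z [Kz|Hz]; first exact: preimage_field_range.
have nd := rat_nondeg iota phi; have [sp sq nz] := nd.
have P1 y : Phi y = Some z -> K_ n.+1 z.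
  case: y => [y|] E.
    have Ky : K_ n.+1 y.
      by apply: field_gen_sub; right; rewrite /= /iter_preimage /= -iterS iterSr E.
    move: E; rewrite rat_map_eval /ratmap /pt /=; case: eqP => // _ [<-].
    by apply: (sf_div fK); exact: Kn.
  move: E; rewrite rat_map_eval /ratmap /pt /=; case: eqP => // _ [<-].
  by rewrite !coef_map -fmorph_div; apply: preimage_field_range; eexists.
pose h := map_poly iota (rat_num phi) - z *: map_poly iota (rat_den phi).
have pr y : ev deg h y = 0 -> Phi y = Some z.
  move=> hy; rewrite rat_map_eval.
  have -> : Some z = pt z 1 by rewrite /pt oner_eq0 divr1.
  apply/(pt_eq (nz y)); first by move=> [_ /eqP]; rewrite oner_eq0.
  apply/eqP; rewrite mulr1 -subr_eq0 mulrC; apply/eqP; rewrite -[RHS]hy /h.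
  by case: (y) => [w|] /=; rewrite ?hornerD ?hornerN ?hornerZ ?coefB ?coefZ.
(* A nonzero constant [h] means that the fibre is reduced to infinity; then [z] is the value of
   [phi] there and lies in K. *)
case: (boolP (size h == 1%N)) => [|/closed_rootP[y /eqP hy]]; last by apply: (P1 (Some y)); exact: pr.
move=> /eqP sh; apply: (P1 None); apply: pr => /=; rewrite nth_default // sh.
exact: ltnW.
Qed.

Lemma preimage_field_le m n : (m <= n)%N -> K_ m `<=` K_ n.
Proof.
move=> mn; rewrite -(subnK mn); elim: (n - m)%N => [//|l IH].
by rewrite addSn => z /IH; exact: preimage_field_incl.
Qed.

Lemma preimage_union_subfield : subfield_set (\bigcup_(n in [set n | (0 < n)%N]) K_ n).
Proof.
have two x y : (\bigcup_(n in [set n | (0 < n)%N]) K_ n) x ->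
    (\bigcup_(n in [set n | (0 < n)%N]) K_ n) y ->
    exists n, [/\ (0 < n)%N, K_ n x & K_ n y].
  move=> [m m0 Kx] [n n0 Ky]; exists (maxn m n); split.
  - by rewrite leq_max m0.
  - by apply: preimage_field_le Kx; exact: leq_maxl.
  - by apply: preimage_field_le Ky; exact: leq_maxr.
have fK n : subfield_set (K_ n) := field_gen_subfield _.
apply/subfield_setP; split.
- by exists 1%N => //; exact: (sf1 (fK 1%N)).
- move=> x y Kx Ky; have [n [n0 Kx' Ky']] := two x y Kx Ky.
  by exists n => //; exact: (srB (sf_ring (fK n))).
- move=> x y Kx Ky; have [n [n0 Kx' Ky']] := two x y Kx Ky.
  by exists n => //; exact: (sf_div (fK n)).
Qed.

End Assembly.

Theorem theorem5p1
  (k K : fieldType) (i : {rmorphism k -> K})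
  (charK : [pchar K] =i pred0)
  (ffK : function_field_over i)
  (Kbar : closedFieldType) (iota : {rmorphism K -> Kbar})
  (algKbar : forall z : Kbar, algebraicOver iota z)
  (phi : {fraction {poly K}}) (deg_phi : (1 < rat_deg phi)%N)
  (beta : option K)
  (K' : fieldExtType K)
  (k' : set K')
  (k'E : k' = [set y : K' | algebraicOver (in_alg K' \o i) y])
  (sigma sigmaV : {fraction {poly K'}})
  (deg_sigma : rat_deg sigma = 1%N)
  (sigmaK : rat_comp sigma sigmaV = rat_X K')
  (sigmaVK : rat_comp sigmaV sigma = rat_X K')
  (isotriv : rat_over k'
     (rat_comp (rat_comp sigma (rat_map (in_alg K') phi)) sigmaV)) :
  let K_ := preimage_field iota phi beta in
  let sigma_beta := rat_eval sigma (omap (in_alg K') beta) in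
  (P1_of k' sigma_beta ->
     finite_set [set P : set K | prime_of i P /\
       ramifies_in iota P (\bigcup_(n in [set n | (0 < n)%N]) K_ n)])
  /\
  (~ P1_of k' sigma_beta ->
   ~ postcritically_finite (rat_map iota phi) ->
     exists N : nat, forall n : nat, (0 < n)%N -> (N <= n)%N ->
       exists P : set K,
         [/\ prime_of i P, ramifies_in iota P (K_ n) &
             forall m : nat, (0 < m < n)%N -> ~ ramifies_in iota P (K_ m)]).
Proof.
move=> K_ sigma_beta.
have char0 : [pchar Kbar] =i pred0 by move=> p; rewrite (fmorph_pchar iota).
have [j jE] := finite_extension_embedding K' iota charK.
have [a [b [c [d [N [D [[det [Ea Eb Ec Ed]] [kN kD mN sN sD] nd semi P1E]]]]]]] :=
  normal_form beta deg_phi jE k'E deg_sigma sigmaK sigmaVK isotriv.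
have itsemi := iter_semiconj semi.
have [us [us0 Hus]] := extended_constants_etale ffK algKbar char0 jE.
pose kb := kbar i iota; pose E := extended_constants i iota j.
have fE : subfield_set E := field_gen_subfield _.
have rE := sf_ring fE.
have fT := setT_subfield Kbar.
have kE : kb `<=` E by move=> z kz; apply: field_gen_sub; right.
have ENb : E (- b) := srN rE Eb.
have ENc : E (- c) := srN rE Ec.
have P1mono (A B : set Kbar) x : A `<=` B -> P1_of A x -> P1_of B x.
  by move=> AB [->|[z Az <-]]; [left|right; exists z => //; exact: AB].
have P1S (A : set Kbar) z : P1_of A (Some z) -> A z by case=> // -[w Aw [<-]].
have no_value Q P L y : same_values Q (range iota) L -> L y -> y != 0 ->
    iota @^-1` Q = P -> (forall x : K, x != 0 -> ~ unit_of Q (y / iota x)) -> False.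
  move=> sv Ly y0 _ Hy; have [_ [[x _ <-] x0 u]] := sv y Ly y0.
  by apply: (Hy x) => //; move: x0; rewrite fmorph_eq0.
split=> [/P1E.1 Pb|nPb npcf].
  (* Only primes with some place above them at which a member of [us] is not a unit can ramify:
     elsewhere K' and the constants bring no new values. *)
  apply: (@sub_finite_set _ _ (\bigcup_(u in [set` us]) [set P | prime_of i P /\
      exists Q, [/\ place i iota Q, iota @^-1` Q = P & ~ unit_of Q u]])); last first.
    apply: bigcup_finite; first exact: finite_seq.
    by move=> u uin; exact: (finite_nonunits ffK algKbar (us0 u uin)).
  move=> P [pP ramP]; apply: contrapT => nbad.
  have fL := preimage_union_subfield iota beta deg_phi.
  have KL : range iota `<=` \bigcup_(n in [set n | (0 < n)%N]) K_ n.
    by move=> z Kz; exists 1%N => //; exact: preimage_field_range.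
  have [Q [pQ EQ [y [[n n0 Ky] y0 Hy]]]] := ramified_place pP fL KL ramP.
  have uQ u : u \in us -> unit_of Q u.
    move=> uin; apply: contrapT => nu; apply: nbad; exists u => //.
    by split=> //; exists Q.
  have KM := etale_closure_sub pQ (L := range iota).
  have EM := Hus Q (range iota) pQ uQ KM.
  have KnE : K_ n `<=` etale_closure i iota Q (range iota).
    apply: field_gen_min; first exact: (etale_closure_subfield pQ).
    move=> z [Kz|Hz]; first exact: KM.
    (* In the model the preimages are constant, and the inverse conjugation has coefficients in
       [E]. *)
    apply: EM; apply: P1S; rewrite -(mobK (Some z) det); apply: P1_mob => //.
    apply: (P1mono kb) => //; apply: (iter_Psi_constant deg_phi kN kD mN sN sD nd (n := n)).
    by rewrite itsemi Hz.
  have sv := etale_closure_values ffK algKbar char0 pQ (range_subfield iota).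
  apply: (no_value Q P _ y (sv _) (KnE _ Ky) y0 EQ Hy).
  by move=> _ [x _ <-]; exists (i x).
have [t [tE nt]] : exists t, mob a b c d (omap iota beta) = Some t /\ ~ kb t.
  case tE : (mob a b c d (omap iota beta)) => [t|]; last first.
    by case: nPb; apply/P1E.2; rewrite tE; left.
  exists t; split=> // kt; apply: nPb; apply/P1E.2; rewrite tE.
  by right; exists t.
have [us2 [us20 Hus2]] := range_etale ffK algKbar char0 nt.
(* The first five entries make the conjugation integral and invertible at Q; [us] controls K' over
   K, and [us2] controls K over kbar(t). *)
pose us3 := [seq u <- [:: a; b; c; d; a * d - b * c] ++ us ++ us2 | u != 0].
have [bad Hbad] : exists bad : seq Kbar, forall Q g, place i iota Q -> kb g ->
    maxid Q (t - g) -> g \notin bad -> forall u, u \in us3 -> unit_of Q u.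
  by apply: generic_units => // u; rewrite mem_filter => /andP[].
have [y0 [cy0 wy0]] :=
  wandering_critical char0 deg_phi kN kD mN sN sD nd det semi npcf.
have [cvs Hcvs] := crit_values_finite char0 deg_phi kN kD mN sN nd.
pose C := [seq Some y | y <- cvs & `[< crit_value N D y >]].
have [b0 [b0C wb0 maxb0]] := ex_maximal_wandering C wy0.
have [bb [b0E cb]] : exists bb, b0 = Some bb /\ crit_value N D bb.
  case: b0C => [->|/mapP[y]]; first by exists y0.
  by rewrite mem_filter => /andP[/asboolP cy _] ->; exists y.
subst b0; have [_ kbb] := Hcvs _ cb.
pose Psi := ratmap (rat_deg phi) N D.
have [N0 HN0] := eventually_notin [seq Some g | g <- bad] wb0.
(* The successor accounts for n = l + 1: [g] is the l-th iterate of the critical value [bb], and it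
   must avoid [bad]. *)
exists N0.+1 => n n0 Nn.
have [l nE] : exists l, n = l.+1 by exists n.-1; rewrite prednK.
have [g gE] : exists g, iter l Psi (Some bb) = Some g.
  case gE : (iter l Psi (Some bb)) => [g|]; first by exists g.
  (* Infinity is fixed, so an orbit that reaches it repeats and does not wander. *)
  suff : l = l.+1 by move/eqP; rewrite -[X in X == _]addn0 -[X in _ == X]addn1 eqn_add2l.
  by apply: wb0; rewrite /= gE; exact: esym (Psi_inf N sD).
have kg : kb g.
  apply: P1S; rewrite -gE; apply: (iter_Psi_kbar kN kD sD).
  by right; exists bb.
have gbad : g \notin bad.
  have := HN0 l; rewrite gE => H; apply: contra (H _) => [gb|]; first exact: map_f.
  by rewrite -ltnS -nE.
have [Q [pQ mg]] := place_at nt kg.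
have [vQ _ _] := pQ; have rQ := vr_ring vQ.
have uQ := Hbad Q g pQ kg mg gbad.
have in3 u : u != 0 -> u \in [:: a; b; c; d; a * d - b * c] ++ us ++ us2 -> unit_of Q u.
  by move=> u0 uin; apply: uQ; rewrite mem_filter u0.
have uQ1 u : u \in us -> unit_of Q u.
  by move=> uin; apply: in3; [exact: us0|rewrite !mem_cat uin orbT].
have uQ2 u : u \in us2 -> unit_of Q u.
  by move=> uin; apply: in3; [exact: us20|rewrite !mem_cat uin !orbT].
have Qin u : u \in [:: a; b; c; d] -> Q u.
  move=> uin; case: (eqVneq u 0) => [->|u0]; first exact: (sr0 rQ).
  apply: unitW; apply: in3 => //; rewrite mem_cat.
  by move: uin; rewrite !inE => /or4P[] ->; rewrite ?orbT.
have udet : unit_of Q (a * d - b * c).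
  by apply: in3 => //; rewrite mem_cat !inE eqxx !orbT.
have tg : t != g by apply/eqP => tgE; apply: nt; rewrite tgE.
exists (iota @^-1` Q); split.
- exact: place_prime.
- apply: contrapT => nram.
  have fK : subfield_set (K_ n) := field_gen_subfield _.
  have sv1 := unramified_values fK pQ erefl (@preimage_field_range _ _ iota phi beta n) nram.
  have kK : range (iota \o i) `<=` K_ n.
    by move=> _ [x _ <-]; apply: preimage_field_range; exists (i x).
  have sv2 := etale_closure_values ffK algKbar char0 pQ fK kK.
  set M := etale_closure i iota Q (K_ n) in sv2.
  have fM : subfield_set M := etale_closure_subfield pQ (K_ n).
  have rM := sf_ring fM.
  have KnM : K_ n `<=` M := etale_closure_sub pQ (L := K_ n).
  have EM : E `<=` M.
    by apply: Hus => // z Kz; apply: KnM; exact: preimage_field_range.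
  have [x [cc [e [itx kcc xc e1 uxc]]]] :=
    ramified_critical kN kD mN sN sD nd pQ kg mg tg cb kbb gE.
  have Mx : M x.
    apply: P1S; rewrite -(mobVK (Some x) det).
    apply: P1_mob; rewrite ?/(M _); do ?[exact: EM|exact: fM].
    case zE : (mob d (- b) (- c) a (Some x)) => [z|]; last by left.
    right; exists z => //; apply: KnM; apply: field_gen_sub; right.
    rewrite /= /iter_preimage /=; rewrite -zE -[LHS](mobK _ det) -itsemi mobVK //.
    by rewrite nE itx -tE mobK.
  have Mxc : M (x - cc) by apply: (srB rM) => //; apply: EM; exact: kE.
  have xc0 : x - cc != 0 by rewrite subr_eq0.
  (* If P did not ramify, [x - cc] would have the value of some [r] in K, hence of some [w] in
     kbar(t), hence of a quotient of powers of t - g. *)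
  have [_ [[r _ <-] r0 ur]] := same_values_trans pQ sv1 sv2 Mxc xc0.
  have KT : range iota `<=` etale_closure i iota Q (adj i iota t) by exact: Hus2.
  have kadj : range (iota \o i) `<=` adj i iota t.
    by move=> z Kz; apply: adj_kbar; exact: range_kbar.
  have rT : etale_closure i iota Q (adj i iota t) (iota r) by apply: KT; exists r.
  have [w [aw w0 uw]] :=
    etale_closure_values ffK algKbar char0 pQ (adj_subfield i iota t) kadj rT r0.
  have [m1 [m2 um]] := adj_order pQ kg mg tg nt aw w0.
  set v := t - g in mg um uxc *.
  have v0 : v != 0 by rewrite subr_eq0.
  have : unit_of Q (v ^+ (m1 * e + 1) / v ^+ (m2 * e)).
    have -> : v ^+ (m1 * e + 1) / v ^+ (m2 * e) =
        ((x - cc) / iota r * (iota r / w) * (w * v ^+ m1 / v ^+ m2)) ^+ e /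
        ((x - cc) ^+ e / v).
      have -> : (x - cc) / iota r * (iota r / w) * (w * v ^+ m1 / v ^+ m2) =
          (x - cc) * v ^+ m1 / v ^+ m2 by field; rewrite r0 w0 expf_neq0.
      rewrite expr_div_n exprMn -!exprM exprD expr1.
      by field; rewrite v0 !expf_neq0.
    apply: (unit_div vQ) => //; apply: (unitX vQ).
    by apply: (unitM vQ) => //; exact: (unitM vQ).
  (* The e-th power of [x - cc] has the value of [v] itself, so [e] would divide 1. *)
  move/(pi_power_unit pQ v0 mg)/(congr1 (modn^~ e)).
  by rewrite modnMDl modnMl modn_small.
move=> m /andP[m0 mn] ram.
have fK : subfield_set (K_ m) := field_gen_subfield _.
(* [Q1] is above the same prime, but [t] need not reduce to [g] there; residues are compared at [Q]
   only. *)
have [Q1 [pQ1 EQ1 [y [Ky yn0 Hy]]]] :=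
  ramified_place (place_prime algKbar pQ) fK (@preimage_field_range _ _ iota phi beta m) ram.
have [xs [uxs sxs Hxs]] := preimage_list char0 deg_phi kN kD mN sN sD nd m nt.
have Qxs x : x \in xs -> Q x.
  by move=> /Hxs; exact: (Q_iter kN kD mN sN sD nd pQ kg mg).
have Dxs x x' : x \in xs -> x' \in xs -> x != x' -> unit_of Q (x - x').
  move=> xin xin' xx; have Qxx : Q (x - x') by apply: (srB rQ); exact: Qxs.
  case: (maxidP Qxx) => // mxx; exfalso.
  have [xi [kxi mxi]] := residue pQ ffK algKbar (Qxs x xin).
  have mxi' : maxid Q (x' - xi).
    by have -> : x' - xi = (x - xi) - (x - x') by [ring]; exact: (maxidB fT vQ).
  have [l' [eta [l'm ceta ieta]]] := distinct_residues kN kD mN sN sD nd pQ ffK algKbar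
    kg mg ((Hxs x).1 xin) ((Hxs x').1 xin') xx kxi mxi mxi'.
  have [etac _] := Hcvs _ ceta.
  apply: (maxb0 (Some eta)).
    by apply: map_f; rewrite mem_filter etac andbT; apply/asboolP.
  (* Both iterates equal [g], and l' < m <= l: [bb] would precede the critical value [eta], against
     its maximality. *)
  exists l, l'; split; last by rewrite ieta.
  by apply: leq_trans l'm _; rewrite -ltnS -nE.
have fibre z : iter m (rat_eval (rat_map iota phi)) z = omap iota beta <->
    exists2 x, x \in xs & z = mob d (- b) (- c) a (Some x).
  split=> [zE|[x /Hxs itx ->]].
    have := itsemi m z; rewrite zE tE.
    case xE : (mob a b c d z) => [x|]; last by rewrite (iter_Psi_inf N sD).
    by move=> /Hxs xin; exists x => //; rewrite -xE mobK.
  by rewrite -[LHS](mobK _ det) -itsemi mobVK // itx -tE mobK.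
have Qabcd : [/\ Q a, Q b, Q c & Q d] by split; apply: Qin; rewrite !inE eqxx ?orbT.
have KM := preimage_etale ffK algKbar char0 pQ pQ1 EQ1 Qabcd udet uxs sxs Qxs Dxs fibre.
have sv := etale_closure_values ffK algKbar char0 pQ1 (range_subfield iota).
apply: (no_value Q1 _ _ y (sv _) (KM _ Ky) yn0 EQ1 Hy).
by move=> _ [x _ <-]; exists (i x).
Qed.
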